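(* Let $w\in C([0,1];H^{3}(\mathbb{R}^{2}))\cap C^{1}([0,1];L^{2}(\mathbb{R}^{2}))$ be a function such that for all $\beta>0$: (i) $w$ is bounded from $[0,1]$ with values in $H^{3}(e^{2\beta|x|}e^{2\beta|y|}\,dx\,dy)$, and (ii) $w'\in L^{1}([0,1];L^{2}(e^{2\beta|x|}e^{2\beta|y|}\,dx\,dy))$. Then, for all real $\lambda\neq 0$, \[ \|e^{\lambda x}w\|\leq \|e^{\lambda x}w(0)\|_{L^{2}(\mathbb{R}^{2})}+\|e^{\lambda x}w(1)\|_{L^{2}(\mathbb{R}^{2})}+\|e^{\lambda x}(w'+\partial_{x}^{3}w+\partial_{x}\partial_{y}^{2}w)\|, \] where $\|\cdot\|:=\|\cdot\|_{L^{2}(\mathbb{R}^{2}\times[0,1])}$. Likewise, for all real $\lambda\neq 0$, \[ \|e^{\lambda y}w\|\leq \|e^{\lambda y}w(0)\|_{L^{2}(\mathbb{R}^{2})}+\|e^{\lambda y}w(1)\|_{L^{2}(\mathbb{R}^{2})}+\|e^{\lambda y}(w'+\partial_{x}^{3}w+\partial_{x}\partial_{y}^{2}w)\|. \]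
   Context: $(x,y)$ are the variables in $\mathbb{R}^2$, $t\in[0,1]$ is time, and $w'$ is the derivative of the $C^1$ map $t\mapsto w(t)\in L^2(\mathbb{R}^2)$. For a positive weight $\omega(x,y)$, $L^2(\omega\,dx\,dy)$ is the space of measurable $f$ on $\mathbb{R}^2$ with $\int_{\mathbb{R}^2}|f|^2\omega\,dx\,dy<\infty$, and $f\in H^k(\omega\,dx\,dy)$ means that $\partial^\alpha f\in L^2(\omega\,dx\,dy)$ for all multi-indices $\alpha=(\alpha_1,\alpha_2)$ with $|\alpha|\le k$. ''$w$ is bounded from $[0,1]$ with values in $H^k(\omega\,dx\,dy)$'' means that $w(t)\in H^k(\omega\,dx\,dy)$ for every $t\in[0,1]$ and $\sup_{t\in[0,1]}\sum_{|\alpha|\le k}\|\partial^\alpha w(t)\|_{L^2(\omega\,dx\,dy)}<\infty$. An $L^2(\mathbb{R}^2\times[0,1])$ norm is understood to be $+\infty$ if the function is not square integrable. *)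

(* Defs.v *)
From HB Require Import structures.
From mathcomp Require Export all_boot all_order all_algebra.
From mathcomp Require Export complex.
From mathcomp Require Export all_classical all_reals all_analysis.
From mathcomp Require Export measurable_realfun.
Export Order.TTheory GRing.Theory Num.Theory numFieldNormedType.Exports.

Set Implicit Arguments.
Unset Strict Implicit.
Unset Printing Implicit Defensive.

Local Open Scope classical_set_scope.
Local Open Scope ring_scope.
Local Open Scope complex_scope.

(* Functions on the plane are complex valued, real-valued ones being the
   special case of zero imaginary part. A class of functions modulo almost
   everywhere equality is given by a Borel representative R * R -> R[i]; the
   notions below do not depend on its choice. *)

Local Notation normc := ComplexField.Normc.normc.

Definition leb2 (R : realType) :=
  (@lebesgue_measure R \x @lebesgue_measure R)%E.

HB.instance Definition _ (R : realType) := Measure.on (@leb2 R).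

(* The library proves this but does not make it a canonical instance. *)
Lemma leb2_sigma_finite (R : realType) : sigma_finite setT (@leb2 R).
Proof.
have /sigma_finiteP[F [TF ndF Foo]] := sigma_finiteT (@lebesgue_measure R).
exists (fun n => F n `*` F n).
  rewrite -setXTT TF predeqE => -[x y]; split.
    move=> [/= [n _ Fnx] [k _ Fky]]; exists (maxn n k) => //; split.
    - by move: x Fnx; exact/subsetPset/ndF/leq_maxl.
    - by move: y Fky; exact/subsetPset/ndF/leq_maxr.
  by move=> [n _ []/= ? ?]; split; exists n.
move=> k; have [mF Fk] := Foo k; split; first exact: measurableX.
by rewrite /leb2 product_measure1E// lte_mul_pinfty// ge0_fin_numE.
Qed.

HB.instance Definition _ (R : realType) :=
  Measure_isSigmaFinite.Build _ _ R (@leb2 R) (@leb2_sigma_finite R).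

Definition cmeasurable d (T : measurableType d) (R : realType)
    (f : T -> R[i]) : Prop :=
  measurable_fun setT (fun z => complex.Re (f z)) /\
  measurable_fun setT (fun z => complex.Im (f z)).

Definition cintegral (R : realType) (f : R * R -> R[i]) : R[i] :=
  (\int[@leb2 R]_z complex.Re (f z))%R +i* (\int[@leb2 R]_z complex.Im (f z))%R.

Definition L2norm (R : realType) (om : R * R -> R) (f : R * R -> R[i]) :
    \bar R :=
  ((\int[@leb2 R]_z (normc (f z) ^+ 2 * om z)%:E) `^ 2^-1)%E.

Definition inL2 (R : realType) (om : R * R -> R) (f : R * R -> R[i]) : Prop :=
  cmeasurable f /\ (L2norm om f < +oo)%E.

Definition pderiv (R : realType) (a b : nat) (phi : R * R -> R) : R * R -> R :=
  let dx (g : R * R -> R) (z : R * R) : R := 'D_((1, 0) : R * R) g z in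
  let dy (g : R * R -> R) (z : R * R) : R := 'D_((0, 1) : R * R) g z in
  iter a dx (iter b dy phi).

(* C^oo: all iterated directional derivatives exist and are continuous. *)
Definition smooth2 (R : realType) (phi : R * R -> R) : Prop :=
  forall s : seq (R * R),
    let g := foldr (fun (v : R * R) (h : R * R -> R) z => 'D_v h z) phi s in
    continuous g /\ forall z v, derivable g z v.

Definition test_function (R : realType) (phi : R * R -> R) : Prop :=
  smooth2 phi /\ compact (closure [set z | phi z != 0]).

Definition locally_integrable2 (R : realType) (f : R * R -> R[i]) : Prop :=
  cmeasurable f /\
  forall K : set (R * R), compact K ->
    (\int[@leb2 R]_(z in K) (normc (f z))%:E < +oo)%E.

(* g is the weak derivative of f of multi-index (a, b). Real test functions
   suffice, the pairing with them being complex valued. *)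
Definition is_wderiv (R : realType) (a b : nat) (f g : R * R -> R[i]) : Prop :=
  [/\ locally_integrable2 f, locally_integrable2 g &
   forall phi : R * R -> R, test_function phi ->
     cintegral (fun z => f z * (pderiv a b phi z)%:C) =
     (-1) ^+ (a + b) * cintegral (fun z => g z * (phi z)%:C)].

(* A representative of the weak derivative when there is one, 0 otherwise. *)
Definition wderiv (R : realType) (a b : nat) (f : R * R -> R[i]) :
    R * R -> R[i] :=
  xget (fun=> 0) [set g | is_wderiv a b f g].

Definition inH (R : realType) (om : R * R -> R) (k : nat)
    (f : R * R -> R[i]) : Prop :=
  forall a b : nat, (a + b <= k)%N ->
    (exists g, is_wderiv a b f g) /\ inL2 om (wderiv a b f).

Definition Hnorm (R : realType) (om : R * R -> R) (k : nat)
    (f : R * R -> R[i]) : \bar R :=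
  (\sum_(a < k.+1) \sum_(b < k.+1 | (a + b <= k)%N) L2norm om (wderiv a b f))%E.

Definition unit_weight (R : realType) : R * R -> R := fun=> 1.

Definition exp_weight (R : realType) (beta : R) : R * R -> R :=
  fun z => expR (2 * beta * `|z.1|) * expR (2 * beta * `|z.2|).

(* A curve t |-> f t is only considered for t in [0, 1]; it is allowed to take
   arbitrary values for the other t. *)

Definition continuous_curve (R : realType) (X : (R * R -> R[i]) -> Prop)
    (N : (R * R -> R[i]) -> \bar R) (f : R -> R * R -> R[i]) : Prop :=
  (forall t, t \in `[0, 1] -> X (f t)) /\
  forall t, t \in `[0, 1] ->
    N (fun z => f s z - f t z) @[s --> within `[0, 1] (nbhs t)] --> 0%E.

Definition C0_H (R : realType) (k : nat) (f : R -> R * R -> R[i]) : Prop :=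
  continuous_curve (inH (@unit_weight R) k) (Hnorm (@unit_weight R) k) f.

Definition C0_L2 (R : realType) (f : R -> R * R -> R[i]) : Prop :=
  continuous_curve (inL2 (@unit_weight R)) (L2norm (@unit_weight R)) f.

(* f is in C^1([0,1]; L^2(R^2)) with derivative f'; the derivative is one-sided
   at the endpoints. *)
Definition C1_L2 (R : realType) (f f' : R -> R * R -> R[i]) : Prop :=
  [/\ C0_L2 f, C0_L2 f' &
   forall t, t \in `[0, 1] ->
     L2norm (@unit_weight R)
       (fun z => ((s - t)^-1)%:C * (f s z - f t z) - f' t z)
       @[s --> within `[0, 1] (t^')] --> 0%E].

Definition bounded_in_H (R : realType) (om : R * R -> R) (k : nat)
    (f : R -> R * R -> R[i]) : Prop :=
  (forall t, t \in `[0, 1] -> inH om k (f t)) /\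
  (ereal_sup [set Hnorm om k (f t) | t in `[0%R, 1%R]] < +oo)%E.

Definition simple_curve (R : realType) (om : R * R -> R)
    (s : R -> R * R -> R[i]) : Prop :=
  exists (n : nat) (A : 'I_n -> set R) (c : 'I_n -> R * R -> R[i]),
    [/\ forall i, measurable (A i), forall i, inL2 om (c i) &
     s = fun t z => \sum_(i < n) (\1_(A i) t)%:C * c i z].

(* Bochner space L^1([0,1]; L^2(om)): strongly measurable curves (almost
   everywhere limits of simple ones) with integrable norm. *)
Definition bochner_L1 (R : realType) (om : R * R -> R)
    (f : R -> R * R -> R[i]) : Prop :=
  [/\ {ae @lebesgue_measure R, forall t, t \in `[0, 1] -> inL2 om (f t)},
   exists s : nat -> R -> R * R -> R[i],
     (forall n, simple_curve om (s n)) /\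
     {ae @lebesgue_measure R, forall t, t \in `[0, 1] ->
       L2norm om (fun z => s n t z - f t z) @[n --> \oo] --> 0%E} &
   (\int[@lebesgue_measure R]_(t in `[0%R, 1%R]) L2norm om (f t) < +oo)%E].

(* Norm of L^2(R^2 x [0,1]), for a function given by its time slices f t, with
   the time integral outermost, so that it does not depend on the
   representatives chosen for the slices; see st_normE. *)
Definition st_norm (R : realType) (f : R -> R * R -> R[i]) : \bar R :=
  ((\int[@lebesgue_measure R]_(t in `[0%R, 1%R])
      \int[@leb2 R]_z (normc (f t z) ^+ 2)%:E) `^ 2^-1)%E.

(* On jointly measurable functions, st_norm is the L^2 norm for Lebesgue measure
   on R^2 x [0,1]. *)
Lemma st_normE (R : realType) (f : R -> R * R -> R[i]) :
  cmeasurable (fun p : (R * R) * R => f p.2 p.1) ->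
  st_norm f =
  ((\int[(@leb2 R \x @lebesgue_measure R)%E]_(p in setT `*` `[0%R, 1%R])
      (normc (f p.2 p.1) ^+ 2)%:E) `^ 2^-1)%E.
Proof.
move=> [mRe mIm]; congr (_ `^ _)%E.
have mf : measurable_fun setT
    (fun p : (R * R) * R => (normc (f p.2 p.1) ^+ 2)%:E).
  apply/measurable_EFinP; rewrite [X in measurable_fun _ X](_ : _ =
    (fun p => complex.Re (f p.2 p.1) ^+ 2 + complex.Im (f p.2 p.1) ^+ 2)).
    by apply: measurable_funD; exact: measurable_funX.
  apply/funext => p; case: (f p.2 p.1) => a b /=.
  by rewrite sqr_sqrtr// addr_ge0// sqr_ge0.
rewrite integral_mkcond [in RHS]integral_mkcond.
rewrite fubini_tonelli2; last 2 first.
- apply/(measurable_restrictT _ _).1 => //; first exact: measurableX.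
  exact: measurable_funTS.
- by move=> p; apply: erestrict_ge0 => q _; rewrite lee_fin sqr_ge0.
apply: eq_integral => t _; rewrite /fubini_G patchE; case: ifPn => tI.
  apply: eq_integral => z _; rewrite patchE ifT//.
  by rewrite inE; split => //; rewrite inE in tI.
rewrite integral0_eq// => z _; rewrite patchE ifF//.
by apply/negbTE; apply: contra tI; rewrite !inE => -[].
Qed.

(* Main.v *)
Require Import Defs.
From mathcomp Require Import ring lra.

(* The conjugate of d_t + d_x^3 + d_x d_y^2 by e^(al x + ga y) is d_t + A + S, where A
   is skew-adjoint, S is symmetric, and both have constant coefficients, so that
   <A g, S g> = 0. Let g = e^(al x + ga y) w and h = g' + A g + S g, and put
   N = |g|^2, Q = <g, S g>. Then
     N' = 2 <h, g> - 2 Q  and  Q' = 2 <h, S g> - 2 |S g|^2 <= |h|^2 / 2,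
   hence Phi(t) = (t - 1/2) N - t (1 - t) Q satisfies N <= 2 Phi' + |h|^2 on [0, 1].
   Integrating, int N <= N(0) + N(1) + int |h|^2, which is stronger than the claim.
   As N and Q come from symmetric bilinear forms in w, N' and Q' are the pairings of
   2 w' with e^(2 al x + 2 ga y) times derivatives of w, so that N and Q are C^1 in t
   although e^(al x + ga y) w'(t) need not be square integrable for every t. The
   integrations by parts rest on the fact that a function with integrable weak
   derivative is, on almost every line, a primitive of it. All operators being real,
   real and imaginary parts are treated separately. *)

(** The weights of Phi: t - 1/2 is the primitive of 1 for which N(0) and N(1) enter with the same
    factor 1/2, and t (1 - t) has derivative 1 - 2 t, which makes the terms in Q cancel: Phi' = N +
    (2 t - 1) <h, g> - t (1 - t) Q'. As t (1 - t) is nonnegative, the upper bound on Q' has the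
    right sign; as it vanishes at 0 and 1, no value of Q survives the integration. Taking 2 Phi'
    rather than Phi' leaves one N to absorb <h, g>. The obstacle is regularity in time: with
    exponential weights only bounds on w and its derivatives are available, continuity and
    differentiability in time only without weight. Since S has order two, N and Q require continuity
    in time of the weighted derivatives up to order two, and this is obtained by interpolation with
    the bounds. The operator A, of order three, occurs at fixed times only, where skewness removes
    it. At a time at which h is not square integrable, the inequality for N holds because its
    right-hand side is +oo. *)

Set Implicit Arguments.
Unset Strict Implicit.
Unset Printing Implicit Defensive.
Local Open Scope classical_set_scope.
Local Open Scope ring_scope.

(** * Smooth functions of one variable *)

Section smooth_functions_of_one_variable.
Context {R : realType}.
Implicit Types (f g : R -> R) (a b : R -> R).

Fixpoint Cn (n : nat) f : Prop :=
  if n is n'.+1 then (forall x : R, derivable f x 1) /\ Cn n' (derive1 f)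
  else continuous f.

Definition smooth1 f := forall n, Cn n f.

Lemma derivable_continuous f : (forall x : R, derivable f x 1) -> continuous f.
Proof. by move=> df x; exact/differentiable_continuous/derivable1_diffP. Qed.

Lemma CnW n f : Cn n.+1 f -> Cn n f.
Proof.
elim: n f => [|n IH] f [df]; first by move=> _; exact: derivable_continuous.
by case=> ddf c; split => //; exact: IH.
Qed.

Lemma CnS n f (df : R -> R) :
  (forall x : R, is_derive x 1 f (df x)) -> Cn n df -> Cn n.+1 f.
Proof.
move=> fdf cdf; split; first by move=> x; have [] := fdf x.
suff -> : (derive1 f) = df by [].
by apply/funext => x; rewrite derive1E; exact: derive_val.
Qed.

Lemma Cn_is_derive n f (x : R) : Cn n.+1 f -> is_derive x 1 f ((derive1 f) x).
Proof. by move=> [df _]; rewrite derive1E; exact: (DeriveDef (df x) erefl). Qed.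

Lemma CnD n f g : Cn n f -> Cn n g -> Cn n (fun x => f x + g x).
Proof.
elim: n f g => [|n IH] f g cf cg; first by move=> x; apply: cvgD; [exact: cf|exact: cg].
apply: (@CnS _ _ (fun x => (derive1 f) x + (derive1 g) x)).
  by move=> x; apply: is_deriveD;
    [exact: (Cn_is_derive _ cf)|exact: (Cn_is_derive _ cg)].
by apply: IH; [exact: cf.2|exact: cg.2].
Qed.

Lemma CnM n f g : Cn n f -> Cn n g -> Cn n (fun x => f x * g x).
Proof.
elim: n f g => [|n IH] f g cf cg; first by move=> x; apply: cvgM; [exact: cf|exact: cg].
apply: (@CnS _ _ (fun x => f x * (derive1 g) x + g x * (derive1 f) x)).
  by move=> x; apply: is_deriveM;
    [exact: (Cn_is_derive _ cf)|exact: (Cn_is_derive _ cg)].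
by apply: CnD; apply: IH; [exact: CnW|exact: cg.2|exact: CnW|exact: cf.2].
Qed.

Lemma Cn_cst n (c : R) : Cn n (fun=> c).
Proof.
elim: n c => [|n IH] c; first by move=> x; exact: cvg_cst.
exact: (CnS (fun x => is_derive_cst c x 1)).
Qed.

Lemma is_derive_affine (k c x : R) : is_derive x 1 (fun x => k * x + c) k.
Proof.
have := is_deriveD (is_deriveZ k (is_derive_id x 1)) (is_derive_cst c x 1).
by rewrite addr0 /GRing.scale/= mulr1.
Qed.

Lemma Cn_affine n f (k c : R) : Cn n f -> Cn n (fun x => f (k * x + c)).
Proof.
elim: n f => [|n IH] f cf.
  move=> x; apply: (@continuous_comp _ _ _ (fun x => k * x + c)); last exact: cf.
  by apply: cvgD; [exact: mulrl_continuous|exact: cvg_cst].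
apply: (@CnS _ _ (fun x => (derive1 f) (k * x + c) * k)); last first.
  by apply: CnM; [apply: IH; exact: cf.2|exact: Cn_cst].
by move=> x; exact: (is_derive1_comp (Cn_is_derive _ cf) (is_derive_affine k c x)).
Qed.

Lemma Cn_expR n : Cn n expR.
Proof.
elim: n => [|n IH]; first exact: continuous_expR.
exact: (CnS (@is_derive_expR R)).
Qed.

Lemma smooth1M f g : smooth1 f -> smooth1 g -> smooth1 (fun x => f x * g x).
Proof. by move=> cf cg n; exact: CnM. Qed.

Lemma smooth1_cst (c : R) : smooth1 (fun=> c).
Proof. by move=> n; exact: Cn_cst. Qed.

Lemma smooth1_affine f (k c : R) : smooth1 f -> smooth1 (fun x => f (k * x + c)).
Proof. by move=> cf n; exact: Cn_affine. Qed.

Lemma smooth1_expR (l : R) : smooth1 (fun x => expR (l * x)).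
Proof.
move=> n; have := @Cn_affine n expR l 0 (Cn_expR n).
by under eq_fun do rewrite addr0.
Qed.

Lemma smooth1_derive f : smooth1 f -> smooth1 (derive1 f).
Proof. by move=> cf n; exact: (cf n.+1).2. Qed.

Lemma smooth1_is_derive f (x : R) : smooth1 f -> is_derive x 1 f ((derive1 f) x).
Proof. by move=> cf; exact: (@Cn_is_derive 0 _ _ (cf 1)). Qed.

Lemma smooth1_continuous f : smooth1 f -> continuous f.
Proof. by move=> cf; exact: (cf 0). Qed.

Lemma smooth1_antideriv f F :
  (forall x : R, is_derive x 1 F (f x)) -> smooth1 f -> smooth1 F.
Proof.
move=> dF cf [|n]; last exact: (CnS dF).
by apply: derivable_continuous => x; have [] := dF x.
Qed.

(* The derivatives of exp(-1/x) (x > 0) are combinations of the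
   x^-k exp(-1/x). *)
Definition flat (k : nat) (x : R) : R :=
  if 0 < x then x^-1 ^+ k * expR (- x^-1) else 0.

(** For n > 0, e^y = (e^(y/n))^n >= (y/n)^n, because e^s >= 1 + s. *)
Lemma exprn_expRN_le n (y : R) : 0 <= y -> y ^+ n * expR (- y) <= n%:R ^+ n.
Proof.
case: n => [|n] y0; first by rewrite !expr0 mul1r -expR0 ler_expR oppr_le0.
rewrite expRN ler_pdivrMr ?expR_gt0//.
have -> : expR y = expR (y / n.+1%:R) ^+ n.+1.
  by rewrite -expRM_natl mulrC divfK// pnatr_eq0.
rewrite -exprMn lerXn2r// ?nnegrE ?mulr_ge0 ?expR_ge0//.
rewrite -ler_pdivrMl ?ltr0n// mulrC.
by apply: le_trans (expR_ge1Dx _); rewrite lerDr.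
Qed.

(** The previous bound at y = 1/x with exponent k + 2: the two powers in excess become x^2, which is
    what differentiability at 0 requires. *)
Lemma flat_le k (x : R) : `|flat k x| <= k.+2%:R ^+ k.+2 * `|x| ^+ 2.
Proof.
rewrite /flat; case: ifPn => x0; last first.
  by rewrite normr0 mulr_ge0// exprn_ge0.
rewrite ger0_norm; last by rewrite mulr_ge0// ?expR_ge0// exprn_ge0// invr_ge0 ltW.
rewrite (gtr0_norm x0) -ler_pdivrMr ?exprn_gt0//.
have := @exprn_expRN_le k.+2 x^-1; rewrite invr_ge0 (ltW x0) => /(_ isT).
apply: le_trans; rewrite -exprVn mulrAC -[k.+2]addn2 exprD.
by [].
Qed.

Lemma is_derive_flat k (x : R) :
  is_derive x 1 (flat k) (flat k.+2 x - k%:R * flat k.+1 x).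
Proof.
have [x0|x0|->] := ltgtP x 0.
- have -> : flat k.+2 x - k%:R * flat k.+1 x = 0.
    by rewrite /flat !ifF ?mulr0 ?subr0//; apply/negbTE; rewrite -leNgt ltW.
  apply: (@near_eq_is_derive _ _ _ (cst 0)).
  near=> y; rewrite /flat ifF//; apply/negbTE; rewrite -leNgt ltW//.
  by near: y; exact: lt_nbhsl.
- suff dF : is_derive x 1 (fun y : R => y^-1 ^+ k * expR (- y^-1))
      (flat k.+2 x - k%:R * flat k.+1 x).
    apply: near_eq_is_derive dF.
    by near=> y; rewrite /flat ifT//; near: y; exact: lt_nbhsr.
  rewrite /flat x0.
  have xn0 : x != 0 by rewrite gt_eqF.
  have dV : is_derive x 1 (fun y : R => y^-1) (- x ^- 2).
    have := @is_deriveV R id x 1 1 xn0 (is_derive_id x 1).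
    by rewrite /GRing.scale/= mulr1.
  have d1 : is_derive x 1 (fun y : R => expR (- y^-1)) (expR (- x^-1) * x ^- 2).
    have dN : is_derive x 1 (fun y : R => - y^-1) (x ^- 2).
      by have := is_deriveN dV; rewrite opprK.
    by have := @is_derive1_comp R expR (fun y : R => - y^-1) x _ _
      (is_derive_expR (- x^-1)) dN.
  have d2 := is_deriveX k dV; rewrite exprfctE in d2.
  have d3 := is_deriveM d2 d1.
  apply: (is_derive_eq d3); rewrite /GRing.scale/=.
  set e := expR _; rewrite -!exprVn -mulr_natr.
  by case: k {d2 d3} => [|k] /=; rewrite !exprS ?expr0; ring.
(* At the origin the two-sided difference quotient is O(|h|) by [flat_le]. *)
- have -> : flat k.+2 0 - k%:R * flat k.+1 0 = 0.
    by rewrite /flat ltxx mulr0 subr0.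
  have f0 : flat k 0 = 0 by rewrite /flat ltxx.
  suff H : h^-1 *: (flat k (h + 0) - flat k 0) @[h --> 0^'] --> (0:R).
    apply: derive.DeriveDef.
      apply/cvg_ex; exists 0; under eq_fun do rewrite [_ *: 1]mulr1; exact: H.
    rewrite /derive; under eq_fun do rewrite [_ *: 1]mulr1.
    exact: (cvg_lim (@Rhausdorff R) H).
  apply/cvgr0Pnorm_le => e e0.
  have K0 : 0 < k.+2%:R ^+ k.+2 :> R by rewrite exprn_gt0.
  near=> h; have hn0 : h != 0 by near: h; exact: nbhs_dnbhs_neq.
  rewrite f0 subr0 addr0 normrZ normfV mulrC ler_pdivrMr ?normr_gt0//.
  apply: (le_trans (flat_le k h)); rewrite expr2 mulrA ler_wpM2r//.
  rewrite -ler_pdivlMl// ltW//; near: h.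
  apply: dnbhs0_lt; by rewrite mulr_gt0// invr_gt0.
Unshelve. all: by end_near. Qed.

Lemma Cn_flat n k : Cn n (flat k).
Proof.
elim: n k => [|n IH] k.
  by apply: derivable_continuous => x; have [] := is_derive_flat k x.
apply: (CnS (is_derive_flat k)); apply: CnD => //.
have := CnM (Cn_cst n (-1)) (CnM (Cn_cst n k%:R) (IH k.+1)).
by under eq_fun do rewrite mulN1r.
Qed.

Lemma flat0_ge0 (x : R) : 0 <= flat 0 x.
Proof. by rewrite /flat; case: ifP => // _; rewrite expr0 mul1r expR_ge0. Qed.

Lemma flat0_le1 (x : R) : flat 0 x <= 1.
Proof.
rewrite /flat; case: ifP => // x0; rewrite expr0 mul1r -expR0 ler_expR oppr_le0.
by rewrite invr_ge0 ltW.
Qed.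

(** A smooth approximation from below of the indicator of ]p, q[: it is positive exactly there, and
    its edges steepen with n. It takes the place of a mollified indicator and avoids
    convolutions. *)
Definition bump (n : nat) (p q x : R) : R :=
  flat 0 (n.+1%:R * (x - p)) * flat 0 (n.+1%:R * (q - x)).

Lemma smooth1_bump n p q : smooth1 (bump n p q).
Proof.
move=> m; rewrite /bump; apply: CnM.
  have := Cn_affine n.+1%:R (- (n.+1%:R * p)) (Cn_flat m 0).
  by under eq_fun do rewrite -mulrBr.
have := Cn_affine (- n.+1%:R) (n.+1%:R * q) (Cn_flat m 0).
by under eq_fun do rewrite mulNr addrC -mulrBr.
Qed.

Lemma bump_ge0 n p q x : 0 <= bump n p q x.
Proof. by rewrite mulr_ge0// flat0_ge0. Qed.

Lemma bump_le1 n p q x : bump n p q x <= 1.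
Proof. by rewrite mulr_ile1// ?flat0_ge0 ?flat0_le1. Qed.

Lemma bump_norm_le1 n p q x : `|bump n p q x| <= 1.
Proof. by rewrite ger0_norm ?bump_ge0// bump_le1. Qed.

Lemma bump_out n p q x : x \notin `]p, q[ -> bump n p q x = 0.
Proof.
rewrite in_itv/= negb_and -!leNgt /bump /flat => /orP[h|h].
  by rewrite ifF ?mul0r//; apply/negbTE; rewrite -leNgt pmulr_rle0// subr_le0.
by rewrite mulrC ifF ?mul0r//; apply/negbTE; rewrite -leNgt pmulr_rle0// subr_le0.
Qed.

Lemma flat0_cvg (x : R) : 0 < x -> flat 0 (n.+1%:R * x) @[n --> \oo] --> (1 : R).
Proof.
move=> x0.
have -> : (fun n => flat 0 (n.+1%:R * x)) = (fun n => expR (- (n.+1%:R^-1 * x^-1))).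
  apply/funext => n.
  by rewrite /flat ifT ?mulr_gt0// expr0 mul1r invfM.
suff : expR (- (n.+1%:R^-1 * x^-1)) @[n --> \oo] --> expR (- (0 * x^-1)).
  by rewrite mul0r oppr0 expR0.
apply: continuous_cvg; first exact: continuous_expR.
apply: cvgN; apply: cvgM; last exact: cvg_cst.
exact: cvg_harmonic.
Qed.

Lemma bump_cvg (p q x : R) : bump n p q x @[n --> \oo] --> (\1_`]p, q[ x : R).
Proof.
rewrite indicE; case: (boolP (x \in `]p, q[)) => xpq.
  rewrite mem_set//= -[1%:R]mulr1; move: xpq; rewrite in_itv/= => /andP[px xq].
  by apply: cvgM; apply: flat0_cvg; rewrite subr_gt0.
rewrite memNset/=; last by move=> h; rewrite h in xpq.
under eq_fun do rewrite bump_out//; exact: cvg_cst.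
Qed.

End smooth_functions_of_one_variable.

(** * Integration of real functions *)

Section real_integrals.
Context d (T : measurableType d) (R : realType) (mu : {measure set T -> \bar R}).
Implicit Types (f g : T -> R).

Definition rintegrable f := mu.-integrable setT (EFin \o f).

Lemma rintegrableP f : rintegrable f ->
  measurable_fun setT f /\ (\int[mu]_x `|f x|%:E < +oo)%E.
Proof. by case/integrableP => /measurable_EFinP. Qed.

Lemma rintegrable_meas f : rintegrable f -> measurable_fun setT f.
Proof. by case/rintegrableP. Qed.

Lemma rintegrable_le f g : measurable_fun setT f -> rintegrable g ->
  (forall x, `|f x| <= g x) -> rintegrable f.
Proof.
move=> mf ig fg; apply: (le_integrable _ _ _ ig) => //; first exact/measurable_EFinP.
by move=> x _ /=; rewrite lee_fin (le_trans (fg x))// ler_norm.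
Qed.

Lemma rintegrable_norm f : rintegrable f -> rintegrable (fun x => `|f x|).
Proof.
move=> /[dup] /rintegrable_meas mf.
by move/integrable_abse; apply: eq_integrable.
Qed.

Lemma rintegrableD f g : rintegrable f -> rintegrable g ->
  rintegrable (fun x => f x + g x).
Proof. by move=> intf intg; apply: eq_integrable (integrableD _ intf intg). Qed.

Lemma rintegrableZ (k : R) f : rintegrable f -> rintegrable (fun x => k * f x).
Proof. by move=> intf; apply: eq_integrable (integrableZl _ k intf). Qed.

Lemma rintegrableB f g : rintegrable f -> rintegrable g ->
  rintegrable (fun x => f x - g x).
Proof.
move=> intf /(rintegrableZ (-1)) intg.
have := rintegrableD intf intg; by under eq_fun do rewrite mulN1r.
Qed.

Lemma rintegrable_mul_bounded f g (C : R) : rintegrable f ->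
  measurable_fun setT g -> (forall x, `|g x| <= C) ->
  rintegrable (fun x => f x * g x).
Proof.
move=> intf mg gC; apply: (@rintegrable_le _ (fun x => C * `|f x|)).
- by apply: measurable_funM => //; exact: rintegrable_meas intf.
- exact/rintegrableZ/rintegrable_norm.
- by move=> x; rewrite normrM mulrC ler_wpM2r.
Qed.

Lemma rdominated_cvg (f_ : nat -> T -> R) f g :
  (forall n, measurable_fun setT (f_ n)) -> measurable_fun setT f ->
  (forall x, f_ n x @[n --> \oo] --> f x) -> rintegrable g ->
  (forall n x, `|f_ n x| <= g x) ->
  \int[mu]_x f_ n x @[n --> \oo] --> \int[mu]_x f x.
Proof.
move=> mf_ mf f_f ig f_g.
have [i1 _ H] : [/\ mu.-integrable setT (EFin \o f),
    (\int[mu]_x `|(f_ n x)%:E - (f x)%:E|)%E @[n --> \oo] --> 0%E &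
    (\int[mu]_x (f_ n x)%:E)%E @[n --> \oo] --> (\int[mu]_x (f x)%:E)%E].
  apply: (@dominated_convergence _ _ _ mu setT measurableT
    (fun n => EFin \o f_ n) (EFin \o f) (EFin \o g)) => //.
  - by move=> n; exact/measurable_EFinP.
  - exact/measurable_EFinP.
  - by apply: aeW => x _; apply: cvg_EFin; [exact: nearW|exact: f_f].
  - by apply: aeW => x n _; rewrite /= lee_fin.
apply: fine_cvg; rewrite fineK//; exact: integrable_fin_num.
Qed.

Lemma eq_Rint f g : (forall x, f x = g x) -> \int[mu]_x f x = \int[mu]_x g x.
Proof. by move=> fg; apply: eq_Rintegral => x _. Qed.

Lemma Rint0 : \int[mu]_x (0 : R) = 0.
Proof. by rewrite /Rintegral integral0. Qed.

Lemma RintD f g : rintegrable f -> rintegrable g ->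
  \int[mu]_x (f x + g x) = \int[mu]_x f x + \int[mu]_x g x.
Proof. by move=> intf intg; rewrite RintegralD. Qed.

Lemma RintZ (k : R) f : rintegrable f ->
  \int[mu]_x (k * f x) = k * \int[mu]_x f x.
Proof. by move=> intf; rewrite RintegralZl. Qed.

Lemma RintB f g : rintegrable f -> rintegrable g ->
  \int[mu]_x (f x - g x) = \int[mu]_x f x - \int[mu]_x g x.
Proof. by move=> intf intg; rewrite RintegralB. Qed.

Lemma RintN f : rintegrable f -> \int[mu]_x (- f x) = - \int[mu]_x f x.
Proof.
by move=> intf; rewrite -mulN1r -RintZ//; apply: eq_Rint => x; rewrite mulN1r.
Qed.

End real_integrals.
Notation rintegrable2 := (rintegrable (@leb2 _)).
Notation "\int2_ z F" := (\int[@leb2 _]_(z in setT) F)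
  (at level 36, F at level 36, z name).

(** * Compact support, boundedness and dilated cutoff functions *)

Section cutoff.
Context {R : realType}.
Implicit Types (a b k : R -> R).

Definition csupp a := exists M : R, forall x, M <= `|x| -> a x = 0.

Definition bounded1 a := exists C : R, forall x, `|a x| <= C.

Lemma bounded1_ge0 a : bounded1 a -> exists2 C : R, 0 <= C & forall x, `|a x| <= C.
Proof. by case=> C aC; exists C => //; exact: le_trans (aC 0). Qed.

Lemma csupp_bounded a : continuous a -> csupp a -> bounded1 a.
Proof.
move=> ca [M aM].
have : compact (a @` `[- `|M|, `|M|]).
  apply: continuous_compact; last exact: segment_compact.
  exact: continuous_subspaceT.
move=> /compact_bounded[C [_ /(_ (`|C| + 1))]].
rewrite (le_lt_trans (ler_norm C)) ?ltrDl// => /(_ isT) H.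
exists (`|C| + 1) => x; have [xM|xM] := leP M `|x|.
  by rewrite aM// normr0 addr_ge0.
apply: H; exists x => //=; rewrite in_itv/= -ler_norml.
exact: le_trans (ltW xM) (ler_norm _).
Qed.

Lemma smooth1_csupp_derive a : smooth1 a -> csupp a -> csupp (derive1 a).
Proof.
(* The margin 1 leaves a whole ball around x on which [a] vanishes. *)
move=> sa [M aM]; exists (M + 1) => x xM.
rewrite derive1E; apply: (@derive_val _ _ _ _ _ a).
apply: (@near_eq_is_derive _ _ _ (cst 0)).
near=> y; apply/esym/aM.
have yx : `|x - y| < 1 by near: y; exact: (@nbhsx_ballx _ _ x 1).
have := ler_distD x 0 y; rewrite !sub0r !normrN.
have := ler_normB y (y - x); rewrite opprB addrCA subrr addr0.
have : `|y - x| = `|x - y| by rewrite distrC.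
by move: xM yx; lra.
Unshelve. all: by end_near. Qed.

(** Normalised to the value 1 at the origin, so that by continuity its dilations tend to 1
    pointwise; it has no plateau. *)
Definition cutoff1 (x : R) : R := (bump 0 (-1) 1 0)^-1 * bump 0 (-1) 1 x.

Lemma smooth1_cutoff1 : smooth1 cutoff1.
Proof. by apply: smooth1M; [exact: smooth1_cst|exact: smooth1_bump]. Qed.

Lemma cutoff10 : cutoff1 0 = 1.
Proof.
rewrite /cutoff1 mulVf// /bump !mul1r /flat subr0 opprK add0r ltr01.
by rewrite expr0 mul1r mulf_neq0// gt_eqF// expR_gt0.
Qed.

Lemma csupp_cutoff1 : csupp cutoff1.
Proof.
exists 1 => x x1; rewrite /cutoff1 [X in _ * X]bump_out ?mulr0//.
by rewrite in_itv/= -ltr_norml -leNgt.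
Qed.

(** The summand 0 gives the argument the affine form of [smooth1_affine] and [is_derive_affine]. *)
Definition cutoff (m : nat) (x : R) : R := cutoff1 (m.+1%:R^-1 * x + 0).

Lemma smooth1_cutoff m : smooth1 (cutoff m).
Proof. exact: (smooth1_affine _ _ smooth1_cutoff1). Qed.

Lemma csupp_cutoff m : csupp (cutoff m).
Proof.
have [M h] := csupp_cutoff1; exists (m.+1%:R * M) => x xM; apply: h.
by rewrite addr0 normrM gtr0_norm ?invr_gt0// ler_pdivlMl.
Qed.

Lemma cutoff_cvg (k : R -> R) x : continuous k ->
  k (m.+1%:R^-1 * x + 0) @[m --> \oo] --> k 0.
Proof.
move=> ck; suff : k (m.+1%:R^-1 * x + 0) @[m --> \oo] --> k (0 * x + 0).
  by rewrite mul0r add0r.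
apply: continuous_cvg; first exact: ck.
apply: cvgD; last exact: cvg_cst.
by apply: cvgM; [exact: (@cvg_harmonic R)|exact: cvg_cst].
Qed.

Lemma derive_cutoff m x :
  derive1 (cutoff m) x = m.+1%:R^-1 * derive1 cutoff1 (m.+1%:R^-1 * x + 0).
Proof.
have := @is_derive1_comp R cutoff1 _ x _ _
  (smooth1_is_derive (m.+1%:R^-1 * x + 0) smooth1_cutoff1)
  (is_derive_affine _ _ _).
by move=> [_ e]; rewrite derive1E mulrC; exact: e.
Qed.

End cutoff.

(** * Fubini's theorem for integrals with real values *)

Section real_fubini.
Context d1 d2 (T1 : measurableType d1) (T2 : measurableType d2) (R : realType).
Variable m1 : {sigma_finite_measure set T1 -> \bar R}.
Variable m2 : {sigma_finite_measure set T2 -> \bar R}.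
Variable f : T1 * T2 -> R.
Hypothesis intf : (m1 \x m2)%E.-integrable setT (EFin \o f).

Let mf : measurable_fun setT f.
Proof. by case/integrableP : intf => /measurable_EFinP. Qed.

(** The inner real integral is [fine] of an extended one and thus 0 where that one is infinite.
    Hence it is bounded for every y by the inner integral of |f|, which is integrable by Tonelli. *)
Lemma Rfubini2_integrable : rintegrable m2 (fun y => \int[m1]_x f (x, y)).
Proof.
apply: (@le_integrable _ _ _ m2 setT measurableT _
  (fun y => \int[m1]_x `|(f (x, y))%:E|)%E).
- apply/measurable_EFinP.
  apply: (@measurableT_comp _ _ _ _ _ _ fine); first exact: fine_measurable.
  exact: (measurable_fubini_G intf).
- move=> y _ /=; rewrite [leRHS]gee0_abs ?integral_ge0//.
  have mfy : measurable_fun setT (fun x => (f (x, y))%:E).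
    by apply/measurable_EFinP; exact: (measurableT_comp mf (measurable_pair2 y)).
  have := @le_abse_integral _ _ _ m1 setT _ measurableT mfy.
  rewrite /Rintegral; apply: le_trans.
  by case: (integral _ _ _) => [r||] /=; rewrite ?normr0 ?leey ?lexx.
- apply/integrableP; split.
    apply: (@measurable_fun_fubini_tonelli_G _ _ _ _ _ m1
      (fun z => `|(f z)%:E|%E)) => //.
    by apply: measurableT_comp => //; exact/measurable_EFinP.
  have /(integrable21ltyP _ _ _).1 := intf.
  move=> /(_ ((measurable_EFinP _ _).2 mf)); apply: le_lt_trans.
  rewrite le_eqVlt; apply/orP; left; apply/eqP; apply: eq_integral => y _.
  by rewrite gee0_abs// integral_ge0.
Qed.

Lemma Rfubini2 : \int[m2]_y (\int[m1]_x f (x, y)) = \int[(m1 \x m2)%E]_z f z.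
Proof.
rewrite [RHS]/Rintegral -(integral21_prod_meas1 intf) /Rintegral; congr fine.
apply: ae_eq_integral => //.
- exact/measurable_EFinP/rintegrable_meas/Rfubini2_integrable.
- exact: (measurable_fubini_G intf).
- move: (ae_integrable2 intf); apply: filterS => y /= iy _.
  by rewrite fineK//; exact: integrable_fin_num iy.
Qed.

Lemma slice2_integrable : {ae m2, forall y, rintegrable m1 (fun x => f (x, y))}.
Proof. exact: (ae_integrable2 intf). Qed.

Lemma Rfubini1_integrable : rintegrable m1 (fun x => \int[m2]_y f (x, y)).
Proof.
apply: (@le_integrable _ _ _ m1 setT measurableT _
  (fun x => \int[m2]_y `|(f (x, y))%:E|)%E).
- apply/measurable_EFinP.
  apply: (@measurableT_comp _ _ _ _ _ _ fine); first exact: fine_measurable.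
  exact: (measurable_fubini_F intf).
- move=> x _ /=; rewrite [leRHS]gee0_abs ?integral_ge0//.
  have mfy : measurable_fun setT (fun y => (f (x, y))%:E).
    by apply/measurable_EFinP; exact: (measurableT_comp mf (measurable_pair1 x)).
  have := @le_abse_integral _ _ _ m2 setT _ measurableT mfy.
  rewrite /Rintegral; apply: le_trans.
  by case: (integral _ _ _) => [r||] /=; rewrite ?normr0 ?leey ?lexx.
- apply/integrableP; split.
    apply: (@measurable_fun_fubini_tonelli_F _ _ _ _ _ m2
      (fun z => `|(f z)%:E|%E)) => //.
    by apply: measurableT_comp => //; exact/measurable_EFinP.
  have /(integrable12ltyP _ _ _).1 := intf.
  move=> /(_ ((measurable_EFinP _ _).2 mf)); apply: le_lt_trans.
  rewrite le_eqVlt; apply/orP; left; apply/eqP; apply: eq_integral => y _.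
  by rewrite gee0_abs// integral_ge0.
Qed.

Lemma Rfubini1 : \int[m1]_x (\int[m2]_y f (x, y)) = \int[(m1 \x m2)%E]_z f z.
Proof.
rewrite [RHS]/Rintegral -(integral12_prod_meas1 intf) /Rintegral; congr fine.
apply: ae_eq_integral => //.
- exact/measurable_EFinP/rintegrable_meas/Rfubini1_integrable.
- exact: (measurable_fubini_F intf).
- move: (ae_integrable1 intf); apply: filterS => x /= ix _.
  by rewrite fineK//; exact: integrable_fin_num ix.
Qed.

End real_fubini.

Section real_products.
Context d1 d2 (T1 : measurableType d1) (T2 : measurableType d2) (R : realType).
Variable m1 : {sigma_finite_measure set T1 -> \bar R}.
Variable m2 : {sigma_finite_measure set T2 -> \bar R}.

Lemma rintegrable_prod (g1 : T1 -> R) (g2 : T2 -> R) :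
  rintegrable m1 g1 -> rintegrable m2 g2 ->
  rintegrable (m1 \x m2)%E (fun z => g1 z.1 * g2 z.2).
Proof.
move=> i1 i2; have [mg1 h1] := rintegrableP i1; have [mg2 h2] := rintegrableP i2.
have mK : measurable_fun setT (fun z : T1 * T2 => (g1 z.1 * g2 z.2)%:E).
  by apply/measurable_EFinP; apply: measurable_funM;
    exact: measurableT_comp.
apply/(integrable12ltyP _ _ mK).
under eq_integral => x _.
  under eq_integral do rewrite /= normrM EFinM.
  rewrite ge0_integralZl//; last first.
    by apply/measurable_EFinP; exact: measurableT_comp.
  over.
rewrite ge0_integralZr//.
- by rewrite lte_mul_pinfty// ?integral_ge0// ge0_fin_numE// integral_ge0.
- by apply/measurable_EFinP; exact: measurableT_comp.
- exact: integral_ge0.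
Qed.

(** Here k need not be integrable on the product, as for the kernel g(s) 1(t <= s) of [tail], so
    Fubini does not apply. Tonelli applies to the positive and negative parts, and integrability of
    the slices allows their subtraction. *)
Lemma Rmeasurable_slice (k : T1 * T2 -> R) : measurable_fun setT k ->
  (forall y, rintegrable m1 (fun x => k (x, y))) ->
  measurable_fun setT (fun y => \int[m1]_x k (x, y)).
Proof.
move=> mk ik.
have H (h : T1 * T2 -> R) : measurable_fun setT h -> (forall z, 0 <= h z) ->
    measurable_fun setT (fun y => \int[m1]_x h (x, y)).
  move=> mh h0.
  apply: (@measurableT_comp _ _ _ _ _ _ fine); first exact: fine_measurable.
  apply: (@measurable_fun_fubini_tonelli_G _ _ _ _ _ m1 (EFin \o h)) => //.
  exact/measurable_EFinP.
have mp : measurable_fun setT (fun z => Num.max (k z) 0) by exact: measurable_maxr.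
have mn : measurable_fun setT (fun z => Num.max (- k z) 0).
  by apply: measurable_maxr => //; exact: measurableT_comp.
rewrite [X in measurable_fun _ X](_ : _ = (fun y =>
  \int[m1]_x Num.max (k (x, y)) 0 - \int[m1]_x Num.max (- k (x, y)) 0)); last first.
  apply/funext => y.
  rewrite -RintB; last 2 first.
  - apply: rintegrable_le (rintegrable_norm (ik y)) _.
      exact: (measurableT_comp mp (measurable_pair2 y)).
    by move=> x; rewrite ger0_norm ?le_max ?lexx ?orbT// ge_max ler_norm normr_ge0.
  - apply: rintegrable_le (rintegrable_norm (ik y)) _.
      exact: (measurableT_comp mn (measurable_pair2 y)).
    move=> x; rewrite ger0_norm ?le_max ?lexx ?orbT// ge_max normr_ge0 andbT.
    by rewrite -normrN ler_norm.
  apply: eq_Rint => x; have [k0|k0] := leP (k (x, y)) 0.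
    by rewrite max_l ?oppr_ge0// opprK add0r.
  by rewrite max_r ?subr0// oppr_le0 ltW.
apply: measurable_funB.
  by apply: (H _ mp) => z; rewrite le_max lexx orbT.
by apply: (H _ mn) => z; rewrite le_max lexx orbT.
Qed.

End real_products.

Section almost_everywhere.
Context d (T : measurableType d) (R : realType) (mu : {measure set T -> \bar R}).
Implicit Types P Q : T -> Prop.

Lemma ae_imp P Q : (forall x, P x -> Q x) ->
  {ae mu, forall x, P x} -> {ae mu, forall x, Q x}.
Proof.
by move=> PQ; apply: filterS => //; exact: (ae_filter_ringOfSetsType mu).
Qed.

Lemma ae_and P Q : {ae mu, forall x, P x} -> {ae mu, forall x, Q x} ->
  {ae mu, forall x, P x /\ Q x}.
Proof. by move=> aP aQ; apply: filterI => //; exact: (ae_filter_ringOfSetsType mu). Qed.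

Lemma ae_forall_count (I : countType) (P : I -> T -> Prop) :
  (forall i, {ae mu, forall x, P i x}) -> {ae mu, forall x, forall i, P i x}.
Proof.
move=> H.
have : {ae mu, forall x, forall n, if unpickle n is Some i then P i x else True}.
  apply/ae_foralln => n; case: (unpickle n) => [i|]; first exact: H.
  exact: aeW.
by apply: ae_imp => x Hx i; have := Hx (pickle i); rewrite pickleK.
Qed.

Lemma ae_eq_Rint (f g : T -> R) : measurable_fun setT f -> measurable_fun setT g ->
  {ae mu, forall x, f x = g x} -> \int[mu]_x f x = \int[mu]_x g x.
Proof.
move=> mf mg fg; rewrite /Rintegral; congr fine.
apply: ae_eq_integral => //; [exact/measurable_EFinP|exact/measurable_EFinP|].
by move: fg; apply: ae_imp => x -> _.
Qed.

End almost_everywhere.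

(** * Functions on the line whose integrals over rational intervals vanish *)

Section du_Bois_Reymond.
Context {R : realType}.
Local Notation mu := (@lebesgue_measure R).

(** Rationals accumulate at x: continuity gives g x = 0, and then the difference quotients at nearby
    rationals vanish. *)
Lemma is_derive_zero_on_rat (g : R -> R) (x dg : R) :
  is_derive x 1 g dg -> (forall q : rat, x - 1 < ratr q -> g (ratr q) = 0) -> dg = 0.
Proof.
move=> [dgx dgE] g0.
have gx0 : g x = 0.
  apply/eqP; apply: contrapT => /negP gx.
  have cg : {for x, continuous g} by exact/differentiable_continuous/derivable1_diffP.
  have : \forall y \near x, g y != 0.
    exact: (cvgr_neq0 _ cg gx).
  move=> /nbhs_ballP[e /= e0 ge].
  have /rat_in_itvoo[q] : Num.max (x - 1) (x - e) < x.
    by rewrite gt_max !gtrBl ltr01 e0.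
  rewrite in_itv/= => /andP[].
  rewrite gt_max => /andP[x1 xe] qx.
  suff /ge : ball x e (ratr q) by rewrite /= g0// eqxx.
  by rewrite /ball/= gtr0_norm ?subr_gt0//; lra.
apply/eqP; apply: contrapT => /negP dg0.
have H : h^-1 *: (g (h *: 1 + x) - g x) @[h --> 0^'] --> dg.
  by rewrite -dgE; exact: dgx.
have : \forall h \near 0^', h^-1 *: (g (h *: 1 + x) - g x) != 0.
  exact: (cvgr_neq0 _ H dg0).
move=> /nbhs_ballP[e /= e0 ge].
have /rat_in_itvoo[q] : x < x + e by rewrite ltrDl.
rewrite in_itv/= => /andP[xq qe].
have : ball 0 e (ratr q - x).
  by rewrite /ball/= sub0r normrN gtr0_norm ?subr_gt0//; lra.
move=> /ge /= /(_ _); rewrite [_ *: 1]mulr1 subrK gx0 g0; last by lra.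
by rewrite subrr scaler0 eqxx subr_eq0 gt_eqF// => /(_ isT).
Qed.

(** Lebesgue differentiation: almost everywhere f is the derivative of its primitive, which vanishes
    at the rationals. Asking only for rational end points keeps the conditions countable, so that
    they can be imposed on almost every slice at once. *)
Lemma ae_eq0_of_integral_itv (f : R -> R) : measurable_fun setT f ->
  (forall a b : R, mu.-integrable `[a, b] (EFin \o f)) ->
  (forall q r : rat, \int[mu]_(x in `]ratr q, ratr r[) f x = 0) ->
  {ae mu, forall x, f x = 0}.
Proof.
move=> mf intf f0.
have locf : locally_integrable setT f.
  split => //; first exact: openT.
  move=> K _ cK; have [M [_ KM]] := compact_bounded cK.
  have /integrableP[_] := intf (- (`|M| + 1)) (`|M| + 1).
  apply: le_lt_trans; apply: ge0_subset_integral => //.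
  - exact: compact_measurable.
  - by apply/measurable_EFinP; apply: measurableT_comp => //; exact: measurable_funTS.
  - move=> x Kx /=; rewrite in_itv/= -ler_norml; apply: KM => //.
    by rewrite (le_lt_trans (ler_norm M))// ltrDl.
(* As f need not be integrable near -oo, the primitive starts at -m, and m is varied afterwards. *)
have H (m : nat) : {ae mu, forall x, - m%:R + 1 < x -> f x = 0}.
  have := @FTC1 R f (BLeft (- m%:R)) (fun y => intf _ _) locf.
  apply: ae_imp => x /= Fx mx.
  have [|dF F'x] := Fx; first by rewrite lte_fin (le_lt_trans _ mx)// lerDl.
  apply: (@is_derive_zero_on_rat _ x (f x) (DeriveDef dF _)).
    by rewrite -derive1E.
  move=> q xq.
  have -> : (- m%:R) = ratr (- m%:R) :> R by rewrite rmorphN/= ratr_nat.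
  rewrite /Rintegral integral_itv_bndoo; first exact: f0.
  exact/measurable_funTS/measurable_EFinP.
have key (y : R) : - (Num.bound (`|y| + 1))%:R + 1 < y.
  have := @archi_boundP R (`|y| + 1) (addr_ge0 (normr_ge0 _) ler01).
  by have := ler_norm (- y); rewrite normrN; lra.
by move/ae_foralln : H; apply: ae_imp => x /= fx; exact: (fx _ (key x)).
Qed.

End du_Bois_Reymond.

(** * One-dimensional weak derivatives *)

Section one_dimensional_weak_derivatives.
Context {R : realType}.
Local Notation mu := (@lebesgue_measure R).
Local Notation rint := (rintegrable mu).

Lemma rintegrable_indic_itv (c d : R) : rint (\1_`]c, d[).
Proof. exact: integrable_indic_itv. Qed.

Lemma bump_le_indic n (c d t : R) : `|bump n c d t| <= \1_`]c, d[ t.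
Proof.
rewrite ger0_norm ?bump_ge0// indicE.
case: (boolP (t \in `]c, d[)) => tcd; last by rewrite bump_out.
by rewrite mem_set//= bump_le1.
Qed.

Lemma smooth1_measurable (f : R -> R) : smooth1 f -> measurable_fun setT f.
Proof.
by move=> sf; apply: continuous_measurable_fun => x; exact: (smooth1_continuous sf).
Qed.

Lemma rintegrable_bump n (c d : R) : rint (bump n c d).
Proof.
apply: rintegrable_le (rintegrable_indic_itv c d) (bump_le_indic n c d).
by apply: smooth1_measurable; exact: smooth1_bump.
Qed.

(** The Heaviside kernel: with it primitives are integrals over the whole line, and exchanging them
    with another integral is an instance of Fubini. *)
Definition leI (t s : R) : R := (t <= s)%R%:R.

Lemma measurable_leI d (T : measurableType d) (f g : T -> R) :
  measurable_fun setT f -> measurable_fun setT g ->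
  measurable_fun setT (fun x => leI (f x) (g x)).
Proof.
move=> mf mg.
rewrite [X in measurable_fun _ X](_ : _ = \1_[set x | f x <= g x]).
  apply: measurable_indic; rewrite -[X in measurable X]setTI.
  exact: measurable_fun_le.
by apply/funext => z; rewrite /leI indicE; congr (nat_of_bool _)%:R; rewrite mem_setE.
Qed.

Lemma leI_le1 t s : `|leI t s| <= 1.
Proof. by rewrite /leI; case: (t <= s); rewrite ?normr1 ?normr0. Qed.

(** The primitive of the bump from -oo. It is smooth and bounded but constant beyond d, hence in
    general not of compact support; this is why weak derivatives are extended to bounded test
    functions in [wdx_bounded]. *)
Definition ramp n (c d s : R) : R := \int[mu]_t (bump n c d t * leI t s).

Lemma is_derive_ramp n (c d s : R) : is_derive s 1 (ramp n c d) (bump n c d s).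
Proof.
have -> : ramp n c d = fun x => \int[mu]_(t in [set` `]-oo, x]]) bump n c d t.
  apply/funext => x; rewrite [RHS]Rintegral_mkcond; apply: eq_Rintegral => t _.
  rewrite patchE mem_setE in_itv/= /leI.
  by case: (t <= x); rewrite ?mulr1 ?mulr0.
have ss1 : s < s + 1 by rewrite ltrDl.
have intb : mu.-integrable `]-oo, s + 1] (EFin \o bump n c d).
  exact: integrableS (rintegrable_bump n c d).
have [d1 d2] := continuous_FTC1 ss1 intb (ltNyr s)
  (@smooth1_continuous _ _ (smooth1_bump n c d) s).
by rewrite -d2 derive1E; exact: DeriveDef.
Qed.

Lemma smooth1_ramp n (c d : R) : smooth1 (ramp n c d).
Proof. exact: smooth1_antideriv (is_derive_ramp n c d) (smooth1_bump n c d). Qed.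

Lemma derive1_ramp n (c d : R) : derive1 (ramp n c d) = bump n c d.
Proof.
apply/funext => x; rewrite derive1E.
exact: (@derive_val _ _ _ _ _ _ _ (is_derive_ramp n c d x)).
Qed.

Definition len (c d : R) : R := \int[mu]_t \1_`]c, d[ t.

Lemma ramp_le n (c d s : R) : `|ramp n c d s| <= len c d.
Proof.
have ib : rint (fun t => bump n c d t * leI t s).
  apply: (rintegrable_mul_bounded (C := 1) (rintegrable_bump n c d)) => [|t].
    exact: measurable_leI.
  exact: leI_le1.
apply: le_trans (le_normr_Rintegral measurableT ib) _.
apply: le_Rintegral => //; [exact: rintegrable_norm|exact: rintegrable_indic_itv|].
move=> t _; rewrite normrM (le_trans _ (bump_le_indic n c d t))//.
by rewrite ler_piMr// leI_le1.
Qed.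

Definition lin_ramp (c d s : R) : R := \int[mu]_t (\1_`]c, d[ t * leI t s).

Lemma ramp_cvg (c d s : R) : ramp n c d s @[n --> \oo] --> lin_ramp c d s.
Proof.
apply: (@rdominated_cvg _ _ _ mu (fun n t => bump n c d t * leI t s)
  (fun t => \1_`]c, d[ t * leI t s) \1_`]c, d[).
- move=> n; apply: measurable_funM; last exact: measurable_leI.
  by apply: smooth1_measurable; exact: smooth1_bump.
- by apply: measurable_funM => //; exact: measurable_leI.
- by move=> t; apply: cvgM; [exact: bump_cvg|exact: cvg_cst].
- exact: rintegrable_indic_itv.
- move=> n t; rewrite normrM (le_trans _ (bump_le_indic n c d t))//.
  by rewrite ler_piMr// leI_le1.
Qed.

Lemma rintegrable_tail (g : R -> R) t : rint g -> rint (fun s => g s * leI t s).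
Proof.
move=> ig; apply: (rintegrable_mul_bounded (C := 1) ig) => [|s].
  exact: measurable_leI.
exact: leI_le1.
Qed.

(** The integral of g over [t, +oo[, so that [- tail g] is the primitive of g vanishing at +oo. *)
Definition tail (g : R -> R) (t : R) : R := \int[mu]_s (g s * leI t s).

Lemma measurable_tail (g : R -> R) : rint g -> measurable_fun setT (tail g).
Proof.
move=> ig.
apply: (@Rmeasurable_slice _ _ _ _ _ mu (fun z : R * R => g z.1 * leI z.2 z.1)).
  apply: measurable_funM.
    exact: (measurableT_comp (rintegrable_meas ig) measurable_fst).
  exact: measurable_leI.
by move=> t; exact: rintegrable_tail.
Qed.

Lemma tail_le (g : R -> R) t : rint g -> `|tail g t| <= \int[mu]_s `|g s|.
Proof.
move=> ig; have it := rintegrable_tail t ig.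
apply: le_trans (le_normr_Rintegral measurableT it) _.
apply: le_Rintegral => //; [exact: rintegrable_norm|exact: rintegrable_norm|].
by move=> s _; rewrite normrM ler_piMr// leI_le1.
Qed.

Lemma integral_itv_indic (f : R -> R) (a b : R) :
  \int[mu]_(x in `]a, b[) f x = \int[mu]_x (f x * \1_`]a, b[ x).
Proof.
rewrite Rintegral_mkcond; apply: eq_Rintegral => t _; rewrite patchE indicE.
by case: ifPn => _; rewrite ?mulr1 ?mulr0.
Qed.

Lemma tail_itv (g : R -> R) (c d : R) : rint g ->
  \int[mu]_(t in `]c, d[) tail g t = \int[mu]_s (g s * lin_ramp c d s).
Proof.
move=> ig; pose k (z : R * R) := g z.1 * \1_`]c, d[ z.2 * leI z.2 z.1.
have ik : (mu \x mu)%E.-integrable setT (EFin \o k).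
  apply: (rintegrable_mul_bounded (C := 1)
    (rintegrable_prod ig (rintegrable_indic_itv c d))) => [|z].
    exact: measurable_leI.
  exact: leI_le1.
rewrite integral_itv_indic; transitivity (\int[mu]_t \int[mu]_s k (s, t)).
  apply: eq_Rint => t; rewrite mulrC -RintZ ?rintegrable_tail//.
  by apply: eq_Rint => s; rewrite /k/=; ring.
rewrite (Rfubini2 ik) -(Rfubini1 ik); apply: eq_Rint => s.
rewrite -RintZ; first by apply: eq_Rint => t; rewrite /k/= mulrA.
apply: (rintegrable_mul_bounded (C := 1) (rintegrable_indic_itv c d)) => [|t].
  exact: measurable_leI.
exact: leI_le1.
Qed.

(** The hypothesis is the weak relation f' = g tested against ramps, whose derivatives are the
    bumps. As n tends to infinity it says, by [tail_itv], that f + tail g has zero integral over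
    every rational interval. *)
Lemma ae_eq_tail (f g : R -> R) : rint f -> rint g ->
  (forall n (q r : rat), \int[mu]_x
     (f x * bump n (ratr q) (ratr r) x + g x * ramp n (ratr q) (ratr r) x) = 0) ->
  {ae mu, forall x, f x = - tail g x}.
Proof.
move=> intf intg H.
have mt := measurable_tail intg.
have itail (a b : R) : mu.-integrable `[a, b] (EFin \o tail g).
  apply: measurable_bounded_integrable => //.
  - by apply: compact_finite_measure; exact: segment_compact.
  - exact: measurable_funTS.
  - exists (\int[mu]_s `|g s|); split; first exact: num_real.
    by move=> x xM t _; apply: (le_trans (tail_le t intg)); exact: ltW.
suff : {ae mu, forall x, f x + tail g x = 0}.
  by apply: ae_imp => x /eqP; rewrite addr_eq0 => /eqP.
apply: ae_eq0_of_integral_itv.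
- by apply: measurable_funD => //; exact: rintegrable_meas intf.
- move=> a b.
  have fab : mu.-integrable `[a, b] (EFin \o f) by exact: integrableS intf.
  by apply: eq_integrable (integrableD _ fab (itail a b)).
- move=> q r; set c := ratr q; set d := ratr r.
  have fcd : mu.-integrable `]c, d[ (EFin \o f) by exact: integrableS intf.
  have tcd : mu.-integrable `]c, d[ (EFin \o tail g).
    by apply: integrableS (itail c d) => //; exact: subset_itv_oo_cc.
  rewrite (RintegralD _ fcd tcd)// tail_itv// integral_itv_indic.
  have mbump n : measurable_fun setT (bump n c d).
    by apply: smooth1_measurable; exact: smooth1_bump.
  have mramp n : measurable_fun setT (ramp n c d).
    by apply: smooth1_measurable; exact: smooth1_ramp.
  have i1 n : rint (fun x => f x * bump n c d x).
    exact: rintegrable_mul_bounded intf (mbump n) (bump_norm_le1 n c d).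
  have i2 n : rint (fun x => g x * ramp n c d x).
    exact: rintegrable_mul_bounded intg (mramp n) (ramp_le n c d).
  have l1 : \int[mu]_x (f x * bump n c d x) @[n --> \oo] -->
      \int[mu]_x (f x * \1_`]c, d[ x).
    apply: (@rdominated_cvg _ _ _ mu (fun n x => f x * bump n c d x)
      (fun x => f x * \1_`]c, d[ x) (fun x => `|f x|)).
    - by move=> n; exact: rintegrable_meas (i1 n).
    - by apply: measurable_funM => //; exact: rintegrable_meas intf.
    - by move=> x; apply: cvgM; [exact: cvg_cst|exact: bump_cvg].
    - exact: rintegrable_norm.
    - by move=> n x; rewrite normrM ler_piMr// bump_norm_le1.
  have l2 : \int[mu]_x (g x * ramp n c d x) @[n --> \oo] -->
      \int[mu]_x (g x * lin_ramp c d x).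
    apply: (@rdominated_cvg _ _ _ mu (fun n x => g x * ramp n c d x)
      (fun x => g x * lin_ramp c d x) (fun x => len c d * `|g x|)).
    - by move=> n; exact: rintegrable_meas (i2 n).
    - apply: measurable_funM => //; first exact: rintegrable_meas intg.
      by apply: (measurable_fun_cvg (h := fun n => ramp n c d)) => // x _; exact: ramp_cvg.
    - by move=> x; apply: cvgM; [exact: cvg_cst|exact: ramp_cvg].
    - exact/rintegrableZ/rintegrable_norm.
    - by move=> n x; rewrite normrM mulrC ler_wpM2r// ramp_le.
  have l3 := cvgD l1 l2.
  rewrite -(cvg_lim (@Rhausdorff R) (l3 _)).
  rewrite (_ : _ + _ = cst 0) ?lim_cst//; apply/funext => n.
  exact: etrans (esym (RintD (i1 n) (i2 n))) (H n q r).
Qed.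

End one_dimensional_weak_derivatives.

(** * Integration by parts for primitives of integrable functions *)

Section one_dimensional_integration_by_parts.
Context {R : realType}.
Local Notation mu := (@lebesgue_measure R).
Local Notation rint := (rintegrable mu).
Variables g1 g2 : R -> R.
Hypotheses (i1 : rint g1) (i2 : rint g2).

Let K (z : R * R) := g1 z.1 * g2 z.2.

Let iK : rintegrable (mu \x mu)%E K.
Proof. exact: rintegrable_prod. Qed.

Let k1 (z : R * R) := K z * leI z.2 z.1.
Let k2 (z : R * R) := K z * leI z.1 z.2.
Let k3 (z : R * R) := K z * (z.1 == z.2)%:R.

Let ik1 : rintegrable (mu \x mu)%E k1.
Proof.
apply: (rintegrable_mul_bounded (C := 1) iK); first exact: measurable_leI.
by move=> z; exact: leI_le1.
Qed.

Let ik2 : rintegrable (mu \x mu)%E k2.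
Proof.
apply: (rintegrable_mul_bounded (C := 1) iK); first exact: measurable_leI.
by move=> z; exact: leI_le1.
Qed.

(** The half-planes z.2 <= z.1 and z.1 <= z.2 cover the plane and overlap on the diagonal, whose
    contribution [int_k3] shows to be null. *)
Let k123 z : k1 z + k2 z = K z + k3 z.
Proof.
rewrite /k1 /k2 /k3 /leI; case: ltgtP => _; rewrite ?mulr0 ?mulr1 ?addr0 ?add0r//.
Qed.

Let ik3 : rintegrable (mu \x mu)%E k3.
Proof.
have := rintegrableB (rintegrableD ik1 ik2) iK.
by under eq_fun do rewrite k123 addrC addKr.
Qed.

Let int_k3 : \int[(mu \x mu)%E]_z k3 z = 0.
Proof.
rewrite -(Rfubini1 ik3) -[RHS](Rint0 mu); apply: eq_Rint => x.
rewrite -[RHS](@Rintegral_set1 _ (fun y => K (x, y)) x).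
rewrite [RHS]Rintegral_mkcond; apply: eq_Rint => y.
rewrite patchE /k3/=; case: (eqVneq x y) => [->|xy].
  by rewrite mem_set// mulr1.
by rewrite memNset/= ?mulr0// => /esym/eqP; exact/negP.
Qed.

Let int_K : \int[(mu \x mu)%E]_z K z = \int[mu]_x g1 x * \int[mu]_y g2 y.
Proof.
rewrite -(Rfubini1 iK) mulrC -RintZ//; apply: eq_Rint => x.
by rewrite mulrC -RintZ.
Qed.

Lemma rintegrable_tailMl : rint (fun t => tail g1 t * g2 t).
Proof.
under eq_fun do rewrite mulrC.
apply: (rintegrable_mul_bounded (C := \int[mu]_s `|g1 s|) i2) => [|t].
- exact: measurable_tail.
- exact: tail_le.
Qed.

(** The two integrals are those of g1(s) g2(t) over t <= s and over s <= t, so their sum is the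
    product of the total integrals. That g1 has integral 0 means that its primitive vanishing at +oo
    also tends to 0 at -oo: there is no boundary term. *)
Lemma integral_tailM : \int[mu]_x g1 x = 0 ->
  \int[mu]_t (tail g1 t * g2 t) = - \int[mu]_t (g1 t * tail g2 t).
Proof.
move=> g10; apply/eqP; rewrite -addr_eq0; apply/eqP.
have -> : \int[mu]_t (tail g1 t * g2 t) = \int[(mu \x mu)%E]_z k1 z.
  rewrite -(Rfubini2 ik1); apply: eq_Rint => t.
  rewrite mulrC -RintZ ?rintegrable_tail//; apply: eq_Rint => s.
  by rewrite /k1 /K/=; ring.
have -> : \int[mu]_t (g1 t * tail g2 t) = \int[(mu \x mu)%E]_z k2 z.
  rewrite -(Rfubini1 ik2); apply: eq_Rint => t.
  rewrite -RintZ ?rintegrable_tail//; apply: eq_Rint => s.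
  by rewrite /k2 /K/=; ring.
rewrite -RintD//; under eq_Rint do rewrite k123.
by rewrite RintD// int_k3 int_K g10 mul0r addr0.
Qed.

End one_dimensional_integration_by_parts.

(** * From test functions in the plane to almost every line *)

Section weak_derivatives_on_slices.
Context {R : realType}.
Local Notation mu := (@lebesgue_measure R).
Local Notation rint := (rintegrable mu).
Implicit Types u v : R * R -> R.

(* Testing against products a(x)b(y) only spares the symmetry of second
   derivatives of test functions and suffices to determine weak derivatives. *)
Definition wdx u v := forall a b : R -> R,
  smooth1 a -> csupp a -> smooth1 b -> csupp b ->
  \int2_ z (u z * (derive1 a z.1 * b z.2)) = - \int2_ z (v z * (a z.1 * b z.2)).

Lemma cvg_int2 u (g_ : nat -> R * R -> R) (g : R * R -> R) (C : R) :
  rintegrable2 u -> (forall n, measurable_fun setT (g_ n)) ->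
  (forall z, g_ n z @[n --> \oo] --> g z) -> (forall n z, `|g_ n z| <= C) ->
  \int2_ z (u z * g_ n z) @[n --> \oo] --> \int2_ z (u z * g z).
Proof.
move=> iu mg_ g_g gC.
apply: (@rdominated_cvg _ _ _ (@leb2 R) (fun n z => u z * g_ n z)
  (fun z => u z * g z) (fun z => C * `|u z|)).
- by move=> n; apply: measurable_funM; [exact: rintegrable_meas iu|exact: mg_].
- apply: measurable_funM; first exact: rintegrable_meas iu.
  by apply: (measurable_fun_cvg (h := g_)) => // z _; exact: g_g.
- by move=> z; apply: cvgM; [exact: cvg_cst|exact: g_g].
- exact/rintegrableZ/rintegrable_norm.
- by move=> n z; rewrite normrM mulrC ler_wpM2r.
Qed.

Lemma measurable_tensor (a b : R -> R) : measurable_fun setT a ->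
  measurable_fun setT b -> measurable_fun setT (fun z : R * R => a z.1 * b z.2).
Proof.
by move=> ma mb; apply: measurable_funM;
  [exact: (measurableT_comp ma measurable_fst)|exact: (measurableT_comp mb measurable_snd)].
Qed.

Lemma cvg_int2_tensor u (a_ b_ : nat -> R -> R) (a b : R -> R) (A B : R) :
  rintegrable2 u ->
  (forall n, measurable_fun setT (a_ n)) -> (forall n, measurable_fun setT (b_ n)) ->
  (forall x, a_ n x @[n --> \oo] --> a x) -> (forall x, b_ n x @[n --> \oo] --> b x) ->
  (forall n x, `|a_ n x| <= A) -> (forall n x, `|b_ n x| <= B) ->
  \int2_ z (u z * (a_ n z.1 * b_ n z.2)) @[n --> \oo] -->
  \int2_ z (u z * (a z.1 * b z.2)).
Proof.
move=> iu ma mb la lb bA bB.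
apply: (@cvg_int2 u (fun n z => a_ n z.1 * b_ n z.2)
  (fun z => a z.1 * b z.2) (A * B)) => //.
- by move=> n; exact: measurable_tensor.
- by move=> z; exact: cvgM.
- by move=> n z; rewrite normrM ler_pM.
Qed.

Lemma cvg_eqN (x_ y_ : nat -> R) (x y : R) : (forall n, x_ n = - y_ n) ->
  x_ n @[n --> \oo] --> x -> y_ n @[n --> \oo] --> y -> x = - y.
Proof.
move=> xy lx /cvgN ly.
rewrite -(cvg_lim (@Rhausdorff R) lx) -(cvg_lim (@Rhausdorff R) ly).
by rewrite (_ : x_ = - y_)//; apply/funext => n; rewrite xy.
Qed.

Lemma cutoff_norm_le : exists C : R, forall m x, `|cutoff m x| <= C.
Proof.
have [C h] := csupp_bounded (smooth1_continuous (@smooth1_cutoff1 R)) csupp_cutoff1.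
by exists C => m x; exact: h.
Qed.

Lemma derive_cutoff_norm_le : exists C : R, forall m x, `|derive1 (cutoff m) x| <= C.
Proof.
have [C h] := csupp_bounded (smooth1_continuous (smooth1_derive (@smooth1_cutoff1 R)))
  (smooth1_csupp_derive smooth1_cutoff1 csupp_cutoff1).
exists C => m x; rewrite derive_cutoff normrM (le_trans _ (h (m.+1%:R^-1 * x + 0)))//.
by rewrite ler_piMl// ger0_norm// invf_le1// ler1n.
Qed.

Lemma derive1M (a b : R -> R) x : smooth1 a -> smooth1 b ->
  derive1 (fun x => a x * b x) x = a x * derive1 b x + b x * derive1 a x.
Proof.
move=> sa sb; rewrite [LHS]derive1E.
have [_ e] := is_deriveM (smooth1_is_derive x sa) (smooth1_is_derive x sb).
exact: e.
Qed.

Lemma csuppM (a b : R -> R) : csupp b -> csupp (fun x => a x * b x).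
Proof. by case=> M h; exists M => x xM; rewrite h// mulr0. Qed.

(** Truncate a and b by dilated cutoffs. The derivative of the cutoff carries the factor 1/(m + 1)
    and disappears in the limit; dominated convergence applies since u and v are integrable on the
    whole plane. *)
Lemma wdx_bounded u v : rintegrable2 u -> rintegrable2 v -> wdx u v ->
  forall a b, smooth1 a -> bounded1 a -> bounded1 (derive1 a) ->
    smooth1 b -> bounded1 b ->
  \int2_ z (u z * (derive1 a z.1 * b z.2)) = - \int2_ z (v z * (a z.1 * b z.2)).
Proof.
move=> iu iv uv a b sa /bounded1_ge0[A A0 aA] /bounded1_ge0[A' A'0 aA'] sb.
move=> /bounded1_ge0[B B0 bB].
have [C kC] := cutoff_norm_le; have [C' kC'] := derive_cutoff_norm_le.
pose a_ m x := a x * cutoff m x; pose b_ m x := b x * cutoff m x.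
have sa_ m : smooth1 (a_ m) by apply: smooth1M => //; exact: smooth1_cutoff.
have sb_ m : smooth1 (b_ m) by apply: smooth1M => //; exact: smooth1_cutoff.
have cvgk x : cutoff m x @[m --> \oo] --> (1 : R).
  rewrite -[X in _ --> X]cutoff10; apply: cutoff_cvg.
  exact: smooth1_continuous smooth1_cutoff1.
have la x : a_ m x @[m --> \oo] --> a x.
  by rewrite -[X in _ --> X]mulr1; apply: cvgM; [exact: cvg_cst|exact: cvgk].
have lb x : b_ m x @[m --> \oo] --> b x.
  by rewrite -[X in _ --> X]mulr1; apply: cvgM; [exact: cvg_cst|exact: cvgk].
have da_ m x : derive1 (a_ m) x = a x * derive1 (cutoff m) x + cutoff m x * derive1 a x.
  by apply: derive1M => //; exact: smooth1_cutoff.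
have lda x : derive1 (a_ m) x @[m --> \oo] --> derive1 a x.
  rewrite (_ : (fun m => derive1 (a_ m) x) = fun m =>
    a x * derive1 (cutoff m) x + cutoff m x * derive1 a x); last exact/funext.
  suff : a x * derive1 (cutoff m) x + cutoff m x * derive1 a x @[m --> \oo]
      --> a x * (0 * derive1 (@cutoff1 R) 0) + 1 * derive1 a x.
    by rewrite mul0r mulr0 add0r mul1r.
  apply: cvgD; apply: cvgM.
  - exact: cvg_cst.
  - under eq_fun do rewrite derive_cutoff.
    apply: cvgM; first exact: cvg_harmonic.
    apply: cutoff_cvg; exact: smooth1_continuous (smooth1_derive smooth1_cutoff1).
  - exact: cvgk.
  - exact: cvg_cst.
apply: (@cvg_eqN (fun m => \int2_ z (u z * (derive1 (a_ m) z.1 * b_ m z.2)))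
  (fun m => \int2_ z (v z * (a_ m z.1 * b_ m z.2)))).
- move=> m; apply: uv => //.
  + by apply: csuppM; exact: csupp_cutoff.
  + by apply: csuppM; exact: csupp_cutoff.
- apply: (@cvg_int2_tensor u (fun m => derive1 (a_ m)) b_ (derive1 a) b
    (A * C' + C * A') (B * C)) => //.
  + by move=> m; apply: smooth1_measurable; exact: smooth1_derive.
  + by move=> m; exact: smooth1_measurable.
  + move=> m x; rewrite da_ (le_trans (ler_normD _ _))//.
    rewrite (normrM (a x)) (normrM (cutoff m x)).
    by apply: lerD; apply: ler_pM.
  + by move=> m x; rewrite normrM ler_pM.
- apply: (@cvg_int2_tensor v a_ b_ a b (A * C) (B * C)) => //.
  + by move=> m; exact: smooth1_measurable.
  + by move=> m; exact: smooth1_measurable.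
  + by move=> m x; rewrite normrM ler_pM.
  + by move=> m x; rewrite normrM ler_pM.
Qed.

(** No derivative falls on the factor in y, which may therefore be the limit of bumps. Letting the
    strip vary isolates the slices. *)
Lemma wdx_strip u v : rintegrable2 u -> rintegrable2 v -> wdx u v ->
  forall a p q, smooth1 a -> bounded1 a -> bounded1 (derive1 a) ->
  \int2_ z (u z * (derive1 a z.1 * \1_`]p, q[ z.2)) =
  - \int2_ z (v z * (a z.1 * \1_`]p, q[ z.2)).
Proof.
move=> iu iv uv a p q sa ba bda.
have /bounded1_ge0[A A0 aA] := ba; have /bounded1_ge0[A' A'0 aA'] := bda.
apply: (@cvg_eqN (fun m => \int2_ z (u z * (derive1 a z.1 * bump m p q z.2)))
  (fun m => \int2_ z (v z * (a z.1 * bump m p q z.2)))).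
- move=> m; apply: wdx_bounded => //; first exact: smooth1_bump.
  by exists 1 => x; exact: bump_norm_le1.
- apply: (@cvg_int2_tensor u (fun=> derive1 a) (fun m => bump m p q)
    (derive1 a) \1_`]p, q[ A' 1) => //.
  + by move=> m; apply: smooth1_measurable; exact: smooth1_derive.
  + by move=> m; apply: smooth1_measurable; exact: smooth1_bump.
  + by move=> x; exact: cvg_cst.
  + by move=> x; exact: bump_cvg.
  + by move=> m x; exact: bump_norm_le1.
- apply: (@cvg_int2_tensor v (fun=> a) (fun m => bump m p q) a \1_`]p, q[ A 1) => //.
  + by move=> m; exact: smooth1_measurable.
  + by move=> m; apply: smooth1_measurable; exact: smooth1_bump.
  + by move=> x; exact: cvg_cst.
  + by move=> x; exact: bump_cvg.
  + by move=> m x; exact: bump_norm_le1.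
Qed.

Lemma ae_slice_eq0 (k : R * R -> R) : rintegrable2 k ->
  (forall p q : R, \int2_ z (k z * \1_`]p, q[ z.2) = 0) ->
  {ae mu, forall y, \int[mu]_x k (x, y) = 0}.
Proof.
move=> ik k0; have iF := Rfubini2_integrable ik.
apply: ae_eq0_of_integral_itv.
- exact: rintegrable_meas iF.
- by move=> a b; exact: integrableS iF.
move=> p q; rewrite integral_itv_indic -[RHS](k0 (ratr p) (ratr q)).
set I := \1_ _; have mI : measurable_fun setT I by exact: measurable_indic.
have ikI : rintegrable2 (fun z => k z * I z.2).
  apply: (rintegrable_mul_bounded (C := 1) ik) => [|z].
    exact: (measurableT_comp mI measurable_snd).
  by rewrite /I indicE ger0_norm// lern1 leq_b1.
rewrite -[RHS](Rfubini2 ikI); apply: (ae_eq_Rint (mu := mu)).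
- apply: (rintegrable_meas (mu := mu)).
  apply: (rintegrable_mul_bounded (C := 1) iF) => // t.
  by rewrite /I indicE ger0_norm// lern1 leq_b1.
- exact: rintegrable_meas (Rfubini2_integrable ikI).
- move: (slice2_integrable ik); apply: ae_imp => y iy.
  by rewrite mulrC -RintZ//; apply: eq_Rint => x /=; rewrite mulrC.
Qed.

End weak_derivatives_on_slices.

(** * Integration by parts in the plane *)

Section integration_by_parts.
Context {R : realType}.
Local Notation mu := (@lebesgue_measure R).
Local Notation rint := (rintegrable mu).
Implicit Types u v f : R * R -> R.

Lemma bounded1_cst (c : R) : bounded1 (fun=> c).
Proof. by exists `|c|. Qed.

Lemma wdx_slices u v : rintegrable2 u -> rintegrable2 v -> wdx u v ->
  {ae mu, forall y, [/\ rint (fun x => u (x, y)), rint (fun x => v (x, y)),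
    \int[mu]_x v (x, y) = 0 &
    {ae mu, forall x, u (x, y) = - tail (fun x => v (x, y)) x}]}.
Proof.
move=> iu iv uv.
have d1 : derive1 (fun=> 1 : R) = fun=> 0 by apply/funext => x; rewrite derive1_cst.
(* Test with a = 1, whose derivative is 0. *)
have E2 : {ae mu, forall y, \int[mu]_x v (x, y) = 0}.
  apply: ae_slice_eq0 => // p q.
  have := wdx_strip iu iv uv p q (smooth1_cst 1) (bounded1_cst 1).
  rewrite d1 => /(_ (bounded1_cst 0)) /eqP; rewrite eq_sym eqr_oppLR => /eqP.
  under eq_Rint do rewrite mul1r.
  move=> ->; rewrite (_ : \int2_ z _ = 0) ?oppr0//.
  rewrite -[RHS](Rint0 (@leb2 R)); apply: eq_Rint => z.
  by rewrite mul0r mulr0.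
(* Each test by a ramp gives a condition for almost every y. There are countably many triples (n, q,
   r), so one null set of y serves for all. *)
pose k (i : nat * (rat * rat)) (z : R * R) :=
  u z * bump i.1 (ratr i.2.1) (ratr i.2.2) z.1 +
  v z * ramp i.1 (ratr i.2.1) (ratr i.2.2) z.1.
have E3 : {ae mu, forall y, forall i, \int[mu]_x k i (x, y) = 0}.
  apply: ae_forall_count => -[n [q r]].
  set c : R := ratr q; set d : R := ratr r.
  have mb : measurable_fun setT (fun z : R * R => bump n c d z.1).
    apply: (measurableT_comp _ measurable_fst).
    by apply: smooth1_measurable; exact: smooth1_bump.
  have mr : measurable_fun setT (fun z : R * R => ramp n c d z.1).
    apply: (measurableT_comp _ measurable_fst).
    by apply: smooth1_measurable; exact: smooth1_ramp.
  have i1 : rintegrable2 (fun z => u z * bump n c d z.1).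
    exact: rintegrable_mul_bounded iu mb (fun z => bump_norm_le1 n c d z.1).
  have i2 : rintegrable2 (fun z => v z * ramp n c d z.1).
    exact: rintegrable_mul_bounded iv mr (fun z => ramp_le n c d z.1).
  apply: ae_slice_eq0; first exact: rintegrableD.
  move=> p p'; set I : R -> R := \1_ _.
  have mI : measurable_fun setT (fun z : R * R => I z.2).
    by apply: (measurableT_comp _ measurable_snd); exact: measurable_indic.
  have I1 z : `|I z| <= 1 by rewrite /I indicE ger0_norm// lern1 leq_b1.
  under eq_Rint do rewrite mulrDl.
  rewrite RintD; last 2 first.
  - exact: rintegrable_mul_bounded i1 mI (fun z => I1 z.2).
  - exact: rintegrable_mul_bounded i2 mI (fun z => I1 z.2).
  have := wdx_strip iu iv uv p p' (smooth1_ramp n c d).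
  rewrite derive1_ramp => /(_ _ _)/eqP; rewrite -addr_eq0 => /(_ _ _)/eqP H.
  under eq_Rint do rewrite -mulrA.
  under [X in _ + X = _]eq_Rint do rewrite -mulrA.
  apply: H; first by exists (len c d); exact: ramp_le.
  by exists 1; exact: bump_norm_le1.
have := ae_and (ae_and (slice2_integrable iu) (slice2_integrable iv)) (ae_and E2 E3).
apply: ae_imp => y [[iuy ivy] [v0 ky]]; split => //.
by apply: ae_eq_tail => // n q r; exact: (ky (n, (q, r))).
Qed.

(** On almost every line u1 and u2 are minus the tails of v1 and v2, and v1 has integral 0, so that
    [integral_tailM] applies; Fubini collects the lines. Neither function has to be approximated by
    smooth ones. *)
Lemma ibp_x u1 v1 u2 v2 : rintegrable2 u1 -> rintegrable2 v1 -> wdx u1 v1 ->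
  rintegrable2 u2 -> rintegrable2 v2 -> wdx u2 v2 ->
  rintegrable2 (fun z => u1 z * v2 z) -> rintegrable2 (fun z => v1 z * u2 z) ->
  \int2_ z (u1 z * v2 z) = - \int2_ z (v1 z * u2 z).
Proof.
move=> iu1 iv1 w1 iu2 iv2 w2 iuv ivu.
have iN : rintegrable2 (fun z => - (v1 z * u2 z)).
  by have := rintegrableZ (-1) ivu; under eq_fun do rewrite mulN1r.
rewrite -RintN// -(Rfubini2 iuv) -(Rfubini2 iN).
apply: (ae_eq_Rint (mu := mu)).
- exact: rintegrable_meas (Rfubini2_integrable iuv).
- exact: rintegrable_meas (Rfubini2_integrable iN).
have := ae_and (slice2_integrable ivu)
  (ae_and (slice2_integrable iuv) (ae_and (wdx_slices iu1 iv1 w1) (wdx_slices iu2 iv2 w2))).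
apply: ae_imp => y [ivuy [iuvy [[iu1y iv1y v10 e1] [iu2y iv2y v20 e2]]]].
have it12 := rintegrable_tailMl iv1y iv2y.
have it21 := rintegrable_tailMl iv2y iv1y.
rewrite RintN//.
transitivity (- \int[mu]_x (tail (fun x => v1 (x, y)) x * v2 (x, y))).
  rewrite -RintN//; apply: (ae_eq_Rint (mu := mu)).
  - exact: rintegrable_meas iuvy.
  - by apply: measurableT_comp => //; exact: rintegrable_meas it12.
  - by move: e1; apply: ae_imp => x ->; rewrite mulNr.
rewrite (integral_tailM iv1y iv2y v10); congr (- _).
rewrite -RintN; last by under eq_fun do rewrite mulrC.
apply: (ae_eq_Rint (mu := mu)).
- apply: measurableT_comp => //; apply: measurable_funM.
    exact: rintegrable_meas iv1y.
  exact: measurable_tail.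
- exact: rintegrable_meas ivuy.
- by move: e2; apply: ae_imp => x ->; rewrite mulrN.
Qed.

(** Exchanging the coordinates reduces the y direction to the x direction. *)
Definition swp f (z : R * R) : R := f (z.2, z.1).

Lemma measurable_swp f : measurable_fun setT f -> measurable_fun setT (swp f).
Proof.
move=> mf.
have ms : measurable_fun setT (fun z : R * R => (z.2, z.1)).
  by apply: measurable_fun_pair; [exact: measurable_snd|exact: measurable_fst].
exact: (measurableT_comp mf ms).
Qed.

Lemma rintegrable_swp f : rintegrable2 f -> rintegrable2 (swp f).
Proof.
move=> intf; have mf := rintegrable_meas intf.
have mfE : measurable_fun setT (EFin \o f) by exact/measurable_EFinP.
have msE : measurable_fun setT (EFin \o swp f).
  by apply/measurable_EFinP; exact: measurable_swp.
by have := (integrable12ltyP mu mu mfE).1 intf; exact: (integrable21ltyP mu mu msE).2.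
Qed.

Lemma int2_swp f : rintegrable2 f -> \int2_ z (swp f z) = \int2_ z (f z).
Proof.
move=> intf; rewrite -[LHS](Rfubini2 (rintegrable_swp intf)).
by rewrite -[RHS](Rfubini1 intf).
Qed.

Definition wdy u v := forall a b : R -> R,
  smooth1 a -> csupp a -> smooth1 b -> csupp b ->
  \int2_ z (u z * (a z.1 * derive1 b z.2)) = - \int2_ z (v z * (a z.1 * b z.2)).

Lemma rintegrable_tensor u (a b : R -> R) : rintegrable2 u ->
  smooth1 a -> bounded1 a -> smooth1 b -> bounded1 b ->
  rintegrable2 (fun z => u z * (a z.1 * b z.2)).
Proof.
move=> iu sa /bounded1_ge0[A A0 aA] sb /bounded1_ge0[B B0 bB].
apply: (rintegrable_mul_bounded (C := A * B) iu).
  by apply: measurable_tensor; exact: smooth1_measurable.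
by move=> z; rewrite normrM ler_pM.
Qed.

Lemma smooth1_csupp_bounded (a : R -> R) : smooth1 a -> csupp a -> bounded1 a.
Proof. by move=> sa; apply: csupp_bounded; exact: smooth1_continuous. Qed.

Lemma wdy_swp u v : rintegrable2 u -> rintegrable2 v -> wdy u v ->
  wdx (swp u) (swp v).
Proof.
move=> iu iv uv a b sa ca sb cb.
have ba := smooth1_csupp_bounded sa ca; have bb := smooth1_csupp_bounded sb cb.
have sda := smooth1_derive sa.
have bda := smooth1_csupp_bounded sda (smooth1_csupp_derive sa ca).
have := uv b a sb cb sa ca.
rewrite -int2_swp; last exact: rintegrable_tensor.
rewrite -[in X in _ = - X]int2_swp; last exact: rintegrable_tensor.
rewrite /swp /= => H; transitivity (\int2_ z (u (z.2, z.1) * (b z.2 * derive1 a z.1))).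
  by apply: eq_Rint => z; rewrite [a in _ * a]mulrC.
by rewrite H; congr (- _); apply: eq_Rint => z; rewrite [a in _ * a]mulrC.
Qed.

Lemma ibp_y u1 v1 u2 v2 : rintegrable2 u1 -> rintegrable2 v1 -> wdy u1 v1 ->
  rintegrable2 u2 -> rintegrable2 v2 -> wdy u2 v2 ->
  rintegrable2 (fun z => u1 z * v2 z) -> rintegrable2 (fun z => v1 z * u2 z) ->
  \int2_ z (u1 z * v2 z) = - \int2_ z (v1 z * u2 z).
Proof.
move=> iu1 iv1 w1 iu2 iv2 w2 iuv ivu.
rewrite -(int2_swp iuv) -(int2_swp ivu).
by apply: ibp_x; try (exact: rintegrable_swp); try (exact: wdy_swp);
  [exact: (rintegrable_swp iuv)|exact: (rintegrable_swp ivu)].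
Qed.

End integration_by_parts.

(** * Uniqueness of weak derivatives *)

Section du_Bois_Reymond_plane.
Context {R : realType}.
Local Notation mu := (@lebesgue_measure R).
Local Notation rint := (rintegrable mu).
Implicit Types u v f : R * R -> R.

Definition box (M : nat) : R -> R := \1_`]- M%:R, M%:R[.

(** Local integrability over the squares ]-M, M[^2. The truncation is itself a product, so that it
    can be absorbed by test functions a(x) b(y). *)
Definition loc2 u := measurable_fun setT u /\
  forall M, rintegrable2 (fun z => u z * (box M z.1 * box M z.2)).

Lemma indic01 (A : set R) x : `|\1_A x : R| <= 1.
Proof. by rewrite indicE ger0_norm// lern1 leq_b1. Qed.

Lemma indicM_itv (a b c d x : R) :
  \1_`]a, b[ x * \1_`]c, d[ x = \1_`]Num.max a c, Num.min b d[ x :> R.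
Proof.
rewrite !indicE -natrM mulnb; congr (nat_of_bool _)%:R.
rewrite !mem_setE !in_itv/= gt_max lt_min.
by case: (a < x); case: (x < b); case: (c < x); case: (x < d).
Qed.

Lemma csupp_box (a : R -> R) : csupp a -> exists N : nat,
  forall M, (N <= M)%N -> forall x, a x = a x * box M x.
Proof.
move=> [C aC]; exists (Num.bound (`|C| + 1)) => M NM x.
rewrite /box indicE; case: (boolP (x \in _)) => xM; first by rewrite mulr1.
rewrite mulr0 aC//; move: xM; rewrite mem_setE in_itv/= -ltr_norml -leNgt.
apply: le_trans; apply: (@le_trans _ _ (`|C| + 1)).
  by rewrite (le_trans (ler_norm C))// lerDl.
apply: (@le_trans _ _ (Num.bound (`|C| + 1))%:R); last by rewrite ler_nat.
by rewrite ltW// archi_boundP.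
Qed.

Lemma loc2_tensor u (a b : R -> R) : loc2 u ->
  smooth1 a -> csupp a -> smooth1 b -> csupp b ->
  rintegrable2 (fun z => u z * (a z.1 * b z.2)).
Proof.
move=> [mu_ iu] sa ca sb cb.
have [Na ha] := csupp_box ca; have [Nb hb] := csupp_box cb.
have := rintegrable_tensor (iu (maxn Na Nb)) sa (smooth1_csupp_bounded sa ca)
  sb (smooth1_csupp_bounded sb cb).
apply: eq_integrable => // z _ /=; congr (_%:E).
rewrite [in RHS](ha (maxn Na Nb))  ?leq_maxl//.
by rewrite [in RHS](hb (maxn Na Nb)) ?leq_maxr//; ring.
Qed.

Lemma loc2B u v : loc2 u -> loc2 v -> loc2 (fun z => u z - v z).
Proof.
move=> [mu_ iu] [mv iv]; split; first exact: measurable_funB.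
move=> M; have := rintegrableB (iu M) (iv M).
by under eq_fun do rewrite -mulrBl.
Qed.

Lemma csupp_bump n (p q : R) : csupp (bump n p q).
Proof.
exists (`|p| + `|q|) => x xpq; apply: bump_out.
apply/negP; rewrite in_itv/= => /andP[px xq]; move: xpq; apply/negP; rewrite -ltNge.
have := ler_norm p; have := ler_norm q; have := ler_norm (- p); have := ler_norm (- q).
rewrite !normrN; case: (ger0P x); lra.
Qed.

(** The one-dimensional lemma is used twice, in y for each rational interval in x, then in x on
    almost every line. This replaces a density argument for products among test functions. *)
Lemma ae_eq0_of_tensor f : loc2 f ->
  (forall a b, smooth1 a -> csupp a -> smooth1 b -> csupp b ->
    \int2_ z (f z * (a z.1 * b z.2)) = 0) ->
  {ae @leb2 R, forall z, f z = 0}.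
Proof.
move=> [mf locf] f0.
have H (M : nat) : {ae @leb2 R, forall z, f z * (box M z.1 * box M z.2) = 0}.
  pose F (z : R * R) := f z * (box M z.1 * box M z.2).
  have iF : rintegrable2 F by exact: locf.
  have F0 c d p q : \int2_ z (F z * (\1_`]c, d[ z.1 * \1_`]p, q[ z.2)) = 0.
    (* Once the intervals are cut down to ]-M, M[, the bumps vanish outside the box, so that F may
       be replaced by f under the integral. *)
    pose c' := Num.max (- M%:R) c; pose d' := Num.min M%:R d.
    pose p' := Num.max (- M%:R) p; pose q' := Num.min M%:R q.
    transitivity (\int2_ z (F z * (\1_`]c', d'[ z.1 * \1_`]p', q'[ z.2))).
      apply: eq_Rint => z; rewrite -!indicM_itv -/(box M _) /F.
      have bb x : box M x * box M x = box M x.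
        by rewrite /box indicE -natrM mulnb andbb.
      rewrite -[in LHS]bb -[X in _ * (_ * X) * _ = _]bb; ring.
    have : \int2_ z (F z * (bump n c' d' z.1 * bump n p' q' z.2)) @[n --> \oo] -->
        \int2_ z (F z * (\1_`]c', d'[ z.1 * \1_`]p', q'[ z.2)).
      apply: (@cvg_int2_tensor _ F (fun n => bump n c' d') (fun n => bump n p' q')
        \1_`]c', d'[ \1_`]p', q'[ 1 1) => //.
      - by move=> n; apply: smooth1_measurable; exact: smooth1_bump.
      - by move=> n; apply: smooth1_measurable; exact: smooth1_bump.
      - by move=> x; exact: bump_cvg.
      - by move=> x; exact: bump_cvg.
      - by move=> n x; exact: bump_norm_le1.
      - by move=> n x; exact: bump_norm_le1.
    move=> /(cvg_lim (@Rhausdorff R)) <-.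
    rewrite (_ : (fun n => _) = cst 0) ?lim_cst//; apply/funext => n.
    rewrite -[RHS](f0 (bump n c' d') (bump n p' q')); last 4 first.
    - exact: smooth1_bump.
    - exact: csupp_bump.
    - exact: smooth1_bump.
    - exact: csupp_bump.
    have bbox (x e1 e2 : R) : box M x * bump n (Num.max (- M%:R) e1) (Num.min M%:R e2) x =
        bump n (Num.max (- M%:R) e1) (Num.min M%:R e2) x.
      rewrite /box indicE; case: (boolP (x \in _)) => xM; first by rewrite mul1r.
      rewrite bump_out ?mulr0//; move: xM; rewrite mem_setE !in_itv/=.
      by apply: contra; rewrite gt_max lt_min => /andP[/andP[-> _] /andP[-> _]].
    apply: eq_Rint => z; rewrite -[in RHS]bbox -[X in _ = _ * (_ * X)]bbox /F; ring.
  have mI (p q : R) : measurable_fun setT (fun z : R * R => \1_`]p, q[ z.1 : R).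
    by apply: (measurableT_comp _ measurable_fst); exact: measurable_indic.
  have E : {ae mu, forall y, forall i : rat * rat,
      \int[mu]_x (F (x, y) * \1_`]ratr i.1, ratr i.2[ x) = 0}.
    apply: ae_forall_count => -[c d].
    apply: (@ae_slice_eq0 _ (fun z => F z * \1_`]ratr c, ratr d[ z.1)).
      exact: rintegrable_mul_bounded iF (mI _ _) (fun z => indic01 _ z.1).
    move=> p q; rewrite -[RHS](F0 (ratr c) (ratr d) p q).
    by apply: eq_Rint => z; rewrite mulrA.
  have E2 : {ae mu, forall y, \int[mu]_x `|F (x, y)| = 0}.
    move: (ae_and (slice2_integrable iF) E); apply: ae_imp => y [iy Ey].
    rewrite -[RHS](Rint0 mu).
    apply: (ae_eq_Rint (mu := mu)).
    - by apply: measurableT_comp => //; exact: rintegrable_meas iy.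
    - exact: measurable_cst.
    have : {ae mu, forall x, F (x, y) = 0}.
      apply: ae_eq0_of_integral_itv.
      - exact: rintegrable_meas iy.
      - by move=> a b; exact: integrableS iy.
      - by move=> q r; rewrite integral_itv_indic; exact: (Ey (q, r)).
    by apply: ae_imp => x ->; rewrite normr0.
  have iN : rintegrable2 (fun z => `|F z|) by exact: rintegrable_norm.
  have N0 : \int2_ z `|F z| = 0.
    rewrite -(Rfubini2 iN).
    rewrite -[RHS](Rint0 mu).
    apply: (ae_eq_Rint (mu := mu)).
    - exact: rintegrable_meas (Rfubini2_integrable iN).
    - exact: measurable_cst.
    - by move: E2; apply: ae_imp => y ->.
  have mF : measurable_fun setT (EFin \o F) by exact: measurable_int iF.
  have := (ae_eq_integral_abs (@leb2 R) measurableT mF).1.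
  have -> : (\int[@leb2 R]_z `|(EFin \o F) z|)%E = 0%E.
    rewrite -[RHS]/((0 : R)%:E) -N0 fineK//; exact: integrable_fin_num iN.
  by move=> /(_ erefl); apply: ae_imp => z /(_ I) [].
move/ae_foralln : H; apply: ae_imp => z Hz.
pose M := Num.bound (`|z.1| + `|z.2| + 1).
have := Hz M; rewrite /box !indicE !mem_set ?mulr1//=.
- rewrite in_itv/= -ltr_norml.
  apply: (@lt_trans _ _ (`|z.1| + `|z.2| + 1)); last first.
    by rewrite archi_boundP// !addr_ge0.
  by have := normr_ge0 z.1; lra.
- rewrite in_itv/= -ltr_norml.
  apply: (@lt_trans _ _ (`|z.1| + `|z.2| + 1)); last first.
    by rewrite archi_boundP// !addr_ge0.
  by have := normr_ge0 z.2; lra.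
Qed.

End du_Bois_Reymond_plane.

Local Open Scope complex_scope.

(** * Products a(x) b(y) as test functions of the plane *)

Section tensor_test_functions.
Context {R : realType}.
Implicit Types (a b : R -> R) (f g : R * R -> R).

(** A class stable under all directional derivatives, that of a(x) b(y) along v being v.1 a' b + v.2
    a b'. The condition [smooth2] then follows by induction on the list of directions. *)
Inductive tensor_sum : (R * R -> R) -> Prop :=
| tensor_prod a b : smooth1 a -> smooth1 b -> tensor_sum (fun z => a z.1 * b z.2)
| tensor_add f g : tensor_sum f -> tensor_sum g -> tensor_sum (fun z => f z + g z).

Lemma is_derive_line f (z v : R * R) (df : R) :
  is_derive (0 : R) 1 (fun h : R => f (h *: v + z)) df -> is_derive z v f df.
Proof.
move=> [d e]; have dz : derivable f z v by exact/derivable1P.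
split => //; rewrite -e /derive.
rewrite (_ : (fun h : R => h^-1 *: (f (h *: v + z) - f z)) = fun h : R =>
  h^-1 *: (f ((h *: 1 + 0) *: v + z) - f (0 *: v + z)))//.
by apply/funext => h; rewrite [h *: 1]mulr1 addr0 scale0r add0r.
Qed.

Lemma is_derive_tensor a b (z v : R * R) : smooth1 a -> smooth1 b ->
  is_derive z v (fun z : R * R => a z.1 * b z.2)
    (v.1 * derive1 a z.1 * b z.2 + a z.1 * (v.2 * derive1 b z.2)).
Proof.
move=> sa sb; apply: is_derive_line.
have da : is_derive (0:R) 1 (fun h : R => a (v.1 * h + z.1)) (derive1 a z.1 * v.1).
  have sa0 : is_derive (v.1 * 0 + z.1) 1 a (derive1 a z.1).
    by rewrite mulr0 add0r; exact: smooth1_is_derive.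
  exact: (@is_derive1_comp R a (fun h => v.1 * h + z.1) 0 _ _ sa0
    (is_derive_affine v.1 z.1 0)).
have db : is_derive (0:R) 1 (fun h : R => b (v.2 * h + z.2)) (derive1 b z.2 * v.2).
  have sb0 : is_derive (v.2 * 0 + z.2) 1 b (derive1 b z.2).
    by rewrite mulr0 add0r; exact: smooth1_is_derive.
  exact: (@is_derive1_comp R b (fun h => v.2 * h + z.2) 0 _ _ sb0
    (is_derive_affine v.2 z.2 0)).
have [d e] := is_deriveM da db.
have E : (fun h : R => a (h *: v + z).1 * b (h *: v + z).2) =
    (fun h => a (v.1 * h + z.1) * b (v.2 * h + z.2)).
  by apply/funext => h /=; rewrite [v.1 * h]mulrC [v.2 * h]mulrC.
rewrite E; split; first exact: d.
rewrite [LHS]e /GRing.scale/= !mulr0 !add0r; ring.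
Qed.

Lemma smooth1Z (k : R) a : smooth1 a -> smooth1 (fun x => k * a x).
Proof. by apply: smooth1M; exact: smooth1_cst. Qed.

Lemma tensor_sum_derive f (v : R * R) : tensor_sum f ->
  (forall z, derivable f z v) /\ tensor_sum (fun z => 'D_v f z).
Proof.
elim=> [a b sa sb|{}f g sf [df tf] sg [dg tg]].
  have H z := is_derive_tensor z v sa sb.
  split; first by move=> z; have [] := H z.
  rewrite (_ : (fun z => _) = fun z =>
    v.1 * derive1 a z.1 * b z.2 + a z.1 * (v.2 * derive1 b z.2)); last first.
    by apply/funext => z; have [] := H z.
  apply: (@tensor_add (fun z => v.1 * derive1 a z.1 * b z.2)).
    apply: (@tensor_prod (fun x => v.1 * derive1 a x)) => //.
    exact/smooth1Z/smooth1_derive.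
  apply: (@tensor_prod a (fun x => v.2 * derive1 b x)) => //.
  exact/smooth1Z/smooth1_derive.
split; first by move=> z; exact: derivableD.
rewrite (_ : (fun z => _) = fun z => 'D_v f z + 'D_v g z).
  exact: tensor_add.
by apply/funext => z; rewrite deriveD.
Qed.

Lemma tensor_sum_continuous f : tensor_sum f -> continuous f.
Proof.
elim=> [a b sa sb|{}f g sf cf sg cg] z; last by apply: cvgD; [exact: cf|exact: cg].
apply: cvgM.
  apply: (@continuous_comp _ _ _ fst a); first exact: cvg_fst.
  exact: smooth1_continuous sa _.
apply: (@continuous_comp _ _ _ snd b); first exact: cvg_snd.
exact: smooth1_continuous sb _.
Qed.

Lemma test_function_tensor a b : smooth1 a -> csupp a -> smooth1 b -> csupp b ->
  test_function (fun z => a z.1 * b z.2).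
Proof.
move=> sa [A aA] sb [B bB]; split.
  move=> s /=; set g := foldr _ _ s.
  have tg : tensor_sum g.
    rewrite {}/g; elim: s => [|v s IH] /=; first exact: tensor_prod.
    by have [] := tensor_sum_derive v IH.
  split; first exact: tensor_sum_continuous.
  by move=> z v; have [] := tensor_sum_derive v tg.
apply: (@subclosed_compact _ _ (`[- `|A|, `|A|] `*` `[- `|B|, `|B|])).
- exact: closed_closure.
- by apply: compact_setX; exact: segment_compact.
have cK : closed ((`[- `|A|, `|A|] `*` `[- `|B|, `|B|]) : set (R * R)).
  apply: compact_closed; first exact: (@norm_hausdorff R (R * R)%type).
  by apply: compact_setX; exact: segment_compact.
rewrite [X in _ `<=` X]((closure_id _).1 cK).
apply: closure_subset => z /=; rewrite mulf_eq0 negb_or => /andP[az bz].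
split => /=; rewrite in_itv/= -ler_norml leNgt.
  by apply: contra az => /ltW h; rewrite aA// (le_trans (ler_norm _) h).
by apply: contra bz => /ltW h; rewrite bB// (le_trans (ler_norm _) h).
Qed.

Lemma smooth1_iter m a : smooth1 a -> smooth1 (iter m (@derive1 R R) a).
Proof. by move=> sa; elim: m => //= m IH; exact: smooth1_derive. Qed.

Lemma pderiv_tensor p q a b : smooth1 a -> smooth1 b ->
  pderiv p q (fun z => a z.1 * b z.2) =
  fun z => iter p (@derive1 R R) a z.1 * iter q (@derive1 R R) b z.2.
Proof.
move=> sa sb; rewrite /pderiv.
have -> : iter q (fun g (z : R * R) => 'D_((0, 1) : R * R) g z)
    (fun z => a z.1 * b z.2) = fun z => a z.1 * iter q (@derive1 R R) b z.2.
  elim: q => //= q ->; apply/funext => z.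
  have [_ ->] := is_derive_tensor z (0, 1) sa (smooth1_iter q sb).
  by rewrite /= !mul0r add0r mul1r.
elim: p => //= p ->; apply/funext => z.
have [_ ->] := is_derive_tensor z (1, 0) (smooth1_iter p sa) (smooth1_iter q sb).
by rewrite /= !mul0r mulr0 addr0 mul1r.
Qed.

End tensor_test_functions.

(** * Real and imaginary parts of weak derivatives *)

Section real_weak_derivatives.
Context {R : realType}.
Implicit Types (u v : R * R -> R) (f g : R * R -> R[i]).
Local Notation normc := ComplexField.Normc.normc.

Definition rwd p q u v := forall a b : R -> R,
  smooth1 a -> csupp a -> smooth1 b -> csupp b ->
  \int2_ z (u z * (iter p (@derive1 R R) a z.1 * iter q (@derive1 R R) b z.2)) =
  (-1) ^+ (p + q) * \int2_ z (v z * (a z.1 * b z.2)).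

Lemma is_wderiv_rwd p q f g : is_wderiv p q f g ->
  rwd p q (fun z => complex.Re (f z)) (fun z => complex.Re (g z)) /\
  rwd p q (fun z => complex.Im (f z)) (fun z => complex.Im (g z)).
Proof.
move=> [_ _ fg]; split => a b sa ca sb cb.
  have := fg _ (test_function_tensor sa ca sb cb).
  rewrite pderiv_tensor// => /(congr1 (@complex.Re R)).
  rewrite /cintegral.
  have sgn (c : R[i]) : complex.Re ((-1) ^+ (p + q) * c) = (-1) ^+ (p + q) * complex.Re c.
    rewrite -signr_odd -[in RHS]signr_odd.
    by case: (odd _); rewrite ?expr1 ?expr0 ?mulN1r ?mul1r//; case: c.
  rewrite sgn /= => H.
  transitivity (\int2_ z (complex.Re (f z *
    (iter p (@derive1 R R) a z.1 * iter q (@derive1 R R) b z.2)%:C))).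
    by apply: eq_Rint => z; case: (f z) => x y /=; rewrite mulr0 subr0.
  rewrite H; congr (_ * _); apply: eq_Rint => z; case: (g z) => x y /=.
  by rewrite mulr0 subr0.
have := fg _ (test_function_tensor sa ca sb cb).
rewrite pderiv_tensor// => /(congr1 (@complex.Im R)).
rewrite /cintegral.
have sgn (c : R[i]) : complex.Im ((-1) ^+ (p + q) * c) = (-1) ^+ (p + q) * complex.Im c.
  rewrite -signr_odd -[in RHS]signr_odd.
  by case: (odd _); rewrite ?expr1 ?expr0 ?mulN1r ?mul1r//; case: c.
rewrite sgn /= => H.
transitivity (\int2_ z (complex.Im (f z *
  (iter p (@derive1 R R) a z.1 * iter q (@derive1 R R) b z.2)%:C))).
  by apply: eq_Rint => z; case: (f z) => x y /=; rewrite mulr0 add0r.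
rewrite H; congr (_ * _); apply: eq_Rint => z; case: (g z) => x y /=.
by rewrite mulr0 add0r.
Qed.

(** Testing v against a' amounts to testing u against the derivative of order p + 1 of a; the sign
    (-1)^(p + q) is its own inverse. *)
Lemma rwd_wdx p q u v v' : rwd p q u v -> rwd p.+1 q u v' -> wdx v v'.
Proof.
move=> h h' a b sa ca sb cb.
have := h _ _ (smooth1_derive sa) (smooth1_csupp_derive sa ca) sb cb.
rewrite -iterSr (h' _ _ sa ca sb cb) addSn exprS -mulrA mulN1r.
rewrite -mulrN => /(congr1 (fun x => (-1) ^+ (p + q) * x)).
by rewrite !mulrA -!exprD addnn -mul2n exprM sqrrN !expr1n !mul1r => <-.
Qed.

Lemma rwd_wdy p q u v v' : rwd p q u v -> rwd p q.+1 u v' -> wdy v v'.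
Proof.
move=> h h' a b sa ca sb cb.
have := h _ _ sa ca (smooth1_derive sb) (smooth1_csupp_derive sb cb).
rewrite -iterSr (h' _ _ sa ca sb cb) addnS exprS -mulrA mulN1r.
rewrite -mulrN => /(congr1 (fun x => (-1) ^+ (p + q) * x)).
by rewrite !mulrA -!exprD addnn -mul2n exprM sqrrN !expr1n !mul1r => <-.
Qed.

(** Since [wderiv] makes a choice, even [wderiv 0 0 f] is not f itself; with p = q = 0 this
    identifies them almost everywhere. *)
Lemma rwd_unique p q u v v' : loc2 v -> loc2 v' -> rwd p q u v -> rwd p q u v' ->
  {ae @leb2 R, forall z, v z = v' z}.
Proof.
move=> lv lv' h h'.
suff : {ae @leb2 R, forall z, v z - v' z = 0}.
  by apply: ae_imp => z /eqP; rewrite subr_eq0 => /eqP.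
apply: ae_eq0_of_tensor; first exact: loc2B.
move=> a b sa ca sb cb; under eq_Rint do rewrite mulrBl.
rewrite RintB; [|exact: loc2_tensor|exact: loc2_tensor].
apply/eqP; rewrite subr_eq0; apply/eqP.
have := h _ _ sa ca sb cb; rewrite (h' _ _ sa ca sb cb).
move=> /(congr1 (fun x => (-1) ^+ (p + q) * x)).
by rewrite !mulrA -!exprD addnn -mul2n exprM sqrrN !expr1n !mul1r => <-.
Qed.

Lemma normc_ge_Re (c : R[i]) : `|complex.Re c| <= normc c.
Proof.
by case: c => x y /=; rewrite -sqrtr_sqr ler_sqrt ?addr_ge0 ?sqr_ge0// lerDl sqr_ge0.
Qed.

Lemma normc_ge_Im (c : R[i]) : `|complex.Im c| <= normc c.
Proof.
by case: c => x y /=; rewrite -sqrtr_sqr ler_sqrt ?addr_ge0 ?sqr_ge0// lerDr sqr_ge0.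
Qed.

Lemma measurable_normc f : cmeasurable f -> measurable_fun setT (fun z => normc (f z)).
Proof.
move=> [mr mi].
rewrite [X in measurable_fun _ X](_ : _ = fun z =>
  Num.sqrt (complex.Re (f z) ^+ 2 + complex.Im (f z) ^+ 2)); last first.
  by apply/funext => z; case: (f z).
have ms : measurable_fun setT (@Num.sqrt R).
  by apply: continuous_measurable_fun => x; exact: sqrt_continuous.
have mD : measurable_fun setT (fun z => complex.Re (f z) ^+ 2 + complex.Im (f z) ^+ 2).
  by apply: measurable_funD; exact: measurable_funX.
exact: (measurableT_comp ms mD).
Qed.

Lemma locally_integrable2_loc2 f (h : R[i] -> R) :
  (forall c, `|h c| <= normc c) -> measurable_fun setT (fun z => h (f z)) ->
  locally_integrable2 f -> loc2 (fun z => h (f z)).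
Proof.
move=> hn mh [cmf lf]; split => // M.
have mnf := measurable_normc cmf.
have mb : measurable_fun setT (fun z : R * R => box M z.1 * box M z.2).
  by apply: measurable_tensor; exact: measurable_indic.
pose K : set (R * R) := `[- M%:R, M%:R] `*` `[- M%:R, M%:R].
have cK : compact K by apply: compact_setX; exact: segment_compact.
have mK : measurable K by apply: measurableX.
apply: (@rintegrable_le _ _ _ (@leb2 R) _ (fun z => normc (f z) * \1_K z)).
- exact: measurable_funM.
- apply/integrableP; split.
    by apply/measurable_EFinP; apply: measurable_funM => //; exact: measurable_indic.
  apply: le_lt_trans (lf K cK); rewrite [leRHS]integral_mkcond.
  rewrite le_eqVlt; apply/orP; left; apply/eqP; apply: eq_integral => z _.
  rewrite patchE /= indicE; case: ifPn => _ /=; rewrite ?mulr1 ?mulr0 ?normr0//.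
  by rewrite ger0_norm//; case: (f z) => x y; exact: sqrtr_ge0.
- move=> z; rewrite normrM ler_pM//; rewrite /box !indicE.
  case: (boolP (z.1 \in _)) => z1; last by rewrite mul0r normr0.
  case: (boolP (z.2 \in _)) => z2; last by rewrite mulr0 normr0.
  rewrite mem_set ?mulr1 ?normr1//; move: z1 z2; rewrite !mem_setE => z1 z2.
  by split; apply: subset_itv_oo_cc.
Qed.

End real_weak_derivatives.

(** * The conjugated operator *)

Section square_integrable_functions.
Context {R : realType}.
Implicit Types u v : R * R -> R.

Definition L2 u := measurable_fun setT u /\ rintegrable2 (fun z => u z ^+ 2).

Definition ip u v : R := \int2_ z (u z * v z).

Lemma L2_ip u v : L2 u -> L2 v -> rintegrable2 (fun z => u z * v z).
Proof.
move=> [mu_ iu] [mv iv].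
apply: (@rintegrable_le _ _ _ (@leb2 R) _ (fun z => u z ^+ 2 + v z ^+ 2)).
- exact: measurable_funM.
- exact: rintegrableD.
- move=> z; rewrite ler_norml; have := sqr_ge0 (u z - v z).
  by have := sqr_ge0 (u z + v z); nra.
Qed.

Lemma L2Z (k : R) u : L2 u -> L2 (fun z => k * u z).
Proof.
move=> [mu_ iu]; split; first by apply: measurable_funM => //; exact: measurable_cst.
by have := rintegrableZ (k ^+ 2) iu; under eq_fun do rewrite -exprMn.
Qed.

Lemma L2D u v : L2 u -> L2 v -> L2 (fun z => u z + v z).
Proof.
move=> hu hv; have iuv := L2_ip hu hv; have [mu_ iu] := hu; have [mv iv] := hv.
split; first exact: measurable_funD.
have := rintegrableD (rintegrableD iu (rintegrableZ 2 iuv)) iv.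
by apply: eq_integrable => // z _ /=; congr (_%:E); ring.
Qed.

Lemma L2B u v : L2 u -> L2 v -> L2 (fun z => u z - v z).
Proof.
move=> hu /(L2Z (-1)) hv; have := L2D hu hv.
by under eq_fun do rewrite mulN1r.
Qed.

Lemma ipC u v : ip u v = ip v u.
Proof. by apply: eq_Rint => z; rewrite mulrC. Qed.

Lemma ipDl u u' v : L2 u -> L2 u' -> L2 v ->
  ip (fun z => u z + u' z) v = ip u v + ip u' v.
Proof.
move=> hu hu' hv; rewrite /ip -RintD; [|exact: L2_ip|exact: L2_ip].
by apply: eq_Rint => z; rewrite mulrDl.
Qed.

Lemma ipZl (k : R) u v : L2 u -> L2 v -> ip (fun z => k * u z) v = k * ip u v.
Proof.
move=> hu hv; rewrite /ip -RintZ; last exact: L2_ip.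
by apply: eq_Rint => z; rewrite mulrA.
Qed.

Lemma ipDr u v v' : L2 u -> L2 v -> L2 v' ->
  ip u (fun z => v z + v' z) = ip u v + ip u v'.
Proof. by move=> hu hv hv'; rewrite ipC ipDl// ipC [ip v' u]ipC. Qed.

Lemma ipZr (k : R) u v : L2 u -> L2 v -> ip u (fun z => k * v z) = k * ip u v.
Proof. by move=> hu hv; rewrite ipC ipZl// ipC. Qed.

Lemma ipBl u u' v : L2 u -> L2 u' -> L2 v ->
  ip (fun z => u z - u' z) v = ip u v - ip u' v.
Proof.
move=> hu hu' hv; rewrite /ip -RintB; [|exact: L2_ip|exact: L2_ip].
by apply: eq_Rint => z; rewrite mulrBl.
Qed.

Lemma ipBr u v v' : L2 u -> L2 v -> L2 v' ->
  ip u (fun z => v z - v' z) = ip u v - ip u v'.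
Proof. by move=> hu hv hv'; rewrite ipC ipBl// ipC [ip v' u]ipC. Qed.

Lemma ip_ge0 u : 0 <= ip u u.
Proof. by apply: Rintegral_ge0 => z _; rewrite -expr2 sqr_ge0. Qed.

Lemma Cauchy_Schwarz u v : L2 u -> L2 v -> ip u v ^+ 2 <= ip u u * ip v v.
Proof.
move=> hu hv.
have H (k l : R) : 0 <= k ^+ 2 * ip u u + 2 * k * l * ip u v + l ^+ 2 * ip v v.
  have := ip_ge0 (fun z => k * u z + l * v z).
  have hku := L2Z k hu; have hlv := L2Z l hv; have hs := L2D hku hlv.
  rewrite ipDl// !ipDr// !ipZl// !ipZr// [ip v u]ipC.
  by congr (0 <= _); ring.
have [v0|v0] := eqVneq (ip v v) 0; last first.
  have vp : 0 < ip v v by rewrite lt_neqAle eq_sym v0 ip_ge0.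
  (* The minimiser of |u + s v|^2 is s = -<u, v> / <v, v>; here the denominator has been cleared. *)
  have := H (ip v v) (- ip u v).
  rewrite (_ : _ + _ = ip v v * (ip u u * ip v v - ip u v ^+ 2)); last by ring.
  by rewrite pmulr_rge0// subr_ge0.
rewrite v0 mulr0; have [->|uv0] := eqVneq (ip u v) 0; first by rewrite expr0n.
(* When <v, v> = 0 the form is affine in l, and this l would give it the value -1. *)
have := H 1 (- (ip u u + 1) / (2 * ip u v)).
rewrite v0 mulr0 addr0 expr1n mul1r mulr1.
rewrite (_ : _ * _ * ip u v = - (ip u u + 1)); last by field.
by rewrite opprD addrA subrr sub0r oppr_ge0 ler10.
Qed.

End square_integrable_functions.

(** * Functions square integrable against every exponential weight *)

Section exponentially_decaying_functions.
Context {R : realType}.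
Local Notation mu := (@lebesgue_measure R).
Implicit Types u v : R * R -> R.

(** All beta are required at once so that the class is stable under multiplication by any
    [expw al ga], which only increases beta. *)
Definition exp_decaying u := measurable_fun setT u /\
  forall beta : R, 0 < beta -> rintegrable2 (fun z => u z ^+ 2 * exp_weight beta z).

Lemma measurable_exp_weight (beta : R) : measurable_fun setT (exp_weight beta).
Proof.
have m1 : measurable_fun setT (fun x : R => expR (2 * beta * `|x|)).
  apply: continuous_measurable_fun => x.
  apply: continuous_comp; last exact: continuous_expR.
  by apply: cvgM; [exact: cvg_cst|exact: norm_continuous].
exact: (measurable_tensor m1 m1).
Qed.

Lemma exp_weight_gt0 (beta : R) z : 0 < exp_weight beta z.
Proof. by rewrite mulr_gt0// expR_gt0. Qed.

Lemma exp_weight_ge1 (beta : R) z : 0 <= beta -> 1 <= exp_weight beta z.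
Proof.
by move=> b0; rewrite -[leLHS]mulr1 ler_pM// -[leLHS]expR0 ler_expR !mulr_ge0.
Qed.

Lemma decZ (k : R) u : exp_decaying u -> exp_decaying (fun z => k * u z).
Proof.
move=> [mu_ iu]; split; first by apply: measurable_funM => //; exact: measurable_cst.
move=> b b0; have := rintegrableZ (k ^+ 2) (iu b b0).
by apply: eq_integrable => // z _ /=; congr (_%:E); ring.
Qed.

Lemma decD u v : exp_decaying u -> exp_decaying v -> exp_decaying (fun z => u z + v z).
Proof.
move=> [mu_ iu] [mv iv]; split; first exact: measurable_funD.
move=> b b0; apply: (rintegrable_le (mu := @leb2 R) _
  (rintegrableD (rintegrableZ 2 (iu b b0)) (rintegrableZ 2 (iv b b0)))).
  apply: measurable_funM; last exact: measurable_exp_weight.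
  by apply: measurable_funX; exact: measurable_funD.
move=> z; have w0 := exp_weight_gt0 b z.
rewrite ger0_norm; last by rewrite mulr_ge0 ?sqr_ge0// ltW.
set W := exp_weight b z in w0 *.
rewrite -subr_ge0 (_ : _ - _ = (u z - v z) ^+ 2 * W); last by ring.
by rewrite mulr_ge0 ?sqr_ge0// ltW.
Qed.

Lemma decB u v : exp_decaying u -> exp_decaying v -> exp_decaying (fun z => u z - v z).
Proof.
move=> hu /(decZ (-1)) hv; have := decD hu hv.
by under eq_fun do rewrite mulN1r.
Qed.

Lemma dec_L2 u : exp_decaying u -> L2 u.
Proof.
move=> [mu_ iu]; split => //.
apply: (rintegrable_le (mu := @leb2 R) _ (iu 1 ltr01)).
  exact: measurable_funX.
by move=> z; rewrite ger0_norm ?sqr_ge0// ler_peMr ?sqr_ge0// exp_weight_ge1.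
Qed.

Lemma rintegrable_oneDsqrV : rintegrable mu (fun x : R => (1 + x ^+ 2)^-1).
Proof.
have c : continuous (fun x : R => (1 + x ^+ 2)^-1) by exact: continuous_oneDsqrV.
apply/integrableP; split.
  by apply/measurable_EFinP; exact: continuous_measurable_fun.
have g0 (x : R) : 0 <= (1 + x ^+ 2)^-1 by rewrite invr_ge0 addr_ge0// sqr_ge0.
under eq_integral do rewrite /= ger0_norm//.
rewrite ge0_symfun_integralT//; last by move=> x /=; rewrite sqrrN.
rewrite -set_itvcy.
have := @integral0y_oneDsqr R; rewrite /oneDsqr => ->.
by rewrite -EFinM ltry.
Qed.

(** With w = [exp_weight 1] one has |u| <= u^2 w + 1/w, and 1/w is at most the product of 1/(1 +
    x^2) and 1/(1 + y^2), because e^(2|x|) >= (1 + |x|)^2. *)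
Lemma dec_rintegrable u : exp_decaying u -> rintegrable2 u.
Proof.
move=> [mu_ iu].
apply: (rintegrable_le (mu := @leb2 R) mu_ (rintegrableD (iu 1 ltr01)
  (rintegrable_prod rintegrable_oneDsqrV rintegrable_oneDsqrV))).
move=> z; set w := exp_weight 1 z; have w0 : 0 < w by exact: exp_weight_gt0.
have sqr_le (x : R) : 1 + x ^+ 2 <= expR (2 * 1 * `|x|).
  rewrite mulr1 expRM_natl; have := expR_ge1Dx `|x|.
  move=> h; apply: (@le_trans _ _ ((1 + `|x|) ^+ 2)).
    by rewrite -(real_normK (num_real x)); have := normr_ge0 x; nra.
  by rewrite lerXn2r// nnegrE ?addr_ge0 ?expR_ge0.
apply: (@le_trans _ _ (u z ^+ 2 * w + w^-1)); last first.
  rewrite lerD2l -invfM lef_pV2 ?posrE ?mulr_gt0 ?ltr_wpDr ?sqr_ge0//.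
  by rewrite ler_pM ?addr_ge0 ?sqr_ge0.
have -> : u z ^+ 2 = `|u z| ^+ 2 by rewrite real_normK// num_real.
rewrite -(ler_pM2r w0) mulrDl mulVf ?gt_eqF//.
have := sqr_ge0 (`|u z| * w - 1); have := normr_ge0 (u z); nra.
Qed.

Variables al ga : R.

Definition expw (z : R * R) : R := expR (al * z.1) * expR (ga * z.2).

Lemma measurable_expw : measurable_fun setT expw.
Proof.
by apply: (@measurable_tensor _ (fun x => expR (al * x)) (fun y => expR (ga * y)));
  apply: smooth1_measurable; exact: smooth1_expR.
Qed.

Lemma expw_sqr_le z : expw z ^+ 2 <= exp_weight (`|al| + `|ga|) z.
Proof.
rewrite /expw /exp_weight exprMn -!expRM_natl ler_pM ?expR_ge0// ler_expR -mulrA.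
  rewrite ler_wpM2l// (le_trans (ler_norm _))// normrM ler_wpM2r//.
  by rewrite lerDl.
rewrite ler_wpM2l// (le_trans (ler_norm _))// normrM ler_wpM2r//.
by rewrite lerDr.
Qed.

Lemma dec_expw u : exp_decaying u -> exp_decaying (fun z => expw z * u z).
Proof.
move=> [mu_ iu]; split; first by apply: measurable_funM => //; exact: measurable_expw.
move=> b b0; have bb : 0 < `|al| + `|ga| + b by rewrite ltr_wpDl// addr_ge0.
apply: (rintegrable_le (mu := @leb2 R) _ (iu _ bb)).
  apply: measurable_funM; last exact: measurable_exp_weight.
  by apply: measurable_funX; apply: measurable_funM => //; exact: measurable_expw.
move=> z; have w0 := exp_weight_gt0 b z.
rewrite ger0_norm; last by rewrite mulr_ge0 ?sqr_ge0// ltW.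
rewrite exprMn -mulrA mulrCA ler_wpM2l ?sqr_ge0//.
apply: (@le_trans _ _ (exp_weight (`|al| + `|ga|) z * exp_weight b z)).
  by rewrite ler_pM2r// expw_sqr_le.
rewrite /exp_weight mulrACA -!expRD; rewrite le_eqVlt; apply/orP; left; apply/eqP.
by congr expR; ring.
Qed.

End exponentially_decaying_functions.

Section weighted_weak_derivatives.
Context {R : realType}.
Implicit Types u v : R * R -> R.

Lemma dec_tensor u (a b : R -> R) : exp_decaying u ->
  smooth1 a -> csupp a -> smooth1 b -> csupp b ->
  rintegrable2 (fun z => u z * (a z.1 * b z.2)).
Proof.
by move=> hu sa ca sb cb; apply: rintegrable_tensor => //;
  [exact: dec_rintegrable|exact: smooth1_csupp_bounded|exact: smooth1_csupp_bounded].
Qed.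

Lemma wdx_lin (k : R) u v u' v' :
  exp_decaying u -> exp_decaying v -> exp_decaying u' -> exp_decaying v' ->
  wdx u v -> wdx u' v' ->
  wdx (fun z => u z + k * u' z) (fun z => v z + k * v' z).
Proof.
move=> hu hv hu' hv' w w' a b sa ca sb cb.
have sda := smooth1_derive sa; have cda := smooth1_csupp_derive sa ca.
have L (f g : R * R -> R) (c d : R -> R) : exp_decaying f -> exp_decaying g ->
    smooth1 c -> csupp c -> smooth1 d -> csupp d ->
    \int2_ z ((f z + k * g z) * (c z.1 * d z.2)) =
    \int2_ z (f z * (c z.1 * d z.2)) + k * \int2_ z (g z * (c z.1 * d z.2)).
  move=> hf hg sc cc sd cd; rewrite -RintZ; last exact: dec_tensor.
  rewrite -RintD; [|exact: dec_tensor|exact/rintegrableZ/dec_tensor].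
  by apply: eq_Rint => z; ring.
by rewrite !L// w// w'//; ring.
Qed.

Lemma wdy_lin (k : R) u v u' v' :
  exp_decaying u -> exp_decaying v -> exp_decaying u' -> exp_decaying v' ->
  wdy u v -> wdy u' v' ->
  wdy (fun z => u z + k * u' z) (fun z => v z + k * v' z).
Proof.
move=> hu hv hu' hv' w w' a b sa ca sb cb.
have sdb := smooth1_derive sb; have cdb := smooth1_csupp_derive sb cb.
have L (f g : R * R -> R) (c d : R -> R) : exp_decaying f -> exp_decaying g ->
    smooth1 c -> csupp c -> smooth1 d -> csupp d ->
    \int2_ z ((f z + k * g z) * (c z.1 * d z.2)) =
    \int2_ z (f z * (c z.1 * d z.2)) + k * \int2_ z (g z * (c z.1 * d z.2)).
  move=> hf hg sc cc sd cd; rewrite -RintZ; last exact: dec_tensor.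
  rewrite -RintD; [|exact: dec_tensor|exact/rintegrableZ/dec_tensor].
  by apply: eq_Rint => z; ring.
by rewrite !L// w// w'//; ring.
Qed.

Lemma derive1_expRM (l : R) (a : R -> R) x : smooth1 a ->
  derive1 (fun x => expR (l * x) * a x) x =
  expR (l * x) * derive1 a x + l * (expR (l * x) * a x).
Proof.
move=> sa; rewrite derive1M//; last exact: smooth1_expR.
congr (_ + _); rewrite derive1E.
have H : is_derive x 1 (fun x : R => l * x) l.
  by have := is_derive_affine l 0 x; under eq_fun do rewrite addr0.
have [_ e] := @is_derive1_comp R expR (fun x => l * x) x _ _ (is_derive_expR (l * x)) H.
by rewrite [X in _ * X](e : _ = _); ring.
Qed.

Variables al ga : R.
Local Notation expw := (expw al ga).

(** The weight is moved into the test functions, which stay smooth and of compact support;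
    differentiating e^(al x) a(x) produces the term in al. *)
Lemma wdx_expw u v : exp_decaying u -> exp_decaying v -> wdx u v ->
  wdx (fun z => expw z * u z) (fun z => expw z * (v z + al * u z)).
Proof.
move=> hu hv w a b sa ca sb cb.
pose a1 x := expR (al * x) * a x; pose b1 x := expR (ga * x) * b x.
have sa1 : smooth1 a1 by apply: smooth1M => //; exact: smooth1_expR.
have sb1 : smooth1 b1 by apply: smooth1M => //; exact: smooth1_expR.
have ca1 : csupp a1 by exact: csuppM.
have cb1 : csupp b1 by exact: csuppM.
have sda1 := smooth1_derive sa1; have cda1 := smooth1_csupp_derive sa1 ca1.
transitivity (\int2_ z (u z * (derive1 a1 z.1 * b1 z.2)) -
              al * \int2_ z (u z * (a1 z.1 * b1 z.2))).
  rewrite -RintZ; last exact: dec_tensor.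
  rewrite -RintB; [|exact: dec_tensor|exact/rintegrableZ/dec_tensor].
  by apply: eq_Rint => z; rewrite derive1_expRM// /expw /a1 /b1; ring.
rewrite w//.
transitivity (- (\int2_ z (v z * (a1 z.1 * b1 z.2)) +
                 al * \int2_ z (u z * (a1 z.1 * b1 z.2)))); first by ring.
congr (- _); rewrite -RintZ; last exact: dec_tensor.
rewrite -RintD; [|exact: dec_tensor|exact/rintegrableZ/dec_tensor].
by apply: eq_Rint => z; rewrite /expw /a1 /b1; ring.
Qed.

Lemma wdy_expw u v : exp_decaying u -> exp_decaying v -> wdy u v ->
  wdy (fun z => expw z * u z) (fun z => expw z * (v z + ga * u z)).
Proof.
move=> hu hv w a b sa ca sb cb.
pose a1 x := expR (al * x) * a x; pose b1 x := expR (ga * x) * b x.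
have sa1 : smooth1 a1 by apply: smooth1M => //; exact: smooth1_expR.
have sb1 : smooth1 b1 by apply: smooth1M => //; exact: smooth1_expR.
have ca1 : csupp a1 by exact: csuppM.
have cb1 : csupp b1 by exact: csuppM.
have sdb1 := smooth1_derive sb1; have cdb1 := smooth1_csupp_derive sb1 cb1.
transitivity (\int2_ z (u z * (a1 z.1 * derive1 b1 z.2)) -
              ga * \int2_ z (u z * (a1 z.1 * b1 z.2))).
  rewrite -RintZ; last exact: dec_tensor.
  rewrite -RintB; [|exact: dec_tensor|exact/rintegrableZ/dec_tensor].
  by apply: eq_Rint => z; rewrite derive1_expRM// /expw /a1 /b1; ring.
rewrite w//.
transitivity (- (\int2_ z (v z * (a1 z.1 * b1 z.2)) +
                 ga * \int2_ z (u z * (a1 z.1 * b1 z.2)))); first by ring.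
congr (- _); rewrite -RintZ; last exact: dec_tensor.
rewrite -RintD; [|exact: dec_tensor|exact/rintegrableZ/dec_tensor].
by apply: eq_Rint => z; rewrite /expw /a1 /b1; ring.
Qed.

Lemma ip_wdx u1 v1 u2 v2 :
  exp_decaying u1 -> exp_decaying v1 -> exp_decaying u2 -> exp_decaying v2 ->
  wdx u1 v1 -> wdx u2 v2 -> ip v1 u2 = - ip u1 v2.
Proof.
move=> hu1 hv1 hu2 hv2 w1 w2; rewrite /ip.
rewrite (ibp_x (dec_rintegrable hu1) (dec_rintegrable hv1) w1
  (dec_rintegrable hu2) (dec_rintegrable hv2) w2) ?opprK//;
  by apply: L2_ip; exact: dec_L2.
Qed.

Lemma ip_wdy u1 v1 u2 v2 :
  exp_decaying u1 -> exp_decaying v1 -> exp_decaying u2 -> exp_decaying v2 ->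
  wdy u1 v1 -> wdy u2 v2 -> ip v1 u2 = - ip u1 v2.
Proof.
move=> hu1 hv1 hu2 hv2 w1 w2; rewrite /ip.
rewrite (ibp_y (dec_rintegrable hu1) (dec_rintegrable hv1) w1
  (dec_rintegrable hu2) (dec_rintegrable hv2) w2) ?opprK//;
  by apply: L2_ip; exact: dec_L2.
Qed.

End weighted_weak_derivatives.

(** * Conjugation by the weight and the energy inequality at a fixed time *)

Section derivative_families.
Context {R : realType}.
Implicit Types F G : nat -> nat -> R * R -> R.

(* F a b plays the role of the derivative of multi-index (a, b) of F 0 0. *)
Definition deriv_family n F := forall a b, (a + b <= n)%N ->
  [/\ exp_decaying (F a b), (a + b < n)%N -> wdx (F a b) (F a.+1 b) &
      (a + b < n)%N -> wdy (F a b) (F a b.+1)].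

Lemma fam_dec n F a b : deriv_family n F -> (a + b <= n)%N -> exp_decaying (F a b).
Proof. by move=> fF /fF[]. Qed.

Lemma fam_wdx n F a b : deriv_family n F -> (a + b < n)%N -> wdx (F a b) (F a.+1 b).
Proof. by move=> fF ab; have [_ + _] := fF a b (ltnW ab); apply. Qed.

Lemma fam_wdy n F a b : deriv_family n F -> (a + b < n)%N -> wdy (F a b) (F a b.+1).
Proof. by move=> fF ab; have [_ _] := fF a b (ltnW ab); apply. Qed.

Section shifted_derivatives.
Variables al ga : R.

(** The operators d_x + al and d_y + ga acting on whole families: for E = e^(al x + ga y) one has
    d_x (E u) = E (d_x + al) u, and likewise in y. *)
Definition Tx F a b : R * R -> R := fun z => F a.+1 b z + al * F a b z.
Definition Ty F a b : R * R -> R := fun z => F a b.+1 z + ga * F a b z.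

Lemma fam_Tx n F : deriv_family n.+1 F -> deriv_family n (Tx F).
Proof.
move=> fF a b ab; have ab1 : (a.+1 + b <= n.+1)%N by rewrite addSn.
have ab2 : (a + b <= n.+1)%N by exact: leqW.
split.
- by apply: decD; [exact: fam_dec fF _|exact: decZ (fam_dec fF _)].
- move=> abn; have ab3 : (a.+1 + b < n.+1)%N by rewrite addSn.
  apply: wdx_lin.
  + exact: fam_dec fF _.
  + by apply: (fam_dec fF); rewrite !addSn.
  + exact: fam_dec fF _.
  + by apply: (fam_dec fF).
  + exact: fam_wdx fF _.
  + by apply: (fam_wdx fF).
- move=> abn; have ab3 : (a.+1 + b < n.+1)%N by rewrite addSn.
  apply: wdy_lin.
  + exact: fam_dec fF _.
  + by apply: (fam_dec fF); rewrite addnS.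
  + exact: fam_dec fF _.
  + by apply: (fam_dec fF); rewrite addnS.
  + exact: fam_wdy fF _.
  + by apply: (fam_wdy fF).
Qed.

Lemma fam_Ty n F : deriv_family n.+1 F -> deriv_family n (Ty F).
Proof.
move=> fF a b ab; have ab1 : (a + b.+1 <= n.+1)%N by rewrite addnS.
have ab2 : (a + b <= n.+1)%N by exact: leqW.
split.
- by apply: decD; [exact: fam_dec fF _|exact: decZ (fam_dec fF _)].
- move=> abn; have ab3 : (a + b.+1 < n.+1)%N by rewrite addnS.
  apply: wdx_lin.
  + exact: fam_dec fF _.
  + by apply: (fam_dec fF); rewrite addSn.
  + exact: fam_dec fF _.
  + by apply: (fam_dec fF); rewrite addSn.
  + exact: fam_wdx fF _.
  + by apply: (fam_wdx fF).
- move=> abn; have ab3 : (a + b.+1 < n.+1)%N by rewrite addnS.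
  apply: wdy_lin.
  + exact: fam_dec fF _.
  + by apply: (fam_dec fF); rewrite !addnS.
  + exact: fam_dec fF _.
  + by apply: (fam_dec fF).
  + exact: fam_wdy fF _.
  + by apply: (fam_wdy fF).
Qed.

Lemma fam_iter n a b F : deriv_family (n + (a + b)) F ->
  deriv_family n (iter a Tx (iter b Ty F)).
Proof.
elim: a n => [|a IH] n fF /=; last by apply/fam_Tx/IH; rewrite addSn -addnS.
rewrite add0n in fF; elim: b n fF => [|b IH] n fF /=; first by rewrite addn0 in fF.
by apply/fam_Ty/IH; rewrite addSn -addnS.
Qed.

(** In [conjugated] the [Tx] are applied last; a further derivative in y has to be commuted through
    them. *)
Lemma iter_Ty_Tx F a : Ty (iter a Tx F) = iter a Tx (Ty F).
Proof.
elim: a F => //= a IH F; rewrite -IH.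
apply/funext => i; apply/funext => j; apply/funext => z.
by rewrite /Tx /Ty; ring.
Qed.

(** The derivative of multi-index (a, b) of e^(al x + ga y) F 0 0, as shown by [fam_conjugated]. *)
Definition conjugated F a b : R * R -> R :=
  fun z => expw al ga z * iter a Tx (iter b Ty F) 0 0 z.

Lemma fam_conjugated n F : deriv_family n F -> deriv_family n (conjugated F).
Proof.
move=> fF a b ab.
have f0 : deriv_family (n - (a + b)) (iter a Tx (iter b Ty F)).
  by apply: fam_iter; rewrite subnK.
split.
- by apply: dec_expw; exact: fam_dec f0 _.
- rewrite -subn_gt0 => abn; rewrite /conjugated iterS.
  apply: wdx_expw; [exact: fam_dec f0 _|exact: fam_dec f0 _|exact: fam_wdx f0 _].
- rewrite -subn_gt0 => abn; rewrite /conjugated iterS -iter_Ty_Tx.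
  apply: wdy_expw; [exact: fam_dec f0 _|exact: fam_dec f0 _|exact: fam_wdy f0 _].
Qed.

End shifted_derivatives.

Section skew_and_symmetric_parts.
Variables (n : nat) (F G : nat -> nat -> R * R -> R).
Hypotheses (fF : deriv_family n F) (fG : deriv_family n G).

Lemma ip_famx a b c d : (a + b < n)%N -> (c + d < n)%N ->
  ip (F a.+1 b) (G c d) = - ip (F a b) (G c.+1 d).
Proof.
move=> ab cd; apply: ip_wdx.
- exact: fam_dec fF (ltnW ab).
- by apply: fam_dec fF _; rewrite addSn.
- exact: fam_dec fG (ltnW cd).
- by apply: fam_dec fG _; rewrite addSn.
- exact: fam_wdx fF ab.
- exact: fam_wdx fG cd.
Qed.

Lemma ip_famy a b c d : (a + b < n)%N -> (c + d < n)%N ->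
  ip (F a b.+1) (G c d) = - ip (F a b) (G c d.+1).
Proof.
move=> ab cd; apply: ip_wdy.
- exact: fam_dec fF (ltnW ab).
- by apply: fam_dec fF _; rewrite addnS.
- exact: fam_dec fG (ltnW cd).
- by apply: fam_dec fG _; rewrite addnS.
- exact: fam_wdy fF ab.
- exact: fam_wdy fG cd.
Qed.

End skew_and_symmetric_parts.

Definition comb4 (k1 k2 k3 k4 : R) (u1 u2 u3 u4 : R * R -> R) : R * R -> R :=
  fun z => k1 * u1 z + k2 * u2 z + k3 * u3 z + k4 * u4 z.

Lemma L2_comb4 k1 k2 k3 k4 u1 u2 u3 u4 : L2 u1 -> L2 u2 -> L2 u3 -> L2 u4 ->
  L2 (comb4 k1 k2 k3 k4 u1 u2 u3 u4).
Proof. by move=> h1 h2 h3 h4; do 3 (apply: L2D; last exact: L2Z); exact: L2Z. Qed.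

Lemma ip_comb4 k1 k2 k3 k4 u1 u2 u3 u4 v : L2 u1 -> L2 u2 -> L2 u3 -> L2 u4 -> L2 v ->
  ip (comb4 k1 k2 k3 k4 u1 u2 u3 u4) v =
  k1 * ip u1 v + k2 * ip u2 v + k3 * ip u3 v + k4 * ip u4 v.
Proof.
move=> h1 h2 h3 h4 hv.
have l1 := L2Z k1 h1; have l2 := L2Z k2 h2; have l3 := L2Z k3 h3; have l4 := L2Z k4 h4.
rewrite /comb4 ipDl//; last by apply: L2D => //; exact: L2D.
rewrite ipDl//; last exact: L2D.
by rewrite ipDl// !ipZl.
Qed.

Variables al ga : R.

(* (d_x - al)^3 + (d_x - al) (d_y - ga)^2 is the sum of a skew-adjoint and of a
   symmetric operator with constant coefficients, hence commuting. *)
Definition skew G := comb4 1 1 (3 * al ^+ 2 + ga ^+ 2) (2 * al * ga)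
  (G 3 0) (G 1 2) (G 1 0) (G 0 1).
Definition symm G := comb4 (- (3 * al)) (- (2 * ga)) (- al) (- (al ^+ 3 + al * ga ^+ 2))
  (G 2 0) (G 1 1) (G 0 2) (G 0 0).

Lemma conjugated_operator F z :
  expw al ga z * (F 3 0 z + F 1 2 z) =
  skew (conjugated al ga F) z + symm (conjugated al ga F) z.
Proof. by rewrite /skew /symm /comb4 /conjugated /= /Tx /Ty; ring. Qed.

Section identities.
Variables F G : nat -> nat -> R * R -> R.
Hypotheses (fF : deriv_family 3 F) (fG : deriv_family 3 G).

Let lF a b : (a + b <= 3)%N -> L2 (F a b).
Proof. by move=> ab; apply: dec_L2; exact: fam_dec fF ab. Qed.
Let lG a b : (a + b <= 3)%N -> L2 (G a b).
Proof. by move=> ab; apply: dec_L2; exact: fam_dec fG ab. Qed.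

Lemma L2_skew : L2 (skew G).
Proof. by apply: L2_comb4; exact: lG. Qed.

Lemma L2_symm : L2 (symm G).
Proof. by apply: L2_comb4; exact: lG. Qed.

(** Two different families are allowed because the lemma serves for one curve at two times, as
    differentiating Q requires. *)
Lemma symm_symmetric : ip (symm F) (G 0 0) = ip (F 0 0) (symm G).
Proof.
rewrite /symm [RHS]ipC !ip_comb4; try exact: lF; try exact: lG.
have x1 a b c d := @ip_famx _ _ _ fF fG a b c d.
have y1 a b c d := @ip_famy _ _ _ fF fG a b c d.
rewrite ![ip (G _ _) _]ipC.
by rewrite (x1 1 0 0 0)// (x1 0 0 1 0)// (x1 0 1 0 0)// (y1 0 0 1 0)//
  (y1 0 1 0 0)// (y1 0 0 0 1)// !opprK.
Qed.

Let x1 a b c d := @ip_famx _ _ _ fG fG a b c d.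
Let y1 a b c d := @ip_famy _ _ _ fG fG a b c d.

Let self0 (x : R) : x = - x -> x = 0.
Proof. by lra. Qed.

Let selfx a b : (a + b < 3)%N -> ip (G a.+1 b) (G a b) = 0.
Proof. by move=> ab; apply: self0; rewrite {1}x1// ipC. Qed.

Let selfy a b : (a + b < 3)%N -> ip (G a b.+1) (G a b) = 0.
Proof. by move=> ab; apply: self0; rewrite {1}y1// ipC. Qed.

Let selfx' a b : (a + b < 3)%N -> ip (G a b) (G a.+1 b) = 0.
Proof. by rewrite ipC; exact: selfx. Qed.

Let selfy' a b : (a + b < 3)%N -> ip (G a b) (G a b.+1) = 0.
Proof. by rewrite ipC; exact: selfy. Qed.

Lemma skew_ip0 : ip (skew G) (G 0 0) = 0.
Proof.
rewrite /skew !ip_comb4; try exact: lG.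
rewrite (@x1 2 0 0 0)// (@selfx 1 0)// (@y1 1 1 0 0)// (@selfx 0 1)//.
by rewrite (@selfx 0 0)// (@selfy 0 0)// !oppr0 !mulr0 !addr0.
Qed.

(** Commuting the operators would require derivatives of order five, and only three are at hand.
    Instead each of the sixteen pairings joins a derivative of odd order to one of even order, and
    integration by parts within order three reduces it to a pairing of some u with a first
    derivative of u, which is its own opposite. *)
Lemma skew_ip_symm0 : ip (skew G) (symm G) = 0.
Proof.
rewrite /skew /symm ip_comb4; try exact: lG; last exact: L2_symm.
rewrite ![ip (G _ _) (comb4 _ _ _ _ _ _ _ _)]ipC !ip_comb4; try exact: lG.
have e1 : ip (G 2 0) (G 3 0) = 0 by exact: selfx'.
have e2 : ip (G 1 1) (G 3 0) = 0 by rewrite ipC x1// selfy' ?oppr0.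
have e12 : ip (G 1 2) (G 2 0) = 0 by rewrite y1// selfx' ?oppr0.
have e3 : ip (G 0 2) (G 3 0) = 0 by rewrite ipC x1// ipC e12 oppr0.
have e4 : ip (G 0 0) (G 3 0) = 0 by rewrite ipC x1// selfx ?oppr0.
have e5 : ip (G 2 0) (G 1 2) = 0 by rewrite ipC.
have e6 : ip (G 1 1) (G 1 2) = 0 by exact: selfy'.
have e7 : ip (G 0 2) (G 1 2) = 0 by exact: selfx'.
have e8 : ip (G 0 0) (G 1 2) = 0 by rewrite ipC y1// selfx ?oppr0.
have e9 : ip (G 2 0) (G 1 0) = 0 by exact: selfx.
have e10 : ip (G 1 1) (G 1 0) = 0 by exact: selfy.
have e11 : ip (G 0 2) (G 1 0) = 0 by rewrite y1// selfx' ?oppr0.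
have e13 : ip (G 0 0) (G 1 0) = 0 by exact: selfx'.
have e14 : ip (G 2 0) (G 0 1) = 0 by rewrite x1// selfy' ?oppr0.
have e15 : ip (G 1 1) (G 0 1) = 0 by exact: selfx.
have e16 : ip (G 0 2) (G 0 1) = 0 by exact: selfy.
have e17 : ip (G 0 0) (G 0 1) = 0 by exact: selfy'.
rewrite e1 e2 e3 e4 e5 e6 e7 e8 e9 e10 e11 e13 e14 e15 e16 e17.
by rewrite !mulr0 !addr0 !mulr0 !addr0.
Qed.

End identities.

Lemma energy_inequality F w' (t : R) : deriv_family 3 F -> L2 w' -> 0 <= t <= 1 ->
  let G := conjugated al ga F in
  let h := fun z => expw al ga z * (w' z + F 3 0 z + F 1 2 z) in
  let N := ip (G 0 0) (G 0 0) in
  let Q := ip (G 0 0) (symm G) in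
  let N' := 2 * ip w' (fun z => expw al ga z * G 0 0 z) in
  let Q' := 2 * ip w' (fun z => expw al ga z * symm G z) in
  L2 h ->
  N <= 2 * (N + (t - 2^-1) * N' - t * (1 - t) * Q' - (1 - 2 * t) * Q) + ip h h.
Proof.
move=> fF lw' /andP[t0 t1] G h N Q N' Q' lh.
have fG : deriv_family 3 G by exact: fam_conjugated.
have lG : L2 (G 0 0) by apply: dec_L2; exact: fam_dec fG _.
have lS := L2_symm fG; have lA := L2_skew fG.
(* This is the weighted w'. It is square integrable because h is, although w' comes without any
   weighted bound at this t. *)
pose e z := h z - skew G z - symm G z.
have eE z : e z = expw al ga z * w' z.
  rewrite /e /h -addrA -opprD -conjugated_operator; ring.
have le : L2 e by apply: L2B => //; exact: L2B.
have ipe v : ip w' (fun z => expw al ga z * v z) = ip e v.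
  by apply: eq_Rint => z; rewrite eE; ring.
have ehv v : L2 v -> ip e v = ip h v - ip (skew G) v - ip (symm G) v.
  by move=> lv; rewrite /e ipBl// ?ipBl//; exact: L2B.
have N'expw : N' = 2 * ip h (G 0 0) - 2 * Q.
  by rewrite /N' ipe ehv// skew_ip0// [ip (symm G) _]ipC -/Q; ring.
have Q'expw : Q' = 2 * ip h (symm G) - 2 * ip (symm G) (symm G).
  by rewrite /Q' ipe ehv// skew_ip_symm0//; ring.
(* The square of h - 2 S g; it says that 2 Q' <= |h|^2. *)
have sq1 : 0 <= ip h h - 4 * ip h (symm G) + 4 * ip (symm G) (symm G).
  have l2 := L2Z 2 lS; have := ip_ge0 (fun z => h z - 2 * symm G z).
  rewrite ipBl//; last exact: L2B.
  by rewrite !ipBr// !ipZl// !ipZr// [ip (symm G) h]ipC; congr (0 <= _); ring.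
(* The square of (1 - 2 t) h - g, which absorbs the pairing <h, g> left in Phi'. *)
have sq2 : 0 <= (1 - 2 * t) ^+ 2 * ip h h - 2 * (1 - 2 * t) * ip h (G 0 0) + N.
  have l2 := L2Z (1 - 2 * t) lh; have := ip_ge0 (fun z => (1 - 2 * t) * h z - G 0 0 z).
  rewrite ipBl//; last exact: L2B.
  by rewrite !ipBr// !ipZl// !ipZr// [ip (G 0 0) h]ipC /N; congr (0 <= _); ring.
have hh := ip_ge0 h.
have tt : 0 <= t * (1 - t) by rewrite mulr_ge0// subr_ge0.
rewrite N'expw Q'expw; have p1 := mulr_ge0 tt sq1; have p2 := mulr_ge0 tt hh.
(* The difference is exactly t (1 - t) times [sq1], plus [sq2], plus 3 t (1 - t) |h|^2, since 1 - (1
   - 2 t)^2 - t (1 - t) = 3 t (1 - t). *)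
rewrite -subr_ge0; apply: le_trans (addr_ge0 (addr_ge0 p1 sq2) (mulr_ge0 (ler0n _ 3) p2)) _.
by rewrite le_eqVlt; apply/orP; left; apply/eqP; field.
Qed.

End derivative_families.

(** * Curves in L2 *)

Section convergence_in_L2.
Context {R : realType}.
Implicit Types u v : R * R -> R.

Definition nsq u : R := ip u u.

Lemma nsq_ge0 u : 0 <= nsq u. Proof. exact: ip_ge0. Qed.

Lemma nsqZ (k : R) u : L2 u -> nsq (fun z => k * u z) = k ^+ 2 * nsq u.
Proof. by move=> hu; have hk := L2Z k hu; rewrite /nsq ipZl// ipZr//; ring. Qed.

Lemma nsqD_le u v : L2 u -> L2 v -> nsq (fun z => u z + v z) <= 2 * nsq u + 2 * nsq v.
Proof.
move=> hu hv; have huv := L2D hu hv; have := nsq_ge0 (fun z => u z - v z).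
have hd := L2B hu hv; rewrite /nsq ipBl// !ipBr// ipDl// !ipDr// [ip v u]ipC; lra.
Qed.

Lemma norm_ip_le u v : L2 u -> L2 v -> `|ip u v| <= Num.sqrt (nsq u * nsq v).
Proof.
move=> hu hv; rewrite -sqrtr_sqr ler_sqrt ?mulr_ge0 ?nsq_ge0//.
exact: Cauchy_Schwarz.
Qed.

Section filtered.
Variables (F : set_system R) (FF : Filter F).

Lemma ip_cvg (u_ v_ : R -> R * R -> R) u v :
  (\forall s \near F, L2 (u_ s)) -> (\forall s \near F, L2 (v_ s)) -> L2 u -> L2 v ->
  nsq (fun z => u_ s z - u z) @[s --> F] --> 0 ->
  nsq (fun z => v_ s z - v z) @[s --> F] --> 0 ->
  ip (u_ s) (v_ s) @[s --> F] --> ip u v.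
Proof.
move=> lu_ lv_ lu lv cu cv.
set p := fun s => nsq (fun z => u_ s z - u z) in cu.
set q := fun s => nsq (fun z => v_ s z - v z) in cv.
pose B s := Num.sqrt (p s * q s) + Num.sqrt (p s * nsq v) + Num.sqrt (nsq u * q s).
have B0 : B s @[s --> F] --> 0.
  have B_lim : Num.sqrt (0 * 0) + Num.sqrt (0 * nsq v) + Num.sqrt (nsq u * 0) = 0 :> R.
    by rewrite !mul0r mulr0 sqrtr0 !addr0.
  rewrite -B_lim; apply: cvgD; [apply: cvgD|];
    (apply: continuous_cvg; first exact: sqrt_continuous);
    by apply: cvgM => //; exact: cvg_cst.
apply/subr_cvg0/(@squeeze_cvgr _ _ _ _ (fun s => - B s) B) => //; last first.
  by rewrite -oppr0; exact: cvgN.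
near=> s; rewrite -ler_norml.
have lus : L2 (u_ s) by near: s.
have lvs : L2 (v_ s) by near: s.
have ldu := L2B lus lu; have ldv := L2B lvs lv.
have -> : ip (u_ s) (v_ s) - ip u v =
    ip (fun z => u_ s z - u z) (fun z => v_ s z - v z) +
    ip (fun z => u_ s z - u z) v + ip u (fun z => v_ s z - v z).
  by rewrite ipBl// !ipBr// ipBl//; ring.
apply: (le_trans (ler_normD _ _)); apply: lerD; last exact: norm_ip_le.
by apply: (le_trans (ler_normD _ _)); apply: lerD; exact: norm_ip_le.
Unshelve. all: by end_near. Qed.

Lemma nsqD_cvg0 (u_ v_ : R -> R * R -> R) :
  (\forall s \near F, L2 (u_ s)) -> (\forall s \near F, L2 (v_ s)) ->
  nsq (u_ s) @[s --> F] --> 0 -> nsq (v_ s) @[s --> F] --> 0 ->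
  nsq (fun z => u_ s z + v_ s z) @[s --> F] --> 0.
Proof.
move=> lu lv cu cv.
apply: (@squeeze_cvgr _ _ _ _ (fun=> 0) (fun s => 2 * nsq (u_ s) + 2 * nsq (v_ s))).
- near=> s; rewrite nsq_ge0/= nsqD_le//; by near: s.
- exact: cvg_cst.
- rewrite [X in _ --> X](_ : 0 = 2 * 0 + 2 * 0); last by rewrite !mulr0 addr0.
  by apply: cvgD; apply: cvgM => //; exact: cvg_cst.
Unshelve. all: by end_near. Qed.

Lemma nsqZ_cvg0 (k : R) (u_ : R -> R * R -> R) :
  (\forall s \near F, L2 (u_ s)) -> nsq (u_ s) @[s --> F] --> 0 ->
  nsq (fun z => k * u_ s z) @[s --> F] --> 0.
Proof.
move=> lu cu.
apply: (@squeeze_cvgr _ _ _ _ (fun=> 0) (fun s => k ^+ 2 * nsq (u_ s))).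
- near=> s; rewrite nsq_ge0/= nsqZ//; by near: s.
- exact: cvg_cst.
- rewrite [X in _ --> X](_ : 0 = k ^+ 2 * 0); last by rewrite mulr0.
  by apply: cvgM => //; exact: cvg_cst.
Unshelve. all: by end_near. Qed.

(* Interpolation: the square of the norm with weight K^2 is at most the product
   of the norm without weight and of the norm with weight K^4. *)
Lemma nsq_weight_cvg0 (K : R * R -> R) (u_ : R -> R * R -> R) (C : R) :
  (\forall s \near F, L2 (u_ s)) ->
  (\forall s \near F, L2 (fun z => K z * (K z * u_ s z))) ->
  (\forall s \near F, nsq (fun z => K z * (K z * u_ s z)) <= C) ->
  nsq (u_ s) @[s --> F] --> 0 -> nsq (fun z => K z * u_ s z) @[s --> F] --> 0.
Proof.
move=> lu lk bk cu.
apply: (@squeeze_cvgr _ _ _ _ (fun=> 0) (fun s => Num.sqrt (C * nsq (u_ s)))).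
- near=> s; rewrite nsq_ge0/=.
  have l1 : L2 (u_ s) by near: s.
  have l2 : L2 (fun z => K z * (K z * u_ s z)) by near: s.
  have -> : nsq (fun z => K z * u_ s z) = ip (fun z => K z * (K z * u_ s z)) (u_ s).
    by apply: eq_Rint => z; ring.
  apply: (le_trans (ler_norm _)); apply: (le_trans (norm_ip_le l2 l1)).
  have bs : nsq (fun z => K z * (K z * u_ s z)) <= C by near: s.
  rewrite ler_sqrt ?ler_wpM2r ?nsq_ge0// mulr_ge0 ?nsq_ge0//.
  exact: le_trans (nsq_ge0 _) bs.
- exact: cvg_cst.
- rewrite [X in _ --> X](_ : 0 = Num.sqrt (C * 0)); last by rewrite mulr0 sqrtr0.
  apply: continuous_cvg; first exact: sqrt_continuous.
  by apply: cvgM => //; exact: cvg_cst.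
Unshelve. all: by end_near. Qed.

End filtered.
End convergence_in_L2.

Section curves.
Context {R : realType}.
Local Notation I := [set` `[0 : R, 1]].
Implicit Types u v : R -> R * R -> R.

Lemma near_within_itv (t : R) (P : R -> Prop) : (forall s, I s -> P s) ->
  \forall s \near within I (nbhs t), P s.
Proof. by move=> H; rewrite near_withinE; apply: nearW => s; exact: H. Qed.

Lemma near_within_ditv (t : R) (P : R -> Prop) : (forall s, I s -> P s) ->
  \forall s \near within I t^', P s.
Proof. by move=> H; rewrite near_withinE; apply: filterE => s; exact: H. Qed.

Definition L2curve u := forall t, I t -> L2 (u t) /\
  nsq (fun z => u s z - u t z) @[s --> within I (nbhs t)] --> 0.

Lemma ip_L2curve u v : L2curve u -> L2curve v ->
  {within I, continuous (fun t => ip (u t) (v t))}.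
Proof.
move=> cu cv; apply/subspace_continuousP => t It.
have [lu tu] := cu t It; have [lv tv] := cv t It.
by apply: ip_cvg => //; apply: near_within_itv => s /[dup] /cu[+ _] /cv[].
Qed.

Lemma cvg_dwithin (f : R -> R) (t l : R) :
  f @ within I (nbhs t) --> l -> f @ within I t^' --> l.
Proof.
move=> H; apply: cvg_trans H; apply: cvg_app => A.
exact: nbhs_dnbhs.
Qed.

Lemma is_derive_ip u v (u' : R * R -> R) (t : R) : L2curve u -> L2curve v -> L2 u' ->
  (forall s t, I s -> I t -> ip (u s) (v t) = ip (u t) (v s)) ->
  t \in `]0, 1[ ->
  nsq (fun z => (s - t)^-1 * (u s z - u t z) - u' z) @[s --> within I t^'] --> 0 ->
  is_derive t 1 (fun s => ip (u s) (v s)) (2 * ip u' (v t)).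
Proof.
move=> cu cv lu' sym t01 du.
have It : I t by exact: subset_itv_oo_cc.
have [lut tu] := cu t It; have [lvt tv] := cv t It.
pose p s : R * R -> R := fun z => (s - t)^-1 * (u s z - u t z).
pose r s : R * R -> R := fun z => v s z + v t z.
have lp s : I s -> L2 (p s) by move=> /cu[lus _]; apply: L2Z; exact: L2B.
have lr s : I s -> L2 (r s) by move=> /cv[lvs _]; exact: L2D.
have H : ip (p s) (r s) @[s --> within I t^'] --> ip u' (r t).
  apply: ip_cvg => //; [exact: near_within_ditv|exact: near_within_ditv|exact: lr|].
  apply: cvg_dwithin.
  rewrite (_ : (fun s => _) = fun s => nsq (fun z => v s z - v t z))//.
  by apply/funext => s; apply: eq_Rint => z; rewrite /r; ring.
have quotE s : I s -> s != t ->
    ip (p s) (r s) = (s - t)^-1 * (ip (u s) (v s) - ip (u t) (v t)).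
  move=> Is st; have [lus _] := cu s Is; have [lvs _] := cv s Is.
  rewrite ipZl//; [|exact: L2B|exact: lr].
  by rewrite ipBl ?ipDr//; [rewrite (sym s t)//; congr (_ * _); ring|exact: lr].
have rt : ip u' (r t) = 2 * ip u' (v t) by rewrite ipDr//; ring.
suff D : h^-1 *: (ip (u (h *: 1 + t)) (v (h *: 1 + t)) - ip (u t) (v t))
    @[h --> 0^'] --> 2 * ip u' (v t).
  split; last exact: (cvg_lim (@Rhausdorff R) D).
  by apply/cvg_ex; exists (2 * ip u' (v t)).
rewrite -rt; apply/cvgrPdist_lt => e e0.
have /nbhs_ballP[d /= d0 hd] : nbhs t (fun s => s != t -> I s ->
    `|ip u' (r t) - ip (p s) (r s)| < e).
  have := (cvgrPdist_lt _ _).1 H e e0.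
  by rewrite near_withinE; rewrite /dnbhs near_withinE; exact.
have [t0 t1] : 0 < t /\ t < 1 by move: t01; rewrite in_itv/= => /andP[].
have m0 : 0 < Num.min d (Num.min t (1 - t)) by rewrite !lt_min d0 t0 subr_gt0.
near=> h.
have hn0 : h != 0 by near: h; exact: nbhs_dnbhs_neq.
have : `|h| < Num.min d (Num.min t (1 - t)) by near: h; exact: dnbhs0_lt.
rewrite !lt_min => /and3P[hd' ht h1].
have hI : I (h + t).
  by rewrite /= in_itv/=; move: ht h1; rewrite !ltr_norml; lra.
have ht' : h + t != t by rewrite -subr_eq0 addrK.
have := hd (h + t); rewrite /ball/= opprD addrCA subrr addr0 normrN => /(_ hd' ht' hI).
by rewrite (quotE _ hI ht') addrK [h *: 1]mulr1.
Unshelve. all: by end_near. Qed.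

End curves.

(** * Curves continuous in every exponentially weighted norm *)

Section weighted_curves.
Context {R : realType}.
Local Notation I := [set` `[0 : R, 1]].
Implicit Types u v : R -> R * R -> R.

Definition Wcurve u := forall t, I t -> exp_decaying (u t) /\ forall al ga : R,
  nsq (fun z => expw al ga z * (u s z - u t z)) @[s --> within I (nbhs t)] --> 0.

Lemma expwM (al ga al' ga' : R) z :
  expw al ga z * expw al' ga' z = expw (al + al') (ga + ga') z.
Proof. by rewrite /expw !mulrDl !expRD; ring. Qed.

Lemma expw00 z : expw (0 : R) 0 z = 1.
Proof. by rewrite /expw !mul0r expR0 mulr1. Qed.

Lemma WcurveD u v : Wcurve u -> Wcurve v -> Wcurve (fun t z => u t z + v t z).
Proof.
move=> cu cv t It; have [du tu] := cu t It; have [dv tv] := cv t It.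
split; first exact: decD.
move=> al ga; rewrite (_ : (fun s => nsq _) = fun s => nsq (fun z =>
  expw al ga z * (u s z - u t z) + expw al ga z * (v s z - v t z))); last first.
  by apply/funext => s; apply: eq_Rint => z; ring.
apply: nsqD_cvg0; [| |exact: tu|exact: tv];
  apply: near_within_itv => s Is; apply/dec_L2/dec_expw/decB => //.
- by have [] := cu s Is.
- by have [] := cv s Is.
Qed.

Lemma WcurveZ (k : R) u : Wcurve u -> Wcurve (fun t z => k * u t z).
Proof.
move=> cu t It; have [du tu] := cu t It.
split; first exact: decZ.
move=> al ga; rewrite (_ : (fun s => nsq _) = fun s => nsq (fun z =>
  k * (expw al ga z * (u s z - u t z)))); last first.
  by apply/funext => s; apply: eq_Rint => z; ring.
apply: nsqZ_cvg0; last exact: tu.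
apply: near_within_itv => s Is; apply/dec_L2/dec_expw/decB => //.
by have [] := cu s Is.
Qed.

Lemma Wcurve_expw (al ga : R) u : Wcurve u -> Wcurve (fun t z => expw al ga z * u t z).
Proof.
move=> cu t It; have [du tu] := cu t It.
split; first exact: dec_expw.
move=> al' ga'; have := tu (al' + al) (ga' + ga).
rewrite (_ : (fun s => nsq _) =
  fun s => nsq (fun z => expw al' ga' z * (expw al ga z * u s z - expw al ga z * u t z)))//.
by apply/funext => s; apply: eq_Rint => z; rewrite -expwM; ring.
Qed.

Lemma Wcurve_L2curve u : Wcurve u -> L2curve u.
Proof.
move=> cu t It; have [du tu] := cu t It; split; first exact: dec_L2.
have := tu 0 0; rewrite (_ : (fun s => nsq _) = fun s => nsq (fun z => u s z - u t z))//.
by apply/funext => s; apply: eq_Rint => z; rewrite expw00 mul1r.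
Qed.

Lemma nsq_expw_le (al ga : R) (f : R * R -> R) : exp_decaying f ->
  nsq (fun z => expw al ga z * f z) <=
  \int2_ z (f z ^+ 2 * exp_weight (`|al| + `|ga| + 1) z).
Proof.
move=> df; have b0 : 0 < `|al| + `|ga| + 1 by rewrite ltr_wpDl// addr_ge0.
apply: le_Rintegral => //.
- have lf := dec_L2 (dec_expw al ga df); exact: (L2_ip lf lf).
- exact: df.2.
- move=> z _; rewrite -expr2 exprMn mulrC ler_wpM2l ?sqr_ge0//.
  apply: (le_trans (expw_sqr_le al ga z)).
  by apply: ler_pM; rewrite ?expR_ge0// ler_expR ler_wpM2r// ler_wpM2l// lerDl.
Qed.

(** Interpolation between continuity without weight and boundedness with doubled exponents. The
    constant 4 C comes from |a - b|^2 <= 2 |a|^2 + 2 |b|^2. *)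
Lemma bounded_Wcurve u : (forall t, I t -> exp_decaying (u t)) ->
  (forall beta : R, 0 < beta -> exists C : R, forall t, I t ->
    \int2_ z (u t z ^+ 2 * exp_weight beta z) <= C) ->
  (forall t, I t -> nsq (fun z => u s z - u t z) @[s --> within I (nbhs t)] --> 0) ->
  Wcurve u.
Proof.
move=> du bu cu t It; split; first exact: du.
move=> al ga.
have [|C hC] := bu (`|al + al| + `|ga + ga| + 1); first by rewrite ltr_wpDl// addr_ge0.
have K2 s : (fun z => expw al ga z * (expw al ga z * (u s z - u t z))) =
    (fun z => expw (al + al) (ga + ga) z * u s z +
              -1 * (expw (al + al) (ga + ga) z * u t z)).
  by apply/funext => z; rewrite -expwM; ring.
apply: (@nsq_weight_cvg0 _ _ _ (expw al ga) _ (4 * C)).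
- by apply: near_within_itv => s Is; apply/dec_L2/decB; exact: du.
- apply: near_within_itv => s Is; rewrite K2.
  by apply: L2D; [|apply: L2Z]; apply/dec_L2/dec_expw/du.
- apply: near_within_itv => s Is; rewrite K2.
  have ls := dec_L2 (dec_expw (al + al) (ga + ga) (du s Is)).
  have lt := dec_L2 (dec_expw (al + al) (ga + ga) (du t It)).
  apply: (le_trans (nsqD_le ls (L2Z (-1) lt))).
  rewrite nsqZ// sqrrN expr1n mul1r.
  have h1 := le_trans (nsq_expw_le _ _ (du s Is)) (hC s Is).
  have h2 := le_trans (nsq_expw_le _ _ (du t It)) (hC t It).
  by move: h1 h2; lra.
- exact: cu.
Qed.

End weighted_curves.

(** * The energy N and the form Q along a curve *)

Section energy_of_a_curve.
Context {R : realType}.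
Local Notation I := [set` `[0 : R, 1]].
Local Notation mu := (@lebesgue_measure R).
Variables (F : R -> nat -> nat -> R * R -> R) (w' : R -> R * R -> R).
Hypothesis famF : forall t, I t -> deriv_family 3 (F t).
Hypothesis curveF : forall a b, (a + b <= 2)%N -> Wcurve (fun t => F t a b).
Hypothesis curvew' : L2curve w'.
Hypothesis derw : forall t, I t ->
  nsq (fun z => (s - t)^-1 * (F s 0 0 z - F t 0 0 z) - w' t z) @[s --> within I t^'] --> 0.
Variables al ga : R.

Let G t := conjugated al ga (F t).

Let fG t : I t -> deriv_family 3 (G t). Proof. by move=> It; exact/fam_conjugated/famF. Qed.

Let curveG a b : (a + b <= 2)%N -> Wcurve (fun t => G t a b).
Proof.
case: a => [|[|[|a]]]; case: b => [|[|[|b]]] //= _; rewrite /G /conjugated /= /Tx /Ty;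
  apply: Wcurve_expw; rewrite ?/Tx ?/Ty;
  repeat first [apply: WcurveD|apply: WcurveZ|exact: curveF].
Qed.

Let curveS : Wcurve (fun t => symm al ga (G t)).
Proof.
by rewrite /symm /comb4; repeat first [apply: WcurveD|apply: WcurveZ|exact: curveG].
Qed.

Let curveEG : Wcurve (fun t z => expw al ga z * G t 0 0 z).
Proof. by apply: Wcurve_expw; exact: curveG. Qed.

Let curveES : Wcurve (fun t z => expw al ga z * symm al ga (G t) z).
Proof. exact: Wcurve_expw. Qed.

Let curve0 : L2curve (fun t => F t 0 0).
Proof. exact/Wcurve_L2curve/curveF. Qed.

Definition energy t := ip (G t 0 0) (G t 0 0).
(** In [N] and [Q] all weights stand in the right factor. The left one is the unweighted curve, the
    only one known to be differentiable, as [is_derive_ip] demands. *)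
Let N t := ip (F t 0 0) (fun z => expw al ga z * G t 0 0 z).
Let Q t := ip (F t 0 0) (fun z => expw al ga z * symm al ga (G t) z).
Let N' t := 2 * ip (w' t) (fun z => expw al ga z * G t 0 0 z).
Let Q' t := 2 * ip (w' t) (fun z => expw al ga z * symm al ga (G t) z).

Let NE t : N t = energy t.
Proof. by apply: eq_Rint => z; rewrite /G /conjugated /=; ring. Qed.

Let QE t : Q t = ip (G t 0 0) (symm al ga (G t)).
Proof. by apply: eq_Rint => z; rewrite /G /conjugated /=; ring. Qed.

Let symN s t : ip (F s 0 0) (fun z => expw al ga z * G t 0 0 z) =
  ip (F t 0 0) (fun z => expw al ga z * G s 0 0 z).
Proof. by apply: eq_Rint => z; rewrite /G /conjugated /=; ring. Qed.

Let symQ s t : I s -> I t -> ip (F s 0 0) (fun z => expw al ga z * symm al ga (G t) z) =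
  ip (F t 0 0) (fun z => expw al ga z * symm al ga (G s) z).
Proof.
move=> Is It; transitivity (ip (G s 0 0) (symm al ga (G t))).
  by apply: eq_Rint => z; rewrite /G /conjugated /=; ring.
rewrite -(symm_symmetric al ga (fG Is) (fG It)) ipC.
by apply: eq_Rint => z; rewrite /G /conjugated /=; ring.
Qed.

Let f t := N t + (t - 2^-1) * N' t - t * (1 - t) * Q' t - (1 - 2 * t) * Q t.
Let Phi t := (t - 2^-1) * N t - t * (1 - t) * Q t.

Let contN : {within I, continuous N}.
Proof. exact: ip_L2curve curve0 (Wcurve_L2curve curveEG). Qed.
Let contQ : {within I, continuous Q}.
Proof. exact: ip_L2curve curve0 (Wcurve_L2curve curveES). Qed.
Let contN' : {within I, continuous N'}.
Proof.
have c := ip_L2curve curvew' (Wcurve_L2curve curveEG).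
by move=> x; apply: cvgM; [exact: cvg_cst|exact: c].
Qed.
Let contQ' : {within I, continuous Q'}.
Proof.
have c := ip_L2curve curvew' (Wcurve_L2curve curveES).
by move=> x; apply: cvgM; [exact: cvg_cst|exact: c].
Qed.

Let cont_poly (p : R -> R) : continuous p -> {within I, continuous p}.
Proof. by move=> cp; exact: continuous_subspaceT. Qed.

Let c1 : continuous (fun t : R => t - 2^-1).
Proof. by move=> t; apply: cvgB; [exact: cvg_id|exact: cvg_cst]. Qed.
Let c2 : continuous (fun t : R => t * (1 - t)).
Proof.
by move=> t; apply: cvgM; [exact: cvg_id|apply: cvgB; [exact: cvg_cst|exact: cvg_id]].
Qed.
Let c3 : continuous (fun t : R => 1 - 2 * t).
Proof.
by move=> t; apply: cvgB; [exact: cvg_cst|apply: cvgM; [exact: cvg_cst|exact: cvg_id]].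
Qed.

Let contf : {within I, continuous f}.
Proof.
move=> x; apply: cvgB; [apply: cvgB; [apply: cvgD|]|].
- exact: contN.
- by apply: cvgM; [exact: (cont_poly c1)|exact: contN'].
- by apply: cvgM; [exact: (cont_poly c2)|exact: contQ'].
- by apply: cvgM; [exact: (cont_poly c3)|exact: contQ].
Qed.

Let contPhi : {within I, continuous Phi}.
Proof.
move=> x; apply: cvgB.
- by apply: cvgM; [exact: (cont_poly c1)|exact: contN].
- by apply: cvgM; [exact: (cont_poly c2)|exact: contQ].
Qed.

Let derPhi (t : R) : t \in `]0, 1[ -> is_derive t 1 Phi (f t).
Proof.
move=> t01; have It : I t by exact: subset_itv_oo_cc.
have dN : is_derive t 1 N (N' t).
  apply: (is_derive_ip curve0 (Wcurve_L2curve curveEG) (curvew' It).1 _ t01 (derw It)).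
  by move=> s s' _ _; exact: symN.
have dQ : is_derive t 1 Q (Q' t).
  exact: (is_derive_ip curve0 (Wcurve_L2curve curveES) (curvew' It).1 symQ t01 (derw It)).
have d1 : is_derive t 1 (fun s : R => s - 2^-1) 1.
  by have := is_derive_affine 1 (- 2^-1) t; under eq_fun do rewrite mul1r.
have d2 : is_derive t 1 (fun s : R => s * (1 - s)) (1 - 2 * t).
  have := is_deriveM (is_derive_affine 1 0 t) (is_derive_affine (-1) 1 t).
  rewrite (_ : _ * _ = fun s : R => s * (1 - s)); last first.
    by apply/funext => s; rewrite mulrfctE; ring.
  by move=> h; apply: (is_derive_eq h); rewrite /GRing.scale/=; ring.
have := is_deriveB (is_deriveM d1 dN) (is_deriveM d2 dQ).
rewrite /GRing.scale/= => h; apply: (is_derive_eq h); rewrite /f; ring.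
Qed.

Lemma integral_energy_derivative :
  (\int[mu]_(t in `[0%R, 1%R]) (f t)%:E = ((energy 0 + energy 1) / 2)%:E)%E.
Proof.
have [_ P0 P1] := (continuous_within_itvP _ ltr01).1 contPhi.
(* At the end points t (1 - t) vanishes and t - 1/2 equals -1/2 and 1/2. *)
rewrite (@continuous_FTC2 _ f Phi 0 1 ltr01 contf).
- by rewrite -EFinB /Phi !NE; congr (_%:E); field.
- by split => // t t01; have [] := derPhi t01.
- by move=> t t01; rewrite derive1E; have [] := derPhi t01.
Qed.

Lemma energy_curve : exists f : R -> R,
  [/\ {within I, continuous f}, {within I, continuous energy},
   (\int[mu]_(t in `[0%R, 1%R]) (f t)%:E = ((energy 0 + energy 1) / 2)%:E)%E &
   forall t, I t ->
     let h := fun z => expw al ga z * (w' t z + F t 3 0 z + F t 1 2 z) in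
     L2 h -> energy t <= 2 * f t + ip h h].
Proof.
exists f; split.
- exact: contf.
- by rewrite (_ : energy = N) ?contN//; apply/funext => t; rewrite NE.
- exact: integral_energy_derivative.
- move=> t It h lh.
  have t01 : 0 <= t <= 1 by move: It; rewrite /= in_itv.
  have := @energy_inequality R al ga (F t) (w' t) t (famF It) (curvew' It).1 t01 lh.
  by rewrite -QE -[ip (conjugated _ _ _ _ _) _]/(energy t) -NE.
Qed.

End energy_of_a_curve.

(** * Continuity in time of the derivatives of order at most two *)

Section bounded_families.
Context {R : realType}.
Local Notation I := [set` `[0 : R, 1]].

(** Taken at two times of a curve, this makes integration by parts available for its increments. *)
Lemma famB n (F G : nat -> nat -> R * R -> R) : deriv_family n F -> deriv_family n G ->
  deriv_family n (fun a b z => F a b z + -1 * G a b z).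
Proof.
move=> fF fG a b ab; have dF := fam_dec fF; have dG := fam_dec fG; split.
- by apply: decD; [exact: dF|apply: decZ; exact: dG].
- move=> abn; apply: wdx_lin.
  + exact: dF.
  + by apply: dF; rewrite addSn.
  + exact: dG.
  + by apply: dG; rewrite addSn.
  + exact: fam_wdx fF abn.
  + exact: fam_wdx fG abn.
- move=> abn; apply: wdy_lin.
  + exact: dF.
  + by apply: dF; rewrite addnS.
  + exact: dG.
  + by apply: dG; rewrite addnS.
  + exact: fam_wdy fF abn.
  + exact: fam_wdy fG abn.
Qed.

Variables (F : R -> nat -> nat -> R * R -> R).
Hypothesis famF : forall t, I t -> deriv_family 3 (F t).
Hypothesis bndF : forall a b, (a + b <= 3)%N -> forall beta : R, 0 < beta ->
  exists C : R, forall t, I t -> \int2_ z (F t a b z ^+ 2 * exp_weight beta z) <= C.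
Hypothesis cvgF : forall t, I t ->
  nsq (fun z => F s 0 0 z - F t 0 0 z) @[s --> within I (nbhs t)] --> 0.

Let D s t a b z := F s a b z + -1 * F t a b z.

Let lD s t a b : I s -> I t -> (a + b <= 3)%N -> L2 (D s t a b).
Proof. by move=> Is It ab; apply: dec_L2; exact: fam_dec (famB (famF Is) (famF It)) ab. Qed.

Let bD a b : (a + b <= 3)%N -> exists C : R,
  forall s t, I s -> I t -> nsq (D s t a b) <= C.
Proof.
move=> ab; have b0 : 0 < `|0 : R| + `|0 : R| + 1 by rewrite normr0 !add0r.
have [C hC] := bndF ab b0.
have h t : I t -> nsq (F t a b) <= C.
  move=> It; apply: le_trans (hC t It).
  have := nsq_expw_le 0 0 (fam_dec (famF It) ab).
  by rewrite (_ : nsq _ = nsq (F t a b))//; apply: eq_Rint => z; rewrite expw00; ring.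
exists (4 * C) => s t Is It.
have ls := dec_L2 (fam_dec (famF Is) ab); have lt := dec_L2 (fam_dec (famF It) ab).
apply: (le_trans (nsqD_le ls (L2Z (-1) lt))).
by rewrite nsqZ// sqrrN expr1n mul1r; have := h s Is; have := h t It; lra.
Qed.

Let DE s t a b : (fun z => F s a b z - F t a b z) = D s t a b.
Proof. by apply/funext => z; rewrite /D mulN1r. Qed.

Let interp t (a b a' b' a'' b'' : nat) : I t ->
  (a + b <= 3)%N -> (a'' + b'' <= 3)%N ->
  (forall s, I s -> nsq (D s t a' b') = - ip (D s t a b) (D s t a'' b'')) ->
  nsq (D s t a b) @[s --> within I (nbhs t)] --> 0 ->
  nsq (D s t a' b') @[s --> within I (nbhs t)] --> 0.
Proof.
move=> It ab ab'' H cD; have [C hC] := bD ab''.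
apply: (@squeeze_cvgr _ _ _ _ (fun=> 0) (fun s => Num.sqrt (nsq (D s t a b) * C))).
- apply: near_within_itv => s Is; rewrite nsq_ge0/= H//.
  rewrite (le_trans (ler_norm _))// normrN.
  apply: (le_trans (norm_ip_le (lD Is It ab) (lD Is It ab''))).
  have hs := hC s t Is It.
  rewrite ler_sqrt ?ler_wpM2l ?nsq_ge0// mulr_ge0 ?nsq_ge0//.
  exact: le_trans (nsq_ge0 _) hs.
- exact: cvg_cst.
- rewrite [X in _ --> X](_ : 0 = Num.sqrt (0 * C)); last by rewrite mul0r sqrtr0.
  apply: continuous_cvg; first exact: sqrt_continuous.
  by apply: cvgM => //; exact: cvg_cst.
Qed.

(* The L2 continuity of the derivatives of order one and two follows from that
   of F 0 0 by |d'|^2 = -<d, d''>, all derivatives being bounded. *)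
Lemma fam_curve a b : (a + b <= 2)%N -> Wcurve (fun t => F t a b).
Proof.
move=> ab; have ab3 : (a + b <= 3)%N by exact: leqW.
apply: bounded_Wcurve.
- by move=> t It; exact: fam_dec (famF It) ab3.
- exact: bndF ab3.
move=> t It; under eq_fun do rewrite DE.
have fD s (Is : I s) := famB (famF Is) (famF It).
have h00 : nsq (D s t 0 0) @[s --> within I (nbhs t)] --> 0.
  by under eq_fun do rewrite -DE; exact: cvgF.
have h10 : nsq (D s t 1 0) @[s --> within I (nbhs t)] --> 0.
  apply: (@interp t 0 0 1 0 2 0) h00 => // s Is.
  exact: (@ip_famx _ _ _ _ (fD s Is) (fD s Is) 0 0 1 0).
have h01 : nsq (D s t 0 1) @[s --> within I (nbhs t)] --> 0.
  apply: (@interp t 0 0 0 1 0 2) h00 => // s Is.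
  exact: (@ip_famy _ _ _ _ (fD s Is) (fD s Is) 0 0 0 1).
have hx a' b' : (a' + b' <= 1)%N -> nsq (D s t a' b') @[s --> within I (nbhs t)] --> 0 ->
    nsq (D s t a'.+1 b') @[s --> within I (nbhs t)] --> 0.
  move=> ab'; apply: (@interp t a' b' a'.+1 b' a'.+2 b') => //; first exact: leqW (leqW _).
  move=> s Is; apply: (@ip_famx _ _ _ _ (fD s Is) (fD s Is) a' b' a'.+1 b').
    exact: leqW.
  by rewrite addSn.
have h02 : nsq (D s t 0 2) @[s --> within I (nbhs t)] --> 0.
  apply: (@interp t 0 1 0 2 0 3) h01 => // s Is.
  exact: (@ip_famy _ _ _ _ (fD s Is) (fD s Is) 0 1 0 2).
by move: ab {ab3}; case: a => [|[|[|a]]]; case: b => [|[|[|b]]] //= _; apply: hx.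
Qed.

End bounded_families.

(** * Proof of the theorem *)

Section square_roots_of_extended_reals.
Context {R : realType}.
Implicit Types x y : \bar R.

Lemma poweR_half x : (0 <= x)%E ->
  (x `^ 2^-1)%E = if x is r%:E then (Num.sqrt r)%:E else +oo%E.
Proof.
case: x => [r r0||//]; first by rewrite poweR_EFin powR12_sqrt.
by move=> _; rewrite poweRyr// invr_eq0.
Qed.

Lemma poweR_half_le x (M : R) :
  (0 <= x)%E -> (x `^ 2^-1 <= M%:E)%E -> (x <= (M ^+ 2)%:E)%E.
Proof.
move=> x0; rewrite poweR_half//; case: x x0 => [r|//|//].
rewrite !lee_fin => r0 rM; rewrite -(sqr_sqrtr r0) lerXn2r// nnegrE ?sqrtr_ge0//.
exact: le_trans (sqrtr_ge0 _) rM.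
Qed.

Lemma poweR_half_lty x : (0 <= x)%E -> (x `^ 2^-1 < +oo)%E -> (x < +oo)%E.
Proof. by move=> x0; rewrite poweR_half//; case: x x0 => // r _ _; exact: ltry. Qed.

Lemma poweR_half_mono x y :
  (0 <= x)%E -> (x <= y)%E -> (x `^ 2^-1 <= y `^ 2^-1)%E.
Proof.
move=> x0 xy; have y0 := le_trans x0 xy; rewrite !poweR_half//.
case: y xy y0 => [s||//]; last by move=> _ _; rewrite leey.
case: x x0 => [r|//|//]; rewrite !lee_fin => r0 rs s0.
by rewrite ler_sqrt.
Qed.

Lemma poweR_halfD x y : (0 <= x)%E -> (0 <= y)%E ->
  ((x + y) `^ 2^-1 <= x `^ 2^-1 + y `^ 2^-1)%E.
Proof.
move=> x0 y0; have xy0 := adde_ge0 x0 y0; rewrite !poweR_half//.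
case: x y x0 y0 xy0 => [r||//] [s||//] //.
rewrite !lee_fin => r0 s0 rs0.
rewrite -[leRHS]ger0_norm ?addr_ge0 ?sqrtr_ge0// -sqrtr_sqr ler_sqrt ?sqr_ge0//.
rewrite sqrrD !sqr_sqrtr// lerD2r lerDl.
by rewrite mulrn_wge0// mulr_ge0 ?sqrtr_ge0.
Qed.

End square_roots_of_extended_reals.

Section complex_measurability.
Context {R : realType}.
Implicit Types f g : R * R -> R[i].
Local Notation normc := ComplexField.Normc.normc.

Lemma ReD (c d : R[i]) : complex.Re (c + d) = complex.Re c + complex.Re d.
Proof. by case: c; case: d. Qed.
Lemma ImD (c d : R[i]) : complex.Im (c + d) = complex.Im c + complex.Im d.
Proof. by case: c; case: d. Qed.
Lemma ReB (c d : R[i]) : complex.Re (c - d) = complex.Re c - complex.Re d.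
Proof. by case: c; case: d. Qed.
Lemma ImB (c d : R[i]) : complex.Im (c - d) = complex.Im c - complex.Im d.
Proof. by case: c; case: d. Qed.
Lemma ReZ (r : R) (c : R[i]) : complex.Re (r%:C * c) = r * complex.Re c.
Proof. by case: c => x y /=; rewrite mul0r subr0. Qed.
Lemma ImZ (r : R) (c : R[i]) : complex.Im (r%:C * c) = r * complex.Im c.
Proof. by case: c => x y /=; rewrite mul0r addr0. Qed.

Lemma normc_sqr (c : R[i]) : normc c ^+ 2 = complex.Re c ^+ 2 + complex.Im c ^+ 2.
Proof. by case: c => x y /=; rewrite sqr_sqrtr// addr_ge0// sqr_ge0. Qed.

Lemma cmeasurableD f g : cmeasurable f -> cmeasurable g ->
  cmeasurable (fun z => f z + g z).
Proof.
move=> [fr fi] [gr gi]; split.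
  by under eq_fun do rewrite ReD; exact: measurable_funD.
by under eq_fun do rewrite ImD; exact: measurable_funD.
Qed.

Lemma cmeasurableB f g : cmeasurable f -> cmeasurable g ->
  cmeasurable (fun z => f z - g z).
Proof.
move=> [fr fi] [gr gi]; split.
  by under eq_fun do rewrite ReB; exact: measurable_funB.
by under eq_fun do rewrite ImB; exact: measurable_funB.
Qed.

Lemma cmeasurableM (k : R * R -> R) f : measurable_fun setT k -> cmeasurable f ->
  cmeasurable (fun z => (k z)%:C * f z).
Proof.
move=> mk [fr fi]; split.
  by under eq_fun do rewrite ReZ; exact: measurable_funM.
by under eq_fun do rewrite ImZ; exact: measurable_funM.
Qed.

End complex_measurability.

Section real_components.
Context {R : realType}.
Local Notation normc := ComplexField.Normc.normc.
Local Notation I := [set` `[0 : R, 1]].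

(** The properties of the real and imaginary parts on which the real argument rests, so that it is
    carried out once for both. *)
Definition component (cc : R[i] -> R) :=
  [/\ forall c, `|cc c| <= normc c,
      forall f : R * R -> R[i], cmeasurable f -> measurable_fun setT (fun z => cc (f z)),
      (forall c d, cc (c - d) = cc c - cc d) /\
      (forall (r : R) c, cc (r%:C * c) = r * cc c) &
      forall p q f g, is_wderiv p q f g ->
        rwd p q (fun z => cc (f z)) (fun z => cc (g z))].

Lemma component_Re : component (@complex.Re R).
Proof.
split; first exact: normc_ge_Re.
- by move=> f [].
- by split; [exact: ReB|exact: ReZ].
- by move=> p q f g /is_wderiv_rwd[].
Qed.

Lemma component_Im : component (@complex.Im R).
Proof.
split; first exact: normc_ge_Im.
- by move=> f [].
- by split; [exact: ImB|exact: ImZ].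
- by move=> p q f g /is_wderiv_rwd[].
Qed.

Variables (cc : R[i] -> R) (ccP : component cc).

Let cc_le c : `|cc c| <= normc c. Proof. by have [] := ccP. Qed.
Let cc_meas f : cmeasurable f -> measurable_fun setT (fun z : R * R => cc (f z)).
Proof. by have [_ h _ _] := ccP; exact: h. Qed.
Let ccB c d : cc (c - d) = cc c - cc d. Proof. by have [_ _ []] := ccP. Qed.
Let ccZ (r : R) c : cc (r%:C * c) = r * cc c. Proof. by have [_ _ []] := ccP. Qed.

Lemma cc_int f (om : R * R -> R) : cmeasurable f -> measurable_fun setT om ->
  (forall z, 0 <= om z) ->
  (\int[@leb2 R]_z (normc (f z) ^+ 2 * om z)%:E < +oo)%E ->
  rintegrable2 (fun z => cc (f z) ^+ 2 * om z) /\
  ((\int2_ z (cc (f z) ^+ 2 * om z))%:E <=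
    \int[@leb2 R]_z (normc (f z) ^+ 2 * om z)%:E)%E.
Proof.
move=> mf mom om0 foo.
have mn : measurable_fun setT (fun z => normc (f z) ^+ 2 * om z).
  by apply: measurable_funM => //; apply: measurable_funX; exact: measurable_normc.
have iN : rintegrable2 (fun z => normc (f z) ^+ 2 * om z).
  apply/integrableP; split; first exact/measurable_EFinP.
  rewrite (eq_integral (fun z => (normc (f z) ^+ 2 * om z)%:E))// => z _.
  by rewrite /= ger0_norm// mulr_ge0 ?sqr_ge0 ?om0.
have le z : cc (f z) ^+ 2 * om z <= normc (f z) ^+ 2 * om z.
  rewrite ler_wpM2r// -real_normK ?num_real// lerXn2r// nnegrE//.
  by case: (f z) => x y; exact: sqrtr_ge0.
have iC : rintegrable2 (fun z => cc (f z) ^+ 2 * om z).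
  apply: (rintegrable_le (mu := @leb2 R) _ iN).
    by apply: measurable_funM => //; apply: measurable_funX; exact: cc_meas.
  by move=> z; rewrite ger0_norm// mulr_ge0// sqr_ge0.
split => //.
have -> : (\int[@leb2 R]_z (normc (f z) ^+ 2 * om z)%:E =
    (\int2_ z (normc (f z) ^+ 2 * om z))%:E)%E.
  by rewrite /Rintegral fineK//; exact: integrable_fin_num iN.
by rewrite lee_fin; apply: le_Rintegral.
Qed.

Lemma L2norm_ge0 (om : R * R -> R) f : (0 <= L2norm om f)%E.
Proof. exact: poweR_ge0. Qed.

Lemma sqr_integral_ge0 (om : R * R -> R) f : (forall z, 0 <= om z) ->
  (0 <= \int[@leb2 R]_z (normc (f z) ^+ 2 * om z)%:E)%E.
Proof. by move=> om0; apply: integral_ge0 => z _; rewrite lee_fin mulr_ge0// sqr_ge0. Qed.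

Lemma cc_L2 f : cmeasurable f -> (L2norm (@unit_weight R) f < +oo)%E ->
  L2 (fun z => cc (f z)) /\
  nsq (fun z => cc (f z)) <= fine (L2norm (@unit_weight R) f) ^+ 2.
Proof.
move=> mf foo.
have i0 := @sqr_integral_ge0 (@unit_weight R) f (fun=> ler01).
have [i1 i2] := cc_int mf (measurable_cst _) (fun=> ler01) (poweR_half_lty i0 foo).
split.
  split; first exact: cc_meas.
  by move: i1; under eq_fun do rewrite mulr1.
rewrite -lee_fin; apply: (@le_trans _ _
  (\int[@leb2 R]_z (normc (f z) ^+ 2 * unit_weight z)%:E)%E).
  apply: le_trans i2; rewrite lee_fin le_eqVlt; apply/orP; left; apply/eqP.
  by apply: eq_Rint => z; rewrite /unit_weight mulr1 expr2.
apply: poweR_half_le => //; rewrite fineK//.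
by rewrite ge0_fin_numE// L2norm_ge0.
Qed.

Lemma cc_cvg (F : set_system R) (FF : Filter F) (g_ : R -> R * R -> R[i]) :
  (\forall s \near F, cmeasurable (g_ s)) ->
  L2norm (@unit_weight R) (g_ s) @[s --> F] --> 0%E ->
  nsq (fun z => cc (g_ s z)) @[s --> F] --> 0.
Proof.
move=> mg /fine_cvgP[fin c0].
apply: (@squeeze_cvgr _ _ _ _ (fun=> 0)
  (fun s => fine (L2norm (@unit_weight R) (g_ s)) ^+ 2)).
- near=> s; rewrite nsq_ge0/=.
  have fs : L2norm (@unit_weight R) (g_ s) \is a fin_num by near: s.
  apply: (cc_L2 _ _).2; first by near: s.
  by rewrite ltey_eq fs.
- exact: cvg_cst.
- rewrite [X in _ --> X](_ : 0 = 0 * 0); last by rewrite mul0r.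
  by apply: cvgM; exact: c0.
Unshelve. all: by end_near. Qed.

Lemma nsq_ae (f g : R * R -> R) : measurable_fun setT f -> measurable_fun setT g ->
  {ae @leb2 R, forall z, f z = g z} -> nsq f = nsq g.
Proof.
move=> mf mg fg; apply: (ae_eq_Rint (mu := @leb2 R)).
- exact: measurable_funM.
- exact: measurable_funM.
- by move: fg; apply: ae_imp => z ->.
Qed.

Lemma L2_ae (f g : R * R -> R) : L2 f -> measurable_fun setT g ->
  {ae @leb2 R, forall z, f z = g z} -> L2 g.
Proof.
move=> [mf intf] mg fg; split => //; apply/integrableP; split.
  by apply/measurable_EFinP; exact: measurable_funX.
have /integrableP[_] := intf; apply: le_lt_trans.
rewrite le_eqVlt; apply/orP; left; apply/eqP; apply: ae_eq_integral => //.
- by apply/measurable_EFinP; apply: measurableT_comp => //; exact: measurable_funX.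
- by apply/measurable_EFinP; apply: measurableT_comp => //; exact: measurable_funX.
- by move: fg; apply: ae_imp => z /= -> _.
Qed.

Variables w w' : R -> R * R -> R[i].
Hypothesis w_C1L2 : C1_L2 w w'.
Hypothesis w_decay : forall beta : R, 0 < beta -> bounded_in_H (exp_weight beta) 3 w.

(** The entry (0, 0) too is a chosen weak derivative; [component_ae] relates it to w t. *)
Let F t a b z := cc (wderiv a b (w t) z).

Let wderivP t a b : I t -> (a + b <= 3)%N -> is_wderiv a b (w t) (wderiv a b (w t)).
Proof.
move=> It ab; have [H _] := w_decay ltr01; have [ex _] := H t It a b ab.
exact: (xgetPex _ ex).
Qed.

Let inL2W t a b (beta : R) : 0 < beta -> I t -> (a + b <= 3)%N ->
  inL2 (exp_weight beta) (wderiv a b (w t)).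
Proof. by move=> b0 It ab; have [H _] := w_decay b0; have [_] := H t It a b ab. Qed.

Let loc2F t a b : I t -> (a + b <= 3)%N -> loc2 (F t a b).
Proof.
move=> It ab; have [_ lg _] := wderivP It ab.
by apply: locally_integrable2_loc2 => //; apply: cc_meas; exact: lg.1.
Qed.

Let decF t a b : I t -> (a + b <= 3)%N -> exp_decaying (F t a b).
Proof.
move=> It ab; split; first exact: (loc2F It ab).1.
move=> beta b0; have [mW foo] := inL2W b0 It ab.
have e0 z : 0 <= exp_weight beta z by exact: ltW (exp_weight_gt0 _ _).
have i0 := sqr_integral_ge0 (wderiv a b (w t)) e0.
exact: (cc_int mW (measurable_exp_weight beta) e0 (poweR_half_lty i0 foo)).1.
Qed.

Let rwdF t a b : I t -> (a + b <= 3)%N -> rwd a b (fun z => cc (w t z)) (F t a b).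
Proof. by move=> It ab; have [_ _ _ h] := ccP; exact: h (wderivP It ab). Qed.

Let famF t : I t -> deriv_family 3 (F t).
Proof.
move=> It a b ab; split; first exact: decF.
- by move=> ab3; apply: rwd_wdx (rwdF It ab) (rwdF It _); rewrite addSn.
- by move=> ab3; apply: rwd_wdy (rwdF It ab) (rwdF It _); rewrite addnS.
Qed.

Lemma L2norm_le_Hnorm (om : R * R -> R) k a b f : (a + b <= k)%N ->
  (L2norm om (wderiv a b f) <= Hnorm om k f)%E.
Proof.
move=> ab; have ak : (a < k.+1)%N by rewrite ltnS (leq_trans (leq_addr b a)).
have bk : (b < k.+1)%N by rewrite ltnS (leq_trans (leq_addl a b)).
rewrite /Hnorm (bigD1 (Ordinal ak))//= (bigD1 (Ordinal bk))//= -addeA leeDl//.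
by rewrite adde_ge0//; apply: sume_ge0 => i _; rewrite ?sume_ge0// => *; exact: L2norm_ge0.
Qed.

Let bndF a b : (a + b <= 3)%N -> forall beta : R, 0 < beta ->
  exists C : R, forall t, I t -> \int2_ z (F t a b z ^+ 2 * exp_weight beta z) <= C.
Proof.
move=> ab beta b0; have [_] := w_decay b0.
set M := ereal_sup _ => Moo.
have leM t : I t -> (L2norm (exp_weight beta) (wderiv a b (w t)) <= M)%E.
  move=> It; apply: (le_trans (L2norm_le_Hnorm _ _ ab)).
  by apply: ereal_sup_ubound; exists t.
exists (fine M ^+ 2) => t It.
have M0 : (0 <= M)%E by exact: le_trans (L2norm_ge0 _ _) (leM t It).
have [mW foo] := inL2W b0 It ab.
have e0 z : 0 <= exp_weight beta z by exact: ltW (exp_weight_gt0 _ _).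
have i0 := sqr_integral_ge0 (wderiv a b (w t)) e0.
have [_ h] := cc_int mW (measurable_exp_weight beta) e0 (poweR_half_lty i0 foo).
rewrite -lee_fin; apply: (le_trans h); apply: poweR_half_le => //.
by rewrite fineK ?leM// ge0_fin_numE.
Qed.

Let cmw t : I t -> cmeasurable (w t).
Proof. by move=> It; have [[h _] _ _] := w_C1L2; have [] := h t It. Qed.

Let cmw' t : I t -> cmeasurable (w' t).
Proof. by move=> It; have [_ [h _] _] := w_C1L2; have [] := h t It. Qed.

Lemma component_ae t : I t -> {ae @leb2 R, forall z, F t 0 0 z = cc (w t z)}.
Proof.
move=> It; have [lw _ _] := wderivP It (isT : (0 + 0 <= 3)%N).
have r0 := rwdF It (isT : (0 + 0 <= 3)%N).
have l0 := loc2F It (isT : (0 + 0 <= 3)%N).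
have l1 : loc2 (fun z => cc (w t z)).
  exact: locally_integrable2_loc2 cc_le (cc_meas (cmw It)) lw.
have r1 : rwd 0 0 (fun z => cc (w t z)) (fun z => cc (w t z)).
  by move=> a b _ _ _ _ /=; rewrite expr0 mul1r.
exact: rwd_unique l0 l1 r0 r1.
Qed.

Let mF00 t : I t -> measurable_fun setT (F t 0 0).
Proof. by move=> It; exact: (loc2F It (isT : (0 + 0 <= 3)%N)).1. Qed.

Let cvgF t : I t ->
  nsq (fun z => F s 0 0 z - F t 0 0 z) @[s --> within I (nbhs t)] --> 0.
Proof.
move=> It; have [[_ h] _ _] := w_C1L2.
have H : nsq (fun z => cc (w s z - w t z)) @[s --> within I (nbhs t)] --> 0.
  apply: cc_cvg; last exact: h.
  by apply: near_within_itv => s Is; apply: cmeasurableB; exact: cmw.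
apply: cvg_trans H; apply: near_eq_cvg; apply: near_within_itv => s Is.
apply: nsq_ae.
- by apply: cc_meas; apply: cmeasurableB; exact: cmw.
- by apply: measurable_funB; exact: mF00.
- move: (ae_and (component_ae Is) (component_ae It)); apply: ae_imp => z [-> ->].
  exact: ccB.
Qed.

Let curvew' : L2curve (fun t z => cc (w' t z)).
Proof.
move=> t It; have [_ [h1 h2] _] := w_C1L2; have [m1 l1] := h1 t It.
split; first exact: (cc_L2 m1 l1).1.
under eq_fun do under eq_fun do rewrite -ccB.
apply: cc_cvg; last exact: h2.
by apply: near_within_itv => s Is; apply: cmeasurableB; exact: cmw'.
Qed.

Let derw t : I t ->
  nsq (fun z => (s - t)^-1 * (F s 0 0 z - F t 0 0 z) - cc (w' t z))
    @[s --> within I t^'] --> 0.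
Proof.
move=> It; have [_ _ h] := w_C1L2.
have cm s : I s -> cmeasurable (fun z => ((s - t)^-1)%:C * (w s z - w t z) - w' t z).
  move=> Is; apply: cmeasurableB; last exact: cmw'.
  by apply: (@cmeasurableM _ (fun=> _)) => //; apply: cmeasurableB; exact: cmw.
have H : nsq (fun z => cc (((s - t)^-1)%:C * (w s z - w t z) - w' t z))
    @[s --> within I t^'] --> 0.
  apply: cc_cvg; last exact: h.
  exact: near_within_ditv.
apply: cvg_trans H; apply: near_eq_cvg; apply: near_within_ditv => s Is.
apply: nsq_ae.
- exact: cc_meas (cm s Is).
- apply: measurable_funB; last by apply: cc_meas; exact: cmw'.
  by apply: measurable_funM => //; apply: measurable_funB; exact: mF00.
- move: (ae_and (component_ae Is) (component_ae It)); apply: ae_imp => z [-> ->].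
  by rewrite ccB ccZ ccB.
Qed.

Lemma component_energy (al ga : R) : exists e f : R -> R,
  [/\ {within I, continuous f}, {within I, continuous e},
    (\int[@lebesgue_measure R]_(t in `[0%R, 1%R]) (f t)%:E = ((e 0 + e 1) / 2)%:E)%E,
    forall t, I t -> L2 (fun z => expw al ga z * cc (w t z)) /\
      e t = nsq (fun z => expw al ga z * cc (w t z)) &
    forall t, I t ->
     let h := fun z => expw al ga z *
       (cc (w' t z) + cc (wderiv 3 0 (w t) z) + cc (wderiv 1 2 (w t) z)) in
     L2 h -> e t <= 2 * f t + nsq h].
Proof.
have [f [cf ce intf H]] := energy_curve famF (fam_curve famF bndF cvgF) curvew' derw al ga.
exists (energy F al ga), f; split => // t It.
have mEw : measurable_fun setT (fun z => expw al ga z * cc (w t z)).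
  by apply: measurable_funM; [exact: measurable_expw|exact: cc_meas (cmw It)].
have dEF := dec_expw al ga (decF It (isT : (0 + 0 <= 3)%N)).
have ae : {ae @leb2 R, forall z, expw al ga z * F t 0 0 z = expw al ga z * cc (w t z)}.
  by move: (component_ae It); apply: ae_imp => z ->.
split; last exact: nsq_ae dEF.1 mEw ae.
exact: L2_ae (dec_L2 dEF) mEw ae.
Qed.

End real_components.

Section carleman_estimate.
Context {R : realType}.
Local Notation normc := ComplexField.Normc.normc.
Local Notation mu := (@lebesgue_measure R).
Local Notation I := [set` `[0 : R, 1]].

(* The integral of a nonnegative function is a supremum over the simple functions
   below it, so that monotonicity does not rest on measurability. *)
Lemma ge0_le_integral_sup d (T : measurableType d) (m : {measure set T -> \bar R})
    (D : set T) (f g : T -> \bar R) : (forall x, D x -> (0 <= f x)%E) ->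
  (forall x, D x -> (f x <= g x)%E) ->
  (\int[m]_(x in D) f x <= \int[m]_(x in D) g x)%E.
Proof.
move=> f0 fg; rewrite !ge0_integralE//; last first.
  by move=> x Dx; exact: le_trans (f0 x Dx) (fg x Dx).
apply: le_ereal_sup => _ [h hf <-]; exists h => // x.
by apply: (le_trans (hf x)); exact: lee_restrict.
Qed.

Variables al ga : R.
Local Notation EC := (fun z : R * R => (expw al ga z)%:C).

Lemma cmeasurable_EC (g : R * R -> R[i]) : cmeasurable g ->
  cmeasurable (fun z => EC z * g z).
Proof. by apply: cmeasurableM; exact: measurable_expw. Qed.

Lemma normc_EC (g : R * R -> R[i]) z : normc (EC z * g z) ^+ 2 =
  (expw al ga z * complex.Re (g z)) ^+ 2 + (expw al ga z * complex.Im (g z)) ^+ 2.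
Proof. by rewrite normc_sqr ReZ ImZ. Qed.

Lemma integral_normc_EC (g : R * R -> R[i]) :
  L2 (fun z => expw al ga z * complex.Re (g z)) ->
  L2 (fun z => expw al ga z * complex.Im (g z)) ->
  (\int[@leb2 R]_z (normc (EC z * g z) ^+ 2)%:E)%E =
  (nsq (fun z => expw al ga z * complex.Re (g z)) +
   nsq (fun z => expw al ga z * complex.Im (g z)))%:E.
Proof.
move=> [_ lr] [_ li].
have -> : nsq (fun z => expw al ga z * complex.Re (g z)) +
    nsq (fun z => expw al ga z * complex.Im (g z)) =
    \int2_ z ((expw al ga z * complex.Re (g z)) ^+ 2 + (expw al ga z * complex.Im (g z)) ^+ 2).
  by rewrite RintD//; congr (_ + _); apply: eq_Rint => z; rewrite expr2.
rewrite /Rintegral fineK; first by apply: eq_integral => z _; rewrite normc_EC.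
by apply: integrable_fin_num => //; exact: (rintegrableD lr li).
Qed.

Lemma L2_of_integral_normc (g : R * R -> R[i]) : cmeasurable g ->
  (\int[@leb2 R]_z (normc (EC z * g z) ^+ 2)%:E < +oo)%E ->
  L2 (fun z => expw al ga z * complex.Re (g z)) /\
  L2 (fun z => expw al ga z * complex.Im (g z)).
Proof.
move=> mg goo; have mE := cmeasurable_EC mg.
have goo' : (\int[@leb2 R]_z (normc (EC z * g z) ^+ 2 * 1)%:E < +oo)%E.
  by under eq_integral do rewrite mulr1.
have H cc (ccP : component cc) : rintegrable2 (fun z => cc (EC z * g z) ^+ 2).
  have [+ _] := cc_int ccP mE (measurable_cst (1 : R)) (fun=> ler01) goo'.
  by under eq_fun do rewrite mulr1.
have hr := H _ component_Re; have hi := H _ component_Im.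
split; split.
- by apply: measurable_funM; [exact: measurable_expw|exact: mg.1].
- by move: hr; under eq_fun do rewrite ReZ.
- by apply: measurable_funM; [exact: measurable_expw|exact: mg.2].
- by move: hi; under eq_fun do rewrite ImZ.
Qed.

Variables w w' : R -> R * R -> R[i].
Hypothesis w_C1L2 : C1_L2 w w'.
Hypothesis w_decay : forall beta : R, 0 < beta -> bounded_in_H (exp_weight beta) 3 w.

Lemma carleman_estimate :
  (st_norm (fun t z => (EC z * w t z)%R) <=
   L2norm (@unit_weight R) (fun z => (EC z * w 0 z)%R) +
   L2norm (@unit_weight R) (fun z => (EC z * w 1 z)%R) +
   st_norm (fun t z => (EC z * (w' t z + wderiv 3 0 (w t) z + wderiv 1 2 (w t) z))%R))%E.
Proof.
have [er [fr [cfr cer ir Er Hr]]] := component_energy component_Re w_C1L2 w_decay al ga.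
have [ei [fi [cfi cei ii Ei Hi]]] := component_energy component_Im w_C1L2 w_decay al ga.
pose Pw t z := w' t z + wderiv 3 0 (w t) z + wderiv 1 2 (w t) z.
pose e t := er t + ei t; pose f t := fr t + fi t.
pose H t := (\int[@leb2 R]_z (normc (EC z * Pw t z) ^+ 2)%:E)%E.
have I0 : I 0 by rewrite /= in_itv/= lexx ler01.
have I1 : I 1 by rewrite /= in_itv/= lexx ler01.
have He t : I t -> (\int[@leb2 R]_z (normc (EC z * w t z) ^+ 2)%:E)%E = (e t)%:E.
  move=> It; have [lr nr] := Er t It; have [li ni] := Ei t It.
  by rewrite integral_normc_EC// -nr -ni.
have mP t : I t -> cmeasurable (Pw t).
  move=> It; have [_ [h _] _] := w_C1L2; have [D _] := w_decay ltr01.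
  have [_ [m30 _]] := D t It 3%N 0%N isT; have [_ [m12 _]] := D t It 1%N 2%N isT.
  by apply: cmeasurableD => //; apply: cmeasurableD => //; have [] := h t It.
have H0 t : (0 <= H t)%E by apply: integral_ge0 => z _; rewrite lee_fin sqr_ge0.
(* Either H t is infinite and the bound is trivial, or both components of the weighted [Pw t] are
   square integrable and the two real inequalities add up. *)
have key t : I t -> ((e t - 2 * f t)%:E <= H t)%E.
  move=> It; have [Hoo|] := ltP (H t) +oo%E; last first.
    by rewrite leye_eq => /eqP ->; exact: leey.
  have [lr li] := L2_of_integral_normc (mP t It) Hoo.
  rewrite /H (integral_normc_EC lr li) lee_fin.
  have Pr : (fun z => expw al ga z * complex.Re (Pw t z)) = fun z => expw al ga z *
     (complex.Re (w' t z) + complex.Re (wderiv 3 0 (w t) z) + complex.Re (wderiv 1 2 (w t) z)).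
    by apply/funext => z; rewrite /Pw !ReD.
  have Pi : (fun z => expw al ga z * complex.Im (Pw t z)) = fun z => expw al ga z *
     (complex.Im (w' t z) + complex.Im (wderiv 3 0 (w t) z) + complex.Im (wderiv 1 2 (w t) z)).
    by apply/funext => z; rewrite /Pw !ImD.
  rewrite Pr in lr *; rewrite Pi in li *.
  by have := Hr t It lr; have := Hi t It li; rewrite /e /f; lra.
have int_cont (g : R -> R) : {within I, continuous g} -> mu.-integrable I (EFin \o g).
  by move=> cg; apply: continuous_compact_integrable => //; exact: segment_compact.
have ie : mu.-integrable I (EFin \o e).
  by apply: int_cont => x; apply: cvgD; [exact: cer|exact: cei].
have if_ : mu.-integrable I (EFin \o f).
  by apply: int_cont => x; apply: cvgD; [exact: cfr|exact: cfi].
have intf : (\int[mu]_(t in I) (f t)%:E = ((e 0 + e 1) / 2)%:E)%E.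
  rewrite /f; under eq_integral do rewrite EFinD.
  rewrite integralD//; [|exact: int_cont|exact: int_cont].
  by rewrite ir ii -EFinD /e; congr (_%:E); field.
pose k t := e t - 2 * f t.
have ik : mu.-integrable I (EFin \o k).
  have i2 : mu.-integrable I (EFin \o (fun t => 2 * f t)).
    by apply: eq_integrable (integrableZl _ 2 if_).
  by apply: eq_integrable (integrableB _ ie i2).
(* No measurability of H in t is at hand, and k may be negative. The positive part of k lies below H
   because H is nonnegative, and for nonnegative functions [ge0_le_integral_sup] compares the
   integrals. *)
have intk : (\int[mu]_(t in I) (k t)%:E <= \int[mu]_(t in I) H t)%E.
  apply: (@le_trans _ _ (\int[mu]_(t in I) (Num.max (k t) 0)%:E)%E).
    apply: le_integral => //; last first.
      by move=> t _; rewrite lee_fin le_max lexx.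
    apply: le_integrable (integrable_abse ik) => //.
      apply/measurable_EFinP; apply: measurable_maxr => //.
      by apply/measurable_EFinP; exact: measurable_int ik.
    move=> t _; rewrite /= lee_fin normr_id ger0_norm ?le_max ?lexx ?orbT//.
    by rewrite ge_max ler_norm normr_ge0.
  apply: ge0_le_integral_sup => t It; first by rewrite lee_fin le_max lexx orbT.
  case: (leP (k t) 0) => kt; first exact: H0.
  exact: key.
have inte : (\int[mu]_(t in I) (e t)%:E =
    \int[mu]_(t in I) (k t)%:E + (e 0 + e 1)%:E)%E.
  have -> : (e 0 + e 1)%:E = (\int[mu]_(t in I) (2 * f t)%:E)%E :> \bar R.
    under eq_integral do rewrite EFinM.
    by rewrite integralZl// intf -EFinM; congr (_%:E); field.
  have i2 : mu.-integrable I (EFin \o (fun t => 2 * f t)).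
    by apply: eq_integrable (integrableZl _ 2 if_).
  transitivity (\int[mu]_(t in I) ((k t)%:E + (2 * f t)%:E))%E.
    by apply: eq_integral => t _; rewrite -EFinD /k subrK.
  exact: integralD.
have L2E t : I t ->
    L2norm (@unit_weight R) (fun z => EC z * w t z) = ((e t)%:E `^ 2^-1)%E.
  move=> It; rewrite /L2norm -(He t It); congr (_ `^ _)%E.
  by apply: eq_integral => z _; rewrite /unit_weight mulr1.
have e0 t : I t -> (0 <= (e t)%:E)%E.
  by move=> It; rewrite -(He t It); apply: integral_ge0 => z _; rewrite lee_fin sqr_ge0.
rewrite (L2E _ I0) (L2E _ I1) /st_norm -/H.
have -> : (\int[mu]_(t in I) \int[@leb2 R]_z (normc (EC z * w t z) ^+ 2)%:E =
    \int[mu]_(t in I) (e t)%:E)%E.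
  by apply: eq_integral => t; rewrite inE => It; exact: He.
have iH0 : (0 <= \int[mu]_(t in I) H t)%E by exact: integral_ge0.
(* The estimate between squared norms; subadditivity of the square root then yields the one between
   norms. *)
apply: (@le_trans _ _ (((e 0)%:E + (e 1)%:E + \int[mu]_(t in I) H t) `^ 2^-1)%E).
  apply: poweR_half_mono; first by apply: integral_ge0 => t It; exact: e0.
  by rewrite inte addeC EFinD leeD2l.
apply: (le_trans (poweR_halfD (adde_ge0 (e0 _ I0) (e0 _ I1)) iH0)).
by rewrite leeD2r// poweR_halfD// e0.
Qed.

End carleman_estimate.

Theorem theorem4 (R : realType) (w w' : R -> R * R -> R[i])
  (w_C0H3 : C0_H 3 w)
  (w_C1L2 : C1_L2 w w')
  (w_decay : forall beta : R, 0 < beta -> bounded_in_H (exp_weight beta) 3 w)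
  (w'_decay : forall beta : R, 0 < beta -> bochner_L1 (exp_weight beta) w') :
  let Pw := fun (t : R) (z : R * R) =>
    w' t z + wderiv 3 0 (w t) z + wderiv 1 2 (w t) z in
  (forall lambda : R, lambda != 0 ->
    let ex := fun z : R * R => (expR (lambda * z.1))%:C in
    (st_norm (fun t z => (ex z * w t z)%R) <=
     L2norm (@unit_weight R) (fun z => (ex z * w 0%R z)%R) +
     L2norm (@unit_weight R) (fun z => (ex z * w 1%R z)%R) +
     st_norm (fun t z => (ex z * Pw t z)%R))%E) /\
  (forall lambda : R, lambda != 0 ->
    let ey := fun z : R * R => (expR (lambda * z.2))%:C in
    (st_norm (fun t z => (ey z * w t z)%R) <=
     L2norm (@unit_weight R) (fun z => (ey z * w 0%R z)%R) +
     L2norm (@unit_weight R) (fun z => (ey z * w 1%R z)%R) +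
     st_norm (fun t z => (ey z * Pw t z)%R))%E).
Proof.
move=> Pw.
have key al ga (ee : R * R -> R[i]) : (forall z, ee z = (expw al ga z)%:C) ->
    (st_norm (fun t z => (ee z * w t z)%R) <=
     L2norm (@unit_weight R) (fun z => (ee z * w 0%R z)%R) +
     L2norm (@unit_weight R) (fun z => (ee z * w 1%R z)%R) +
     st_norm (fun t z => (ee z * Pw t z)%R))%E.
  by move=> /funext ->; exact: carleman_estimate.
split=> lambda _; [apply: (key lambda 0)|apply: (key 0 lambda)] => z.
  by rewrite /expw mul0r expR0 mulr1.
by rewrite /expw mul0r expR0 mul1r.
Qed.
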